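(* Let $m\le n$ and $a_1<\cdots<a_m$ be positive integers, $\mathcal{A}=\{a_1,\ldots,a_m\}$. Let $\Delta_{m-1}=\{u\in\mathbb{R}^m_{\ge0}:u_1+\cdots+u_m=1\}$ and let $\psi_{\mathcal{A}}:\mathbb{R}^n_{\ge0}\setminus\{0\}\to\Delta_{m-1}$, $x\mapsto\bigl(\sum_{j}\|x\|_{a_j}\bigr)^{-1}(\|x\|_{a_1},\ldots,\|x\|_{a_m})$, where $\|x\|_p=(\sum_i x_i^p)^{1/p}$. For $1\le\ell\le m$ and $\nu=(\nu_1<\cdots<\nu_\ell)$ with $\nu_i\in[n]=\{1,\ldots,n\}$, let $R_\nu$ be the set of $x\in\mathbb{R}^n_{\ge0}$ with $x_1=\cdots=x_{\nu_1}\ge x_{\nu_1+1}=\cdots=x_{\nu_2}\ge\cdots\ge x_{\nu_{\ell-1}+1}=\cdots=x_{\nu_\ell}\ge 0$ and $x_i=0$ for $i>\nu_\ell$, and let $B_\nu=\psi_{\mathcal{A}}(R_\nu\setminus\{0\})$. The type of $\nu$ is the multiset $\{\nu_1,\nu_2-\nu_1,\ldots,\nu_\ell-\nu_{\ell-1}\}$, and $T_{n,\ell}$ denotes the set of partitions with exactly $\ell$ parts of an integer between $\ell$ and $n$. Then: (i) $\mathrm{im}(\psi_{\mathcal{A}})$ is the union of the sets $B_\nu$ for $\nu\in\binom{[n]}{m}$; each $B_\nu$ with $|\nu|=\ell\le m$ is a curvy $(\ell-1)$-simplex, and the curvy facets of the curvy $(m-1)$-simplices $B_\nu$, $\nu\in\binom{[n]}{m}$,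 are the sets $B_\mu$ with $\mu\in\binom{[n]}{m-1}$, $\mu\subset\nu$. The boundary of the semialgebraic set $\mathrm{im}(\psi_{\mathcal{A}})$ is formed by some of these curvy $(m-2)$-simplices $B_\mu$, $\mu\in\binom{[n]}{m-1}$. (ii) If $\mu,\mu'\in\binom{[n]}{m-1}$ have the same type, then $B_\mu$ and $B_{\mu'}$ have the same Zariski closure. Thus the branch hypersurfaces $H_\tau$ (the common Zariski closures of the $B_\mu$ of type $\tau$) are indexed by $\tau\in T_{n,m-1}$.
   Context: $R_\nu$ is an $\ell$-dimensional simplicial polyhedral cone and $\psi_{\mathcal{A}}$ is invariant under positive scaling; a curvy $(\ell-1)$-simplex $B_\nu$ here means the image of $R_\nu\setminus\{0\}$, which is the homeomorphic image of an $(\ell-1)$-simplex (a cross-section of $R_\nu$) under $\psi_{\mathcal{A}}$, its curvy facets being the images of the facets of that simplex. Zariski closures are taken in the affine hyperplane $\{u_1+\cdots+u_m=1\}$. *)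

(* Defs.v *)
From HB Require Import structures.
From mathcomp Require Import all_boot all_order all_algebra.
From mathcomp Require Import all_classical all_reals all_analysis.
From mathcomp Require mpoly.

Set Implicit Arguments.
Unset Strict Implicit.
Unset Printing Implicit Defensive.

Import Order.TTheory GRing.Theory Num.Theory.
Import numFieldNormedType.Exports.

Local Open Scope classical_set_scope.
Local Open Scope ring_scope.

(* Conventions: [n] = {1,...,n} is represented by 'I_n, the ordinal i
   standing for the integer i+1.  Points of R^n are row vectors 'rV[R]_n. *)

Section Defs.
Variable R : realType.

Definition pnorm (n p : nat) (x : 'rV[R]_n) : R :=
  (\sum_(i < n) x ord0 i ^+ p) `^ (p%:R)^-1.

Definition psiA (m n : nat) (a : 'I_m -> nat) (x : 'rV[R]_n) : 'rV[R]_m :=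
  \row_(j < m) (pnorm (a j) x / \sum_(k < m) pnorm (a k) x).

Definition nonneg_orthant (n : nat) : set 'rV[R]_n :=
  [set x | forall i, 0 <= x ord0 i].

Definition psi_dom (n : nat) : set 'rV[R]_n :=
  @nonneg_orthant n `\ (0 : 'rV[R]_n).

Definition sum_one_hyperplane (m : nat) : set 'rV[R]_m :=
  [set u | \sum_(i < m) u ord0 i = 1].

Definition std_simplex (m : nat) : set 'rV[R]_m :=
  @nonneg_orthant m `&` @sum_one_hyperplane m.

(* R_nu for nu a subset of [n] (nu_1 < ... < nu_l its elements):
   x >= 0, x_i = 0 beyond nu_l, and x is constant on each block
   (nu_{k-1}, nu_k] and weakly decreasing from block to block.
   In 0-based indices: x_j >= x_{j+1} always, x_j = x_{j+1} when
   j (0-based) is not in nu, and x_j = 0 if j exceeds every element of nu. *)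
Definition Rcone (n : nat) (nu : {set 'I_n}) : set 'rV[R]_n :=
  [set x | (forall i, 0 <= x ord0 i) /\
           (forall i : 'I_n, (forall k, k \in nu -> (k < i)%N) -> x ord0 i = 0) /\
           (forall i j : 'I_n, j = i.+1 :> nat ->
               x ord0 j <= x ord0 i /\ (i \notin nu -> x ord0 i = x ord0 j))].

Definition Bset (m n : nat) (a : 'I_m -> nat) (nu : {set 'I_n}) : set 'rV[R]_m :=
  psiA a @` (Rcone nu `\ (0 : 'rV[R]_n)).

Definition affinely_independent (n k : nat) (V : 'I_k -> 'rV[R]_n) : Prop :=
  forall lam : 'I_k -> R, \sum_(i < k) lam i = 0 ->
    \sum_(i < k) lam i *: V i = 0 -> forall i, lam i = 0.

Definition conv_on (n k : nat) (P : 'I_k -> bool) (V : 'I_k -> 'rV[R]_n)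
  : set 'rV[R]_n :=
  [set x | exists lam : 'I_k -> R,
     (forall i, 0 <= lam i) /\ (forall i, ~~ P i -> lam i = 0) /\
     \sum_(i < k) lam i = 1 /\ x = \sum_(i < k) lam i *: V i].

Definition simplex_of (n k : nat) (V : 'I_k -> 'rV[R]_n) : set 'rV[R]_n :=
  conv_on xpredT V.

Definition facet_of (n k : nat) (V : 'I_k -> 'rV[R]_n) (j : 'I_k) : set 'rV[R]_n :=
  conv_on (fun i => i != j) V.

Definition cross_section (n k : nat) (C : set 'rV[R]_n) (V : 'I_k -> 'rV[R]_n)
  : Prop :=
  affinely_independent V /\
  simplex_of V `<=` C `\ (0 : 'rV[R]_n) /\
  (forall x, C x -> x != 0 ->
     exists t y, 0 < t /\ simplex_of V y /\ x = t *: y /\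
       forall t' y', 0 < t' -> simplex_of V y' -> x = t' *: y' -> t' = t /\ y' = y).

Definition homeomorphic_on (n m : nat) (f : 'rV[R]_n -> 'rV[R]_m)
  (S : set 'rV[R]_n) : Prop :=
  {within S, continuous f} /\
  exists g : 'rV[R]_m -> 'rV[R]_n,
    (forall x, S x -> g (f x) = x) /\ {within f @` S, continuous g}.

Definition poly_eval (m : nat) (p : mpoly.mpoly m R) (u : 'rV[R]_m) : R :=
  mpoly.meval (fun i => u ord0 i) p.

Definition zariski_closure_H (m : nat) (S : set 'rV[R]_m) : set 'rV[R]_m :=
  [set u | @sum_one_hyperplane m u /\
     forall p : mpoly.mpoly m R, (forall s, S s -> poly_eval p s = 0) ->
       poly_eval p u = 0].

Definition rel_interior_H (m : nat) (S : set 'rV[R]_m) : set 'rV[R]_m :=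
  [set u | S u /\ exists e : R, 0 < e /\
     forall v, @sum_one_hyperplane m v -> ball u e v -> S v].

Definition rel_boundary_H (m : nat) (S : set 'rV[R]_m) : set 'rV[R]_m :=
  closure S `\` rel_interior_H S.

End Defs.

Definition elems1 (n : nat) (nu : {set 'I_n}) : seq nat :=
  sort leq [seq (val i).+1 | i <- enum nu].

Definition block_lengths (n : nat) (nu : {set 'I_n}) : seq nat :=
  pairmap (fun a b => b - a)%N 0%N (elems1 nu).

(* the type of nu: the multiset of block lengths, represented as a
   weakly decreasing sequence (a partition) *)
Definition nu_type (n : nat) (nu : {set 'I_n}) : seq nat :=
  sort geq (block_lengths nu).

Definition T_part (n l : nat) : set (seq nat) :=
  [set lam | sorted geq lam /\ size lam = l /\ all (fun k => 0 < k)%N lam /\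
             (l <= sumn lam <= n)%N].

(* Main.v *)
(** Up to scaling, psi_A is the moment map sending x to its power sums
   p_(a_j)(x) = sum_i x_i^(a_j), and x may be assumed to be decreasing.

   Injectivity on the cones.  By Descartes' rule of signs, a nonzero polynomial
   with k nonzero coefficients cannot take k + 1 values of weakly alternating
   signs at increasing positive points.  If the sequence y_i - x_i changes sign
   at most m - 1 times, one can therefore choose q in the span of the t^(a_j)
   whose derivative changes sign exactly at points separating the intervals
   [x_i, y_i] of opposite orientation.  All terms q(y_i) - q(x_i) then have the
   same sign, so that equal moments force x = y.

   Boundary.  It is the union of the B_mu for which mu satisfies Gale's evenness
   condition.  For x in the cone of such a mu, counting sign changes as above
   shows that the last moment of x is extremal among the points sharing the other
   m - 1 moments.  Conversely, a boundary point of the moment set is a limit of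
   points p(x) nearest to some z outside it.  Moving one coordinate of x, moving
   two equal coordinates apart, and making a zero coordinate positive give
   conditions on the derivative of q(t) = sum_j (z_j - p_(a_j)(x)) t^(a_j): by
   Descartes' rule again, the jumps of x extend to a Gale set of m - 1 elements.

   Union.  The lowest point, with respect to one additional power sum, of a fiber
   of the moment map is on the boundary of the moment set of the m + 1
   exponents, so that the fiber meets the cone of a set of m elements.

   Zariski closures.  Along a segment, a polynomial in the norms is a combination,
   with polynomial coefficients, of products of real powers of polynomials.  Such
   functions satisfy an identity theorem, by induction on the number of terms:
   divide by one of them and differentiate until its coefficient disappears.
   Hence an equation valid on B_mu remains valid when the values of x on its
   blocks are no longer ordered, and these values can be permuted. *)

Require Import Defs.
From HB Require Import structures.
From mathcomp Require Import all_boot all_order all_algebra.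
From mathcomp Require Import polyrcf ring lra zify.

Set Implicit Arguments.
Unset Strict Implicit.
Unset Printing Implicit Defensive.

Import Order.TTheory GRing.Theory Num.Theory.
Local Open Scope ring_scope.

(** * Descartes' rule of signs *)

Section Descartes.
Variable R : rcfType.
Implicit Types (P f : {poly R}) (s t : seq R).

Definition nonzero_coefs P : nat :=
  (\sum_(0 <= i < size P) (P`_i != 0)%R)%N.

Lemma nonzero_coefs_widen P N : (size P <= N)%N ->
  nonzero_coefs P = (\sum_(0 <= i < N) (P`_i != 0)%R)%N.
Proof.
move=> le_PN; rewrite [RHS](big_cat_nat (n := size P)) //=.
rewrite [X in _ = (_ + X)%N]big_nat_cond [X in _ = (_ + X)%N]big1 ?addn0 // => i.
by rewrite andbT => /andP[le_Pi _]; rewrite nth_default ?eqxx.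
Qed.

Lemma nonzero_coefs_le (E : seq nat) P :
  (forall i, P`_i != 0 -> i \in E) -> (nonzero_coefs P <= size E)%N.
Proof.
move=> PE; rewrite /nonzero_coefs -big_mkcond sum1_count /=.
rewrite -size_filter uniq_leq_size ?filter_uniq ?iota_uniq // => i.
by rewrite mem_filter => /andP[/PE].
Qed.

Lemma nonzero_coefs_mulX P : nonzero_coefs (P * 'X) = nonzero_coefs P.
Proof.
rewrite (@nonzero_coefs_widen _ (size P).+1); last first.
  by rewrite (leq_trans (size_polyMleq _ _)) // size_polyX addnC.
rewrite big_nat_recl // coefMX !eqxx add0n.
by apply: eq_bigr => i _; rewrite coefMX.
Qed.

Lemma nonzero_coefs_deriv P : P`_0 != 0 -> nonzero_coefs P = (nonzero_coefs P^`()).+1.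
Proof.
move=> P0; have : (0 < size P)%N by rewrite size_poly_gt0; apply: contra_neq P0 => ->; rewrite coef0.
case sz_P: (size P) => [//|k] _; have le_Pk : (size P <= k.+1)%N by rewrite sz_P.
rewrite (nonzero_coefs_widen le_Pk) big_nat_recl // P0 add1n; congr _.+1.
rewrite (@nonzero_coefs_widen _ k).
  by apply: eq_bigr => i _; rewrite coef_deriv mulrn_eq0.
have [->|nzP] := eqVneq P 0; first by rewrite deriv0 size_poly0.
by rewrite -ltnS (leq_trans (lt_size_deriv nzP)).
Qed.

(** The alternation is weak: a root of [P] satisfies either sign requirement. With [b = false] the
    first value has to be nonnegative. *)
Fixpoint alternating P (b : bool) s : bool :=
  if s is y :: s' then (0 <= (-1) ^+ b * P.[y]) && alternating P (~~ b) s'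
  else true.

Lemma alternating_cat P b s t :
  alternating P b (s ++ t) =
  alternating P b s && alternating P (b (+) odd (size s)) t.
Proof.
elim: s b => [|y s IHs] b /=; first by rewrite addbF.
by rewrite IHs andbA addbN addNb.
Qed.

Lemma alternating_roots P b s : all (root P) s -> alternating P b s.
Proof. by elim: s b => //= y s IHs b /andP[/rootP-> /IHs->]; rewrite mulr0 lexx. Qed.

(** Between two consecutive points the mean value theorem gives a point where the derivative has,
    weakly, the sign required at the second one. One point is lost. *)
Lemma alternating_deriv P b y s : path <%R y s -> alternating P b (y :: s) ->
  exists t, [/\ size t = size s, path <%R y t & alternating P^`() (~~ b) t].
Proof.
elim: s b y => [|z s IHs] b y; first by exists [::].
rewrite [path _ _ _]/=; rewrite [alternating _ _ _]/= => /andP[lt_yz path_z].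
move=> /and3P[Py Pz alt_s].
have [|t [sz_t path_t alt_t]] := IHs (~~ b) z path_z; first by rewrite /= Pz.
have [x] := poly_mvt P lt_yz; rewrite in_itv /= => /andP[lt_yx lt_xz] mvtP.
exists (x :: t); split=> /=; first by rewrite sz_t.
  rewrite lt_yx; apply: (path_le lt_trans lt_xz) path_t.
rewrite alt_t andbT -(pmulr_lge0 _ (_ : 0 < z - y)) ?subr_gt0 //.
by rewrite -mulrA -mvtP; move: Py Pz; case: (b) => /=; rewrite ?(expr1,expr0); lra.
Qed.

Lemma alternating_mulX P b x s : 0 <= x -> path <%R x s ->
  alternating (P * 'X) b s -> alternating P b s.
Proof.
elim: s b x => //= y s IHs b x x0 /andP[lt_xy path_s] /andP[Py alt_s].
have y0 := le_lt_trans x0 lt_xy.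
rewrite (IHs _ _ (ltW y0)) // andbT.
by move: Py; rewrite hornerMX mulrA pmulr_lge0.
Qed.

(* Descartes' bound, with sign alternations counted instead of roots. *)
Lemma alternating_size P b s : P != 0 -> path <%R 0 s -> alternating P b s ->
  (size s <= nonzero_coefs P)%N.
Proof.
have [d] := ubnP (size P); elim: d P b s => // d IHd P b s le_Pd nzP path_s alt_s.
(* If the constant term is zero, dividing by ['X] keeps the signs at positive points. Otherwise
   differentiation removes one coefficient and one point. *)
have [P0|P0] := eqVneq P`_0 0.
  have [Q defP] : exists Q, P = Q * 'X.
    exists (drop_poly 1 P); apply/polyP => -[|i]; rewrite coefMX //=.
    by rewrite coef_drop_poly addn1.
  have nzQ : Q != 0 by apply: contra_neq nzP => Q0; rewrite defP Q0 mul0r.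
  rewrite defP nonzero_coefs_mulX; apply: (IHd _ b) => //.
    by move: le_Pd; rewrite defP size_mulX.
  by move: alt_s; rewrite defP; apply: alternating_mulX path_s.
case: s path_s alt_s => // y s /= /andP[y0 path_s] alt_s.
have [t [sz_t path_t alt_t]] := alternating_deriv path_s alt_s.
rewrite nonzero_coefs_deriv // ltnS.
have [dP0|dP0] := eqVneq P^`() 0; last first.
  rewrite -sz_t; apply: (IHd _ _ _ _ dP0 _ alt_t); last exact: path_le lt_trans _ _ _ y0 path_t.
  exact: leq_trans (lt_size_deriv nzP) _.
have defP : P = (P`_0)%:P.
  apply/polyP => -[|i]; rewrite coefC //=; apply/eqP.
  have /eqP := congr1 (fun Q : {poly R} => Q`_i) dP0.
  by rewrite coef_deriv coef0 mulrn_eq0.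
case: s alt_s {path_s sz_t} => // z s /and3P[].
rewrite defP !hornerC => Py Pz _; case/eqP: P0; apply/le_anti.
by move: Py Pz; case: (b) => /=; rewrite ?(expr1,expr0); lra.
Qed.

Lemma lt_pathE (x : R) s : path <%R x s = all (> x) s && pairwise <%R s.
Proof. by rewrite (path_sortedE lt_trans) (sorted_pairwise lt_trans). Qed.

(* A polynomial with as many positive roots as Descartes' bound permits changes
   sign exactly at these roots: otherwise, they would form together with y and
   a point near infinity a too long alternating sequence. *)
Lemma sign_between_roots f t (y : R) : f != 0 -> path <%R 0 t -> all (root f) t ->
  (nonzero_coefs f <= (size t).+1)%N -> 0 < y -> y \notin t ->
  0 < (-1) ^+ count (> y) t * lead_coef f * f.[y].
Proof.
move=> nzf path_t root_t le_f_t y0 ynt; rewrite ltNge; apply/negP => fy.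
(* [z] lies beyond [y] and all roots, where [f] has the sign of its leading coefficient. *)
pose z := y + cauchy_bound f; pose s := lead_coef f < 0.
have z0 : 0 < z by rewrite addr_gt0 // cauchy_bound_gt0.
have lt_yz : y < z by rewrite ltrDl cauchy_bound_gt0.
have lt_tz : all (< z) t.
  apply/allP => u /(allP root_t) ru /=; rewrite (le_lt_trans (ler_norm u)) //.
  by rewrite (lt_trans (cauchy_boundP nzf (rootP ru))) // ltrDr.
have fz : 0 <= (-1) ^+ s * f.[z].
  have noroot : {in `[cauchy_bound f, +oo[, forall x, ~~ root f x}.
    exact: ge_cauchy_bound.
  have /(_ z) := sgp_pinftyP noroot; rewrite in_itv /= andbT lerDr ltW // => /(_ isT).
  rewrite /sgp_pinfty /s -sgr_ge0 sgrM => ->; rewrite -sgrM sgr_ge0.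
  have [l0|l0] := ltP (lead_coef f) 0; first by rewrite expr1; lra.
  by rewrite mul1r.
have cnt : count (> y) t = size [seq x <- t | y < x] by rewrite size_filter.
pose L := [seq x <- t | x < y] ++ y :: [seq x <- t | y < x] ++ [:: z].
(* The starting sign is the one that suits the last point [z]. The roots suit any sign, and the
   assumed sign at [y] is then the one required at its position. *)
pose b := s (+) odd (size L).-1.
have size_L : size L = (size t).+2.
  rewrite /L !(size_cat, size_filter) /= !(size_cat, size_filter) addn1 !addnS; do 2!congr _.+1.
  rewrite -(count_predC (< y) t); congr addn; apply: eq_in_count => x xt /=.
  have nxy : x != y by apply: contraNneq ynt => <-.
  by case: ltgtP nxy.
suff : (size L <= nonzero_coefs f)%N by rewrite size_L ltnNge le_f_t.
apply: (@alternating_size _ b) => //.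
  rewrite lt_pathE /L; move: path_t; rewrite lt_pathE => /andP[t0 pt].
  have sub_t a : {subset filter a t <= t} by apply: mem_subseq; exact: filter_subseq.
  have lt1 u : u \in [seq x <- t | x < y] -> u < y by rewrite mem_filter => /andP[].
  have lt2 u : u \in [seq x <- t | y < x] -> y < u by rewrite mem_filter => /andP[].
  have all_t (a p : pred R) : all p t -> all p (filter a t).
    by move=> /allP pt'; apply/allP => u /sub_t /pt'.
  have [p1 p2] : all (< y) (filter (< y) t) /\ all (> y) (filter (> y) t).
    by rewrite !filter_all.
  rewrite all_cat /= all_cat /= y0 z0 !(all_t _ _ t0) pairwise_cat /= pairwise_cat.
  rewrite /= !allrel_consr allrel_catr all_cat /= lt_yz !pairwise_filter //.
  rewrite !allrel1r !(all_t _ _ lt_tz) p1 p2 allrel0r /= !andbT.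
  by apply/allrelP => u v /lt1 lt_uy /lt2; apply: lt_trans.
rewrite {1}/L alternating_cat /= alternating_cat /= andbT.
rewrite !alternating_roots ?all_filter; try by apply: sub_all root_t => x /= ->; rewrite implybT.
have size_t : size t = (size [seq x <- t | x < y]%R + size [seq x <- t | y < x]%R)%N.
  by move: size_L; rewrite /L !size_cat /= size_cat /= addn1 !addnS => -[].
rewrite /b size_L /= size_t oddD; rewrite cnt -signr_odd in fy; move: fz fy.
have : 0 <= (-1) ^+ s * lead_coef f.
  by rewrite /s; case: ltP => l0; rewrite ?(expr1, expr0); lra.
have : lead_coef f != 0 by rewrite lead_coef_eq0.
move: (lead_coef f) (odd _) (odd _) (f.[z]) (f.[y]) (s : bool).
move=> l o2 o1 fz' fy' s' l0 sl sfz sfy {b s}.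
have -> : (s' (+) ~~ (o2 (+) o1)) (+) o2 = s' (+) ~~ o1 by case: (s') (o1) (o2) => -[] [].
have -> : ~~ (s' (+) ~~ o1) (+) o1 = s' by case: (s') (o1) => -[].
rewrite sfz andbT.
have {}l0 : 0 < (-1) ^+ s' * l by rewrite lt0r sl mulf_neq0 // signr_eq0.
rewrite -(pmulr_rge0 _ l0) mulrACA; move: sfy; rewrite -mulrA; move: (l * fy') => w.
by case: (s') (o1) => -[]; rewrite /= ?(expr0, expr1); lra.
Qed.
(** The roots suit any sign, so they can be followed by one more point whose value dictates the
    starting sign. *)
Lemma size_roots_lt P t : P != 0 -> path <%R 0 t -> all (root P) t ->
  (size t < nonzero_coefs P)%N.
Proof.
move=> nzP path_t root_t; pose z := last 0 t + 1.
pose b := odd (size t) (+) (P.[z] < 0).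
rewrite -(size_rcons t z); apply: (@alternating_size P b) => //.
  by rewrite rcons_path path_t /= ltrDl ltr01.
rewrite -cats1 alternating_cat alternating_roots //= /b addbAC addbb andbT /=.
by case: ltP => Pz; rewrite ?(expr0, expr1); lra.
Qed.

End Descartes.

(** * Sign changes and power sums *)

Section Comparison.
Variable R : rcfType.
Implicit Types (q f : {poly R}) (e : seq nat) (t : seq R).

Definition power_sum n (x : nat -> R) a := \sum_(i < n) x i ^+ a.

Lemma sum_horner n (x : nat -> R) q e : uniq e -> (forall i, q`_i != 0 -> i \in e) ->
  \sum_(i < n) q.[x i] = \sum_(a <- e) q`_a * power_sum n x a.
Proof.
move=> uniq_e qe; under [RHS]eq_bigr do rewrite mulr_sumr.
rewrite exchange_big /=; apply: eq_bigr => i _; rewrite horner_coef.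
rewrite -(big_mkord xpredT (fun a => q`_a * x i ^+ a)).
rewrite (bigID (mem e)) /= [X in _ + X]big1 ?addr0; last first.
  by move=> a ae; rewrite (_ : q`_a = 0) ?mul0r //; apply: contraNeq ae; apply: qe.
rewrite -big_filter [RHS](bigID (fun a => a < size q)%N) /= [X in _ = _ + X]big1 ?addr0; last first.
  by move=> a; rewrite -leqNgt => /leq_sizeP->; rewrite ?mul0r.
rewrite -[RHS]big_filter; apply: perm_big; apply: uniq_perm.
- by rewrite filter_uniq ?iota_uniq.
- by rewrite filter_uniq.
- by move=> a; rewrite !mem_filter mem_index_iota andbC.
Qed.

(** Roots of the derivative are linear conditions on the coefficients, and there are fewer
    conditions than coefficients. *)
Lemma exists_poly_deriv_roots e t : uniq e -> (size t < size e)%N ->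
  exists q, [/\ q != 0, forall i, q`_i != 0 -> i \in e & all (root q^`()) t].
Proof.
move=> uniq_e lt_te.
pose A := \matrix_(j < size e, k < size t) ('X^(nth 0%N e j))^`().[t`_k].
have kA0 : kermx A != 0.
  by rewrite kermx_eq0 -row_leq_rank -ltnNge (leq_ltn_trans (rank_leq_col A)).
pose v := nz_row (kermx A).
have v0 : v != 0 by rewrite nz_row_eq0.
have vA : v *m A = 0 by apply/sub_kermxP/nz_row_sub.
pose q := \sum_(j < size e) v 0 j *: 'X^(nth 0%N e j).
have coef_q j : q`_(nth 0%N e (val (j : 'I_(size e)))) = v 0 j.
  rewrite coef_sum (bigD1 j) //= big1 ?addr0; last first.
    move=> k nkj; rewrite coefZ coefXn nth_uniq //.
    have /negPf -> : (j != k :> nat) by rewrite eq_sym.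
    by rewrite mulr0.
  by rewrite coefZ coefXn eqxx mulr1.
exists q; split.
- apply: contra_neq v0 => q0; apply/rowP => j.
  by rewrite -coef_q q0 coef0 mxE.
- move=> i; apply: contraNT => ie; rewrite coef_sum big1 // => j _.
  by rewrite coefZ coefXn; case: eqP ie => [->|]; rewrite ?mem_nth ?mulr0.
- apply/(all_nthP 0) => k lt_k; apply/rootP.
  have := congr1 (fun M : 'rV_(size t) => M 0 (Ordinal lt_k)) vA.
  rewrite !mxE => vAk; rewrite -[RHS]vAk raddf_sum horner_sum; apply: eq_bigr => j _.
  by rewrite /= derivZ hornerZ !mxE.
Qed.

(** * Comparison of two decreasing nonnegative sequences *)

Variables (n : nat) (x y : nat -> R).
Hypotheses (x_ge0 : forall i, 0 <= x i) (y_ge0 : forall i, 0 <= y i).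
Hypotheses (x_decr : forall i j, (i <= j)%N -> x j <= x i).
Hypotheses (y_decr : forall i j, (i <= j)%N -> y j <= y i).

Definition diff_sign (b : bool) i := if b then y i < x i else x i < y i.

(* The number of sign changes of the sequence (-1)^b, y 0 - x 0, .., y (k - 1)
   - x (k - 1), zeros being ignored *)
Fixpoint sign_changes b k : nat :=
  if k is k'.+1 then
    (diff_sign (~~ (b (+) odd (sign_changes b k'))) k' + sign_changes b k')%N
  else 0%N.

Let M i := Num.max (x i) (y i).
Let m i := Num.min (x i) (y i).

(** At each counted sign change the upper end of the interval between [x k'] and [y k'] is recorded;
    it lies below all earlier nondegenerate intervals. *)
Fixpoint separators b k : seq R :=
  if k is k'.+1 then
    if diff_sign (~~ (b (+) odd (sign_changes b k'))) k' then M k' :: separators b k'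
    else separators b k'
  else [::].

Lemma size_separators b k : size (separators b k) = sign_changes b k.
Proof. by elim: k => //= k <-; case: ifP. Qed.

Lemma M_decr i j : (i <= j)%N -> M j <= M i.
Proof.
by move=> le_ij; rewrite ge_max !le_max x_decr // y_decr // orbT.
Qed.

(** If for instance y_i < x_i and x_j < y_j, then the upper end y_j of the later interval is at most
    the lower end y_i of the earlier one. *)
Lemma diff_sign_sep b i j : (i <= j)%N -> diff_sign b i -> diff_sign (~~ b) j -> M j <= m i.
Proof.
move=> le_ij; have := x_decr le_ij; have := y_decr le_ij; rewrite /M /m.
by case: b; rewrite /diff_sign /= => *; rewrite ge_max !le_min; apply/andP; split; apply/andP; split; lra.
Qed.

Lemma diff_sign_lt b i : diff_sign b i -> m i < M i.
Proof. by case: b; rewrite /diff_sign /m /M lt_max !gt_min => ->; rewrite ?ltxx ?orbT. Qed.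

(** The parity of the count records the current orientation: an opposite orientation at [i] would
    have been counted. *)
Lemma diff_sign_changes b i : x i != y i -> diff_sign (b (+) odd (sign_changes b i.+1)) i.
Proof.
move=> nxy /=; rewrite oddD oddb; set o := odd _.
have [dc|] := boolP (diff_sign (~~ (b (+) o)) i); first by rewrite /= addbN.
by rewrite /diff_sign; case: ltgtP nxy; case: (b) (o) => -[].
Qed.

(** The first sign change after [i] separates the intervals, and they remain separated because [M]
    decreases. *)
Lemma sign_changes_sep b i j : x i != y i -> (i < j)%N ->
  sign_changes b j = sign_changes b i.+1 \/ M j <= m i.
Proof.
move=> nxy; have si := diff_sign_changes b nxy.
elim: j => // j IHj; rewrite ltnS leq_eqVlt => /predU1P[->|lt_ij]; first by left.
have le_M := M_decr (leqnSn j).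
have [eq_c|?] := IHj lt_ij; last by right; apply: le_trans le_M _.
rewrite [sign_changes b j.+1]/= eq_c; case sj: (diff_sign _ _); [right | by left].
apply: le_trans le_M _; apply: diff_sign_sep si sj; exact: ltnW.
Qed.

Lemma separator_le b i j : x i != y i -> (i < j)%N ->
  diff_sign (~~ (b (+) odd (sign_changes b j))) j -> M j <= m i.
Proof.
move=> nxy lt_ij; have [->|//] := sign_changes_sep b nxy lt_ij.
by apply: diff_sign_sep (diff_sign_changes b nxy); exact: ltnW.
Qed.

Lemma separatorsP b k u : u \in separators b k ->
  exists2 j, (j < k)%N & x j != y j /\ u = M j.
Proof.
elim: k => //= k IHk; case: ifP => [sk|_ /IHk[j lt_jk Hj]]; last by exists j => //; apply: ltnW.
rewrite inE => /predU1P[->|/IHk[j lt_jk Hj]]; last by exists j => //; apply: ltnW.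
exists k => //; split=> //; have := diff_sign_lt sk.
by apply: contraTneq; rewrite /m /M => ->; rewrite minxx maxxx ltxx.
Qed.

Lemma path_separators b k : path <%R 0 (separators b k).
Proof.
elim: k => //= k; case: ifP => // sk; rewrite !lt_pathE /= => /andP[-> ->].
rewrite !andbT; apply/andP; split.
  by apply: le_lt_trans (diff_sign_lt sk); rewrite le_min x_ge0 y_ge0.
apply/allP => u /separatorsP[j lt_jk [nxy ->]] /=.
apply: le_lt_trans (separator_le nxy lt_jk sk) _.
exact: diff_sign_lt (diff_sign_changes b nxy).
Qed.

(** Separators recorded up to index [i] are at least [M i], later ones at most [m i]; none lies
    strictly between. *)
Lemma count_separators b i k z : x i != y i -> (i < k)%N -> m i < z < M i ->
  count (> z) (separators b k) = sign_changes b i.+1 /\ z \notin separators b k.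
Proof.
move=> nxy; elim: k => // k IHk; rewrite ltnS leq_eqVlt => /predU1P[->|lt_ik] mzM.
  have /andP[_ lt_zM] := mzM.
  have gt_z : all (> z) (separators b k.+1).
    apply/allP => u /separatorsP[j le_jk [_ ->]]; apply: lt_le_trans lt_zM _.
    exact: M_decr.
  split; last by apply/negP => /(allP gt_z); rewrite ltxx.
  by rewrite -size_separators; apply/eqP; rewrite -all_count.
have [<- zn] := IHk lt_ik mzM; rewrite /=; case: ifP => // sk.
have /andP[lt_mz _] := mzM; have lt_Mz := le_lt_trans (separator_le nxy lt_ik sk) lt_mz.
by rewrite /= inE negb_or zn (gt_eqF lt_Mz) ltNge (ltW lt_Mz).
Qed.

(** The derivative of [q] changes sign exactly at the separators. On the interval at [i] its sign is
    thus given by the number of sign changes so far, as is the orientation of the interval, and the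
    two dependences cancel in the mean value theorem. *)
Lemma horner_diff_sign b q i : (i < n)%N -> q^`() != 0 ->
    all (root q^`()) (separators b n) ->
    (nonzero_coefs q^`() <= (sign_changes b n).+1)%N ->
  0 <= (-1) ^+ b * lead_coef q^`() * (q.[y i] - q.[x i]) ?= iff (x i == y i).
Proof.
move=> lt_in nz_dq root_dq le_nz; have [->|nxy] := eqVneq; first by rewrite subrr mulr0; apply/leifP.
set d := lead_coef _; apply/leifP.
have sgn z : m i < z < M i -> 0 < (-1) ^+ sign_changes b i.+1 * d * q^`().[z].
  move=> mzM; have [<- zn] := count_separators b nxy lt_in mzM.
  apply: sign_between_roots => //; first exact: path_separators.
    by rewrite size_separators.
  by have /andP[+ _] := mzM; apply: le_lt_trans; rewrite le_min x_ge0 y_ge0.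
have := diff_sign_changes b nxy; rewrite -signr_odd in sgn.
move: (odd _) sgn => o sgn; rewrite /diff_sign.
case: ifP => bo lt_xy; have [z] := poly_mvt q lt_xy; rewrite in_itv /= => lt_z.
  move=> /(congr1 -%R); rewrite opprB => ->; have := sgn z.
  rewrite /m /M (min_r (ltW lt_xy)) (max_l (ltW lt_xy)) => /(_ lt_z) sgn_z.
  have -> : (-1) ^+ b = - (-1) ^+ o :> R by move: bo; case: (b) (o) => -[]; rewrite ?(expr0, expr1, opprK).
  by rewrite mulrN !mulNr opprK mulrA pmulr_rgt0 // subr_gt0.
move=> ->; have := sgn z.
rewrite /m /M (min_l (ltW lt_xy)) (max_r (ltW lt_xy)) => /(_ lt_z) sgn_z.
have -> : b = o by move: bo; case: (b) (o) => -[].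
by rewrite mulrA pmulr_rgt0 // subr_gt0.
Qed.

Lemma sum_horner_diff b q e : uniq e -> (forall i, q`_i != 0 -> i \in e) ->
  q^`() != 0 -> all (root q^`()) (separators b n) ->
  (nonzero_coefs q^`() <= (sign_changes b n).+1)%N ->
  0 <= (-1) ^+ b * lead_coef q^`() *
     (\sum_(a <- e) q`_a * (power_sum n y a - power_sum n x a))
   ?= iff [forall i : 'I_n, x i == y i].
Proof.
move=> uniq_e qe nz_dq root_dq le_nz.
under eq_bigr do rewrite mulrBr; rewrite sumrB -!sum_horner // -sumrB mulr_sumr.
rewrite (_ : [forall i, _] = [forall (i : 'I_n | true), x i == y i]); last first.
  by apply: eq_forallb.
by apply: leif_0_sum => i _; apply: horner_diff_sign.
Qed.

Lemma nonzero_coefs_deriv_le q e : (forall i, q`_i != 0 -> i \in e) ->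
  (nonzero_coefs q^`() <= size (filter (predC1 0) e))%N.
Proof.
move=> qe; rewrite -(size_map predn); apply: nonzero_coefs_le => i.
rewrite coef_deriv mulrn_eq0 negb_or => /andP[_ /qe ie].
by apply/mapP; exists i.+1; rewrite // mem_filter.
Qed.

Lemma deriv_neq0 q e : q != 0 -> (forall i, q`_i != 0 -> i \in e) -> 0%N \notin e ->
  q^`() != 0.
Proof.
move=> nzq qe e0; apply: contraNneq e0 => dq0; apply: qe.
suff defq : q = (q`_0)%:P by apply: contraNneq nzq => q00; rewrite defq q00.
apply/polyP => -[|i]; rewrite coefC //=; apply/eqP.
have /eqP := congr1 (fun Q : {poly R} => Q`_i) dq0.
by rewrite coef_deriv coef0 mulrn_eq0.
Qed.

Lemma power_sums_inj b e : uniq e -> 0%N \notin e -> (sign_changes b n < size e)%N ->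
    (forall a, a \in e -> power_sum n x a = power_sum n y a) ->
  forall i, (i < n)%N -> x i = y i.
Proof.
(* One exponent more than there are separators: enough for a nonzero [q], and few enough for its
   derivative to have no other sign changes. *)
move=> uniq_e e0 lt_ce eq_e; pose e' := take (sign_changes b n).+1 e.
have sub_e : {subset e' <= e} by exact: mem_take.
have uniq_e' : uniq e' by rewrite take_uniq.
have e'0 : 0%N \notin e' by apply: contra e0; apply: sub_e.
have sz_e' : size e' = (sign_changes b n).+1 by rewrite size_takel.
have [|q [nzq qe root_q]] := @exists_poly_deriv_roots e' (separators b n) uniq_e'.
  by rewrite size_separators sz_e'.
have le_nz : (nonzero_coefs q^`() <= (sign_changes b n).+1)%N.
  by rewrite (leq_trans (nonzero_coefs_deriv_le qe)) // -sz_e' size_filter count_size.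
have := sum_horner_diff uniq_e' qe (deriv_neq0 nzq qe e'0) root_q le_nz.
rewrite big_seq big1 => [|a /sub_e/eq_e->]; last by rewrite subrr mulr0.
rewrite mulr0 => -[_]; rewrite eqxx => /esym/forallP eq_xy i lt_in.
by have /eqP := eq_xy (Ordinal lt_in).
Qed.

(** With fewer sign changes than common moments the sequences agree. With equally many, only the
    term of [a0] survives in the comparison, and its coefficient is the leading one of [q]. *)
Lemma last_power_sum_diff b e a0 : sorted ltn (rcons e a0) -> 0%N \notin rcons e a0 ->
    (sign_changes b n <= size e)%N ->
    (forall a, a \in e -> power_sum n x a = power_sum n y a) ->
  0 <= (-1) ^+ b * (power_sum n y a0 - power_sum n x a0).
Proof.
move=> sorted_e e0 le_ce eq_e.
have uniq_ea : uniq (rcons e a0) by apply: sorted_uniq sorted_e => //; [exact: ltn_trans | exact: ltnn].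
have [a0e uniq_e] : a0 \notin e /\ uniq e by move: uniq_ea; rewrite rcons_uniq => /andP[].
have e0' : 0%N \notin e by apply: contra e0; rewrite mem_rcons inE orbC => ->.
move: le_ce; rewrite leq_eqVlt => /predU1P[eq_ce|lt_ce]; last first.
  rewrite /power_sum -sumrB big1 ?mulr0 // => i _.
  by rewrite (power_sums_inj uniq_e e0' lt_ce eq_e) ?subrr.
have [|q [nzq qe root_q]] := @exists_poly_deriv_roots (rcons e a0) (separators b n) uniq_ea.
  by rewrite size_separators eq_ce size_rcons.
have le_nz : (nonzero_coefs q^`() <= (sign_changes b n).+1)%N.
  rewrite (leq_trans (nonzero_coefs_deriv_le qe)) // size_filter.
  by rewrite (leq_trans (count_size _ _)) // size_rcons eq_ce.
have nz_dq := deriv_neq0 nzq qe e0.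
have := sum_horner_diff uniq_ea qe nz_dq root_q le_nz.
rewrite big_rcons /= big_seq big1 => [|a /eq_e->]; last by rewrite subrr mulr0.
rewrite add0r => -[+ _].
have lt_a0 k : q`_k != 0 -> (k <= a0)%N.
  move=> /qe; rewrite mem_rcons inE => /predU1P[->//|ke].
  move: sorted_e; rewrite -cats1 sorted_pairwise; last exact: ltn_trans.
  rewrite pairwise_cat allrel1r => /andP[/allP/(_ _ ke) + _].
  exact: ltnW.
(* Otherwise the derivative would have at most [size e] nonzero coefficients, but [size e] positive
   roots. *)
have qa0 : q`_a0 != 0.
  apply: contraTneq (leqnn (size (separators b n))) => q0; rewrite -ltnNge.
  have qe' k : q`_k != 0 -> k \in e.
    move=> qk; move: (qe k qk); rewrite mem_rcons inE => /predU1P[eq_k|//].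
    by rewrite eq_k q0 eqxx in qk.
  rewrite (leq_trans (size_roots_lt nz_dq (path_separators _ _) root_q)) //.
  rewrite size_separators eq_ce (leq_trans (nonzero_coefs_deriv_le qe')) // size_filter.
  exact: count_size.
have a0_gt0 : (0 < a0)%N by rewrite lt0n; apply: contraNneq e0 => <-; rewrite mem_rcons mem_head.
have -> : lead_coef q^`() = q`_a0 *+ a0.
  have <- : q^`()`_a0.-1 = q`_a0 *+ a0 by rewrite coef_deriv prednK.
  suff sz : size q^`() = a0 by rewrite lead_coefE sz.
  apply/anti_leq/andP; split.
    apply/leq_sizeP => k le_k; rewrite coef_deriv; apply/eqP; rewrite mulrn_eq0.
    by apply: contraLR le_k => /norP[_ /lt_a0]; rewrite -ltnNge.
  rewrite -(prednK a0_gt0) ltnNge; apply: contra qa0 => /leq_sizeP/(_ _ (leqnn _)).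
  by move/eqP; rewrite coef_deriv prednK // mulrn_eq0 (gtn_eqF a0_gt0).
rewrite -mulr_natr -!mulrA; set d := _ - _ => D.
(* The coefficient occurs both in the leading coefficient of the derivative and in the surviving
   term, so its sign cancels. *)
have q2 : 0 < q`_a0 ^+ 2 * a0%:R by rewrite mulr_gt0 ?ltr0n // exprn_even_gt0.
rewrite -(pmulr_lge0 _ q2); apply: le_trans D _; rewrite le_eqVlt; apply/orP; left.
by apply/eqP; ring.
Qed.
End Comparison.

(** * Block cones and Gale's evenness condition *)

Definition rank (mu : pred nat) k : nat := (\sum_(i < k) mu i)%N.

Lemma rankS mu k : rank mu k.+1 = (rank mu k + mu k)%N.
Proof. by rewrite /rank big_ord_recr. Qed.

Lemma leq_rank mu i j : (i <= j)%N -> (rank mu i <= rank mu j)%N.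
Proof.
move=> le_ij; rewrite -(subnKC le_ij); elim: (j - i)%N => [|k IHk]; first by rewrite addn0.
by rewrite addnS rankS (leq_trans IHk) // leq_addr.
Qed.

(* Gale's evenness condition: between any two nonmembers of mu, the number of
   members is even *)
Definition gale n (mu : pred nat) (p : bool) :=
  forall i, (i < n)%N -> ~~ mu i -> odd (rank mu i) = p.

Section Cone.
Variable R : rcfType.
Implicit Types (x y : nat -> R) (mu : pred nat).

(** The cone R_mu for sequences extended by zero. Since [x n = 0], the equality at the index [n.-1]
    also makes the entries after the last member of [mu] vanish. *)
Definition block_cone n mu x :=
  [/\ forall i, 0 <= x i, forall i j, (i <= j)%N -> x j <= x i,
      forall i, (n <= i)%N -> x i = 0
    & forall i, (i < n)%N -> ~~ mu i -> x i = x i.+1].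

Lemma cone_eq n mu x i j : block_cone n mu x -> (i <= j <= n)%N ->
  rank mu i = rank mu j -> x i = x j.
Proof.
move=> [_ _ _ eq_x] /andP[le_ij]; rewrite -(subnKC le_ij).
elim: (j - i)%N => [|k IHk]; first by rewrite addn0.
rewrite addnS => lt_n; rewrite rankS => eq_r.
have mk : ~~ mu (i + k)%N.
  apply/negP => mk; rewrite mk addn1 in eq_r.
  by have := leq_rank mu (leq_addr k i); rewrite eq_r ltnn.
rewrite -eq_x // IHk ?(ltnW lt_n) //.
by move: eq_r; rewrite (negPf mk) addn0.
Qed.

Lemma cone_eq0 n mu x i : block_cone n mu x -> (i <= n)%N ->
  rank mu i = rank mu n -> x i = 0.
Proof.
move=> cx le_in eq_r; have -> := cone_eq cx _ eq_r; last by rewrite le_in leqnn.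
by case: cx => _ _ ->.
Qed.

(** Taking the starting sign from the first difference ensures that this difference is not counted
    as a change. *)
Lemma first_diff n x y : ~~ [forall i : 'I_n, x i == y i] ->
  exists i0, [/\ (i0 < n)%N, x i0 != y i0 &
    forall k, (k <= i0.+1)%N -> sign_changes x y (y i0 < x i0) k = 0%N].
Proof.
move=> /forallPn[i nxyi]; have exP : exists i, (i < n)%N && (x i != y i).
  by exists i; rewrite ltn_ord.
case: (ex_minnP exP) => i0 /andP[lt_in nxy] min_i0; exists i0; split=> //.
elim=> //= k IHk lt_k; rewrite (IHk (ltnW lt_k)) addn0 /= addbF.
move: lt_k; rewrite leq_eqVlt => /predU1P[[->]|lt_k].
  by rewrite /diff_sign; case: ltgtP.
rewrite ltnS in lt_k; have lt_kn := ltn_trans lt_k lt_in; have eq_k : x k = y k.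
  apply/eqP; apply: contraTT lt_k => nk; by rewrite -leqNgt min_i0 // nk lt_kn.
by rewrite /diff_sign eq_k ltxx; case: ifP.
Qed.

(** The differences are constant on the blocks and vanish after the last one, and the first nonzero
    difference is not counted. *)
Lemma block_cone_sign_changes n mu x y : block_cone n mu x -> block_cone n mu y ->
    ~~ [forall i : 'I_n, x i == y i] ->
  exists b, (sign_changes x y b n < rank mu n)%N.
Proof.
move=> cx cy /first_diff[i0 [lt_in nxy chg0]]; set b := _ < _ in chg0; exists b.
have lt_rank k : (k < n)%N -> x k != y k -> (rank mu k < rank mu n)%N.
  move=> lt_k nk; rewrite ltn_neqAle leq_rank ?(ltnW lt_k) // andbT.
  by apply: contra nk => /eqP eq_r; rewrite (cone_eq0 cx (ltnW lt_k) eq_r) (cone_eq0 cy (ltnW lt_k) eq_r).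
suff chgP k : (i0 < k <= n)%N ->
    (sign_changes x y b k <= rank mu k.-1)%N /\ (sign_changes x y b k < rank mu n)%N.
  by have [|//] := chgP n; rewrite lt_in leqnn.
elim: k => // k IHk /andP[]; rewrite ltnS leq_eqVlt => /predU1P[<- _|lt_ik lt_k].
  by rewrite chg0 //; split=> //; apply: leq_ltn_trans (lt_rank _ lt_in nxy).
have [|le_r lt_r] := IHk; first by rewrite lt_ik ltnW.
rewrite [sign_changes _ _ _ _.+1]/=; case sk: (diff_sign _ _ _ _); last first.
  by rewrite add0n lt_r (leq_trans le_r) // leq_rank ?leq_pred.
have nk : x k != y k by move: sk; rewrite /diff_sign; case: ltgtP; case: ifP.
suff lt_rk : (sign_changes x y b k < rank mu k)%N by rewrite add1n lt_rk (leq_ltn_trans lt_rk (lt_rank _ lt_k nk)).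
case: k lt_ik lt_k le_r sk nk {IHk lt_r} => // k lt_ik lt_k le_r sk nk.
rewrite rankS; have [mk|mk] := boolP (mu k); first by rewrite addn1 ltnS.
have [[_ _ _ /(_ _ (ltnW lt_k) mk) eq_xk] [_ _ _ /(_ _ (ltnW lt_k) mk) eq_yk]] := (cx, cy).
rewrite -eq_xk -eq_yk in nk.
have := diff_sign_changes b nk; move: sk; rewrite /diff_sign eq_xk eq_yk.
by case: (_ (+) _); case: ltgtP.
Qed.

Lemma block_cone_inj n mu x y e : block_cone n mu x -> block_cone n mu y ->
    uniq e -> 0%N \notin e -> (rank mu n <= size e)%N ->
    (forall a, a \in e -> power_sum n x a = power_sum n y a) ->
  forall i, (i < n)%N -> x i = y i.
Proof.
move=> cx cy uniq_e e0 le_e eq_e.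
have [[x0 xd _ _] [y0 yd _ _]] := (cx, cy).
have [/forallP eq_xy i lt_in|neq_xy] := boolP [forall i : 'I_n, x i == y i].
  exact/eqP/(eq_xy (Ordinal lt_in)).
have [b lt_b] := block_cone_sign_changes cx cy neq_xy.
exact: power_sums_inj uniq_e e0 (leq_trans lt_b le_e) eq_e.
Qed.

(** Within a block of [x] the difference y - x decreases, so it can only change from positive to
    negative. Such a change does not raise the rank, but Gale's condition fixes the parity of the
    rank there, and this excludes equality in the bound just before the change. *)
Lemma gale_sign_changes n mu p x y : gale n mu p -> block_cone n mu x ->
    (forall i, 0 <= y i) -> (forall i j, (i <= j)%N -> y j <= y i) ->
    ~~ [forall i : 'I_n, x i == y i] ->
  exists b, (sign_changes x y b n < rank mu n + (b == p))%N.
Proof.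
move=> gmu cx y0 yd /first_diff[i0 [lt_in nxy chg0]]; set b := _ < _ in chg0; exists b.
have [x0 xd _ _] := cx.
have lt_rank j k : (j <= k <= n)%N -> x k < x j -> (rank mu j < rank mu k)%N.
  move=> /andP[le_jk le_k] lt_x; rewrite ltn_neqAle leq_rank // andbT.
  by apply: contraTneq lt_x => /(cone_eq cx) ->; rewrite ?ltxx ?le_jk.
set c := sign_changes x y b.
(* Invariant: the count is bounded through the rank of the index [j] at which the current sign
   started. *)
have [j [lt_jn sj le_c]] : exists j, [/\ (j < n)%N, diff_sign x y (b (+) odd (c n)) j &
    (c n <= rank mu j + (b == p))%N].
  suff chgP k : (i0 < k <= n)%N -> exists j, [/\ (j < k)%N,
      diff_sign x y (b (+) odd (c k)) j & (c k <= rank mu j + (b == p))%N].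
    by apply: chgP; rewrite lt_in leqnn.
  elim: k => // k IHk /andP[]; rewrite ltnS leq_eqVlt => /predU1P[<- _|lt_ik lt_k].
    exists i0; split=> //; rewrite /c chg0 //.
    by rewrite addbF /diff_sign /b; case: ltgtP nxy.
  have [|j [lt_j sj le_c]] := IHk; first by rewrite lt_ik ltnW.
  rewrite /c [sign_changes _ _ _ _.+1]/= -/c; case sk: (diff_sign _ _ _ _); last first.
    by exists j; split=> //; apply: ltnW.
  exists k; split=> //; first by rewrite add1n /= addbN.
  have : (rank mu j < rank mu k)%N \/ rank mu j = rank mu k.
    by have := leq_rank mu (ltnW lt_j); rewrite leq_eqVlt => /predU1P; tauto.
  move=> [lt_r|eq_r]; first by lia.
  have mj : ~~ mu j.
    apply/negP => mj; have := leq_rank mu lt_j; rewrite rankS mj; lia.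
  have oj := gmu j (ltn_trans lt_j lt_k) mj.
  move: sj sk; case bo: (_ (+) _) => /=; rewrite /diff_sign => sj sk.
    suff : (rank mu j < rank mu k)%N by rewrite eq_r ltnn.
    apply: lt_rank; first by rewrite (ltnW lt_j) (ltnW lt_k).
    by apply: lt_le_trans sk _; apply: le_trans (yd _ _ (ltnW lt_j)) _; exact: ltW.
  have : odd (c k) = b by move: bo; case: (b) (odd _) => -[].
  move: oj le_c; case: eqP => [<-|nbp]; rewrite eq_r; lia.
(* If the rank does not grow after [j], then [x j = 0], so the last sign is positive because y is
   nonnegative, and the parity argument again makes the bound strict. *)
have := leq_rank mu (ltnW lt_jn); rewrite leq_eqVlt => /predU1P[eq_r|]; last by rewrite -/c; lia.
have mj : ~~ mu j by apply/negP => mj; have := leq_rank mu lt_jn; rewrite rankS mj; lia.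
have oj := gmu j lt_jn mj; have xj := cone_eq0 cx (ltnW lt_jn) eq_r.
have : odd (c n) = b.
  move: sj; rewrite /diff_sign; case bo: (_ (+) _); first by rewrite xj ltNge y0.
  by move: bo; case: (b) (odd _) => -[].
by rewrite -/c; move: oj le_c; case: eqP => [<-|nbp]; rewrite eq_r; lia.
Qed.

(** Either there are too few sign changes for the sequences to differ, or the first difference has
    the sign given by [p], which decides the comparison of the last moments. *)
Lemma gale_extremal n mu p x y e a0 : gale n mu p -> block_cone n mu x ->
    (forall i, 0 <= y i) -> (forall i j, (i <= j)%N -> y j <= y i) ->
    sorted ltn (rcons e a0) -> 0%N \notin rcons e a0 -> rank mu n = size e ->
    (forall a, a \in e -> power_sum n x a = power_sum n y a) ->
  0 <= (-1) ^+ p * (power_sum n y a0 - power_sum n x a0).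
Proof.
move=> gmu cx y0 yd sorted_e e0 sz_e eq_e; have [x0 xd _ _] := cx.
have [/forallP eq_xy|neq_xy] := boolP [forall i : 'I_n, x i == y i].
  rewrite /power_sum -sumrB big1 ?mulr0 // => i _.
  by rewrite (eqP (eq_xy i)) subrr.
have [b] := gale_sign_changes gmu cx y0 yd neq_xy.
rewrite sz_e; case: eqP => [->|_]; first by rewrite addn1 => le_b; apply: last_power_sum_diff eq_e.
rewrite addn0 => lt_b; case/negP: neq_xy; apply/forallP => i; apply/eqP.
have uniq_ea : uniq (rcons e a0) by apply: sorted_uniq sorted_e => //; [exact: ltn_trans | exact: ltnn].
apply: power_sums_inj lt_b eq_e _ _ => //; first by move: uniq_ea; rewrite rcons_uniq => /andP[].
by apply: contra e0; rewrite mem_rcons inE orbC => ->.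
Qed.

End Cone.

(** * Critical points of combinations of power sums *)

Lemma eq_rank (mu nu : pred nat) k : (forall i, (i < k)%N -> mu i = nu i) -> rank mu k = rank nu k.
Proof. by move=> eq_mn; apply: eq_bigr => i _; rewrite eq_mn. Qed.

Lemma rank_full (mu : pred nat) n : (forall i, (i < n)%N -> mu i) -> rank mu n = n.
Proof.
move=> mu_all; rewrite (@eq_rank mu xpredT) => [|i /mu_all->//].
by rewrite /rank sum1_card card_ord.
Qed.

(** Adding the largest nonmember alters the ranks only beyond it, where every index is already a
    member. *)
Lemma gale_extend n mu p r : gale n mu p -> (rank mu n <= r <= n)%N ->
  exists nu, [/\ gale n nu p, rank nu n = r & forall i, mu i -> nu i].
Proof.
have [d] := ubnP (r - rank mu n)%N; elim: d mu => // d IHd mu le_d gmu /andP[].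
rewrite leq_eqVlt => /predU1P[<- _|lt_r le_r]; first by exists mu.
have /existsP[i0 mi0] : [exists i : 'I_n, ~~ mu i].
  apply: contraTT lt_r => /existsPn mu_all; rewrite -leqNgt rank_full // => i lt_in.
  by have := mu_all (Ordinal lt_in); rewrite negbK.
case: (@arg_maxnP _ i0 (fun i : 'I_n => ~~ mu i) (fun i => val i) mi0) => i mi max_i.
pose nu k := (k == i :> nat) || mu k.
have rank_nu k : rank nu k = (rank mu k + (i < k)%N)%N.
  elim: k => [|k IHk]; first by rewrite /rank !big_ord0.
  rewrite !rankS IHk /nu ltnS; case: (ltngtP k i) => [_|_|eq_ki] /=.
  - by rewrite !addn0.
  - by rewrite addnAC.
  - by rewrite eq_ki (negPf mi) !addn0.
have [|||nu' [gnu' <- sub_nu]] := IHd nu.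
- by rewrite rank_nu ltn_ord; lia.
- move=> k lt_kn; rewrite /nu negb_or => /andP[nki mk]; rewrite rank_nu -(gmu k lt_kn mk).
  have : (k <= i)%N by have := max_i (Ordinal lt_kn) mk.
  by rewrite leq_eqVlt (negPf nki) /= => lt_ki; rewrite ltnNge (ltnW lt_ki) addn0.
- by rewrite rank_nu ltn_ord addn1 lt_r le_r.
by exists nu'; split=> // k mk; apply: sub_nu; rewrite /nu mk orbT.
Qed.

(** * Greedy completion of the jumps of a decreasing sequence to a Gale set *)

Section Greedy.
Variable R : rcfType.
Implicit Types (x : nat -> R) (q : {poly R}) (L : seq R).

Lemma block_coneS n (mu nu : pred nat) x : (forall i, mu i -> nu i) -> block_cone n mu x ->
  block_cone n nu x.
Proof. by move=> sub [x0 xd xn xe]; split=> // i lt_in /(contra (sub i))/xe->. Qed.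

Variables (n : nat) (x : nat -> R).
Hypotheses (x_ge0 : forall i, 0 <= x i) (x_decr : forall i j, (i <= j)%N -> x j <= x i).
Hypothesis (x_n : forall i, (n <= i)%N -> x i = 0).

Section Count.
Variable p : bool.

(* Scanning the indices from left to right, all jumps of x are selected, and
   also the indices at which Gale's condition would otherwise fail *)
Fixpoint greedy k : nat :=
  if k is k'.+1 then (((x k'.+1 < x k')%R || (odd (greedy k') != p)) + greedy k')%N else 0%N.

Definition greedy_set : pred nat := fun k => (x k.+1 < x k) || (odd (greedy k) != p).

Lemma rank_greedy k : rank greedy_set k = greedy k.
Proof.
elim: k => [|k IHk]; first by rewrite /rank big_ord0.
by rewrite rankS IHk addnC.
Qed.

Lemma gale_greedy : gale n greedy_set p.
Proof. by move=> i _; rewrite negb_or negbK rank_greedy => /andP[_ /eqP]. Qed.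

Lemma greedy_cone : block_cone n greedy_set x.
Proof.
split=> // i lt_in /norP[+ _]; rewrite -leNgt => le_x.
by apply/le_anti; rewrite le_x x_decr.
Qed.

(** Where [x] vanishes there are no jumps, and a single selection repairs the parity for good. *)
Lemma greedy_tail k j : (forall i, x (k + i)%N = 0) ->
  (greedy (k + j) <= greedy k + (odd (greedy k) != p))%N.
Proof.
move=> xk; suff : (greedy (k + j) == greedy k) ||
    (greedy (k + j) == greedy k + 1)%N && (odd (greedy k) != p).
  by case/orP => [/eqP->|/andP[/eqP-> ->]]; rewrite ?leq_addr.
elim: j => [|j IHj]; first by rewrite addn0 eqxx.
rewrite addnS /= -addnS !xk ltxx /=.
case/orP: IHj => [/eqP->|/andP[/eqP-> odd_k]].
  by case: (odd (greedy k) != p) => /=; rewrite ?add0n ?add1n ?addn1 eqxx ?orbT.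
rewrite oddD addbT -addNb odd_k; move: odd_k; rewrite andbT.
by case: (odd _) (p) => -[]; rewrite //= ?add0n eqxx orbT.
Qed.

(** In the application [Q] is the derivative of a combination of powers with the factor ['X^(a1.-1)]
    removed, and [p] records the sign of the derivative of [Q] at a point to the right of all
    [x i]. *)
Variables (Q : {poly R}).
Hypothesis x0_gt0 : 0 < x 0%N.
Hypothesis root_Q : forall i, (i < n)%N -> 0 < x i -> Q.[x i] = 0.
Hypothesis dQ_le0 : forall i, (i.+1 < n)%N -> x i = x i.+1 -> 0 < x i -> Q^`().[x i] <= 0.
Hypothesis Q0_le0 : (exists2 i, (i < n)%N & x i = 0) -> Q.[0] <= 0.
Hypothesis dQ_far : 0 <= (-1) ^+ (~~ p) * Q^`().[x 0%N + 1].

Lemma x_gt0_lt k : 0 < x k -> (k < n)%N.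
Proof. by move=> xk; rewrite ltnNge; apply/negP => /x_n xk0; rewrite xk0 ltxx in xk. Qed.

(** The list starts with a point to the right of [x 0]. A jump contributes a root of the derivative
    of [Q] by Rolle's theorem; an index selected for its parity contributes [x k] itself, where the
    derivative is nonpositive. The strict bound for the wrong parity keeps the points distinct. *)
Lemma greedy_alternating k : 0 < x k -> exists L,
  [/\ size L = (greedy k).+1, pairwise <%R L, all (>= x k) L,
     (odd (greedy k) != p) ==> all (> x k) L &
     alternating Q^`() (~~ (p (+) odd (greedy k))) L].
Proof.
elim: k => [|k IHk] xk1.
  exists [:: x 0%N + 1]; rewrite /= addbF dQ_far !andbT; split=> //.
    by rewrite lerDl ler01.
  by rewrite ltrDl ltr01 implybT.
have xk : 0 < x k by apply: lt_le_trans xk1 (x_decr _).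
have [L [sz_L pL geL gtL altL]] := IHk xk.
rewrite /=; case: (ltP (x k.+1) (x k)) => [lt_x|le_x] /=.
  have [z] := rolle lt_x (etrans (root_Q (x_gt0_lt xk1) xk1) (esym (root_Q (x_gt0_lt xk) xk))).
  rewrite in_itv /= => /andP[lt_xz lt_zx] dQz.
  have gt_z : all (> z) L by apply: sub_all geL => u; apply: lt_le_trans.
  exists (z :: L); rewrite /= sz_L pL gt_z lt_xz (ltW lt_xz) dQz mulr0 lexx /=; split=> //.
  - by apply: sub_all gt_z => u; move/(lt_trans lt_xz)/ltW.
  - by apply/implyP => _; apply: sub_all gt_z => u; apply: lt_trans.
  - by rewrite addbN negbK.
have eq_x : x k = x k.+1 by apply/le_anti; rewrite le_x x_decr.
rewrite -eq_x; case: eqP => [eq_p|/eqP ne_p] /=.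
  by exists L; rewrite add0n; split=> //; rewrite eq_p eqxx.
rewrite ne_p /= in gtL; exists (x k :: L); rewrite /= sz_L pL gtL lexx /=; split=> //.
  by move: ne_p; case: (odd _) (p) => -[].
have dQk : Q^`().[x k] <= 0 by apply: dQ_le0 => //; exact: x_gt0_lt.
have pg : p (+) odd (greedy k) by move: ne_p; case: (odd _) (p) => -[].
by rewrite addbN negbK altL andbT pg expr1 mulN1r oppr_ge0.
Qed.

(** At the last positive index the list has one point in excess, which accounts for the jump to
    zero. A parity repair among the zeros needs one more point, found between 0 and the last
    positive value because [Q.[0]] is nonpositive. *)
Lemma greedy_size : Q^`() != 0 -> (greedy n <= nonzero_coefs Q^`())%N.
Proof.
move=> nz_dQ.
have exP : exists i, x i <= 0 by exists n; rewrite x_n.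
case: (ex_minnP exP) => -[|k] xk1 min_k; first by rewrite leNgt x0_gt0 in xk1.
have {}xk1 : x k.+1 = 0 by apply/le_anti; rewrite xk1 x_ge0.
have xk : 0 < x k by rewrite ltNge; apply/negP => /min_k; rewrite ltnn.
have lt_kn := x_gt0_lt xk.
have [L [sz_L pL geL gtL altL]] := greedy_alternating xk.
have xk_tail i : x (k.+1 + i)%N = 0.
  by apply/le_anti; rewrite x_ge0 -xk1 x_decr // leq_addr.
have gk1 : greedy k.+1 = (greedy k).+1 by rewrite /= xk1 xk.
have path_L : path <%R 0 L.
  by rewrite lt_pathE pL andbT; apply: sub_all geL => u; apply: lt_le_trans.
have le_L := alternating_size nz_dQ path_L altL.
have le_g := greedy_tail (n - k.+1) xk_tail; rewrite subnKC // gk1 in le_g.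
have [eq_kn|ne_kn] := eqVneq k.+1 n.
  by rewrite -eq_kn gk1 -sz_L.
have lt_k1n : (k.+1 < n)%N by rewrite ltn_neqAle ne_kn.
have [odd_g|odd_g] := eqVneq (odd (greedy k).+1) p.
  by rewrite (leq_trans le_g) // odd_g eqxx addn0 -sz_L.
have [z] := poly_mvt Q xk; rewrite in_itv /= root_Q // sub0r subr0 => /andP[z0 lt_zx] dQz.
rewrite (leq_trans le_g) // odd_g addn1 -sz_L.
apply: (@alternating_size _ _ (p (+) odd (greedy k)) (z :: L)) => //=.
  have gt_z : all (> z) L by apply: sub_all geL => u; apply: lt_le_trans.
  by move: path_L; rewrite !lt_pathE /= => /andP[_ ->]; rewrite z0 gt_z.
rewrite altL andbT; have -> : p (+) odd (greedy k) = false.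
  by move: odd_g => /=; case: (odd _) (p) => -[].
rewrite expr0 mul1r -(pmulr_lge0 _ xk) -dQz oppr_ge0; apply: Q0_le0.
by exists k.+1.
Qed.
End Count.
End Greedy.

Section Critical.
Variable R : rcfType.

(** Removing ['X^(a1.-1)] from the derivative of [q] turns its lowest term into a constant, which a
    second differentiation kills: [size e] coefficients remain. At positive roots of [Q] its
    derivative has the sign of the second derivative of [q]. *)
Lemma critical_gale n (x : nat -> R) (q : {poly R}) a1 e :
    (forall i, 0 <= x i) -> (forall i j, (i <= j)%N -> x j <= x i) ->
    (forall i, (n <= i)%N -> x i = 0) -> 0 < x 0%N ->
    sorted ltn (a1 :: e) -> (0 < a1)%N -> (size e < n)%N -> q != 0 ->
    (forall i, q`_i != 0 -> i \in a1 :: e) ->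
    (forall i, (i < n)%N -> 0 < x i -> q^`().[x i] = 0) ->
    (forall i, (i.+1 < n)%N -> x i = x i.+1 -> 0 < x i -> q^`(2).[x i] <= 0) ->
    ((exists2 i, (i < n)%N & x i = 0) -> q`_a1 <= 0) ->
  exists mu p, [/\ gale n mu p, rank mu n = size e & block_cone n mu x].
Proof.
move=> x0 xd xn x0_gt0 sorted_e a1_gt0 lt_en nzq qe root_q ddq q_a1.
pose Q := drop_poly a1.-1 q^`().
have e_gt a : a \in e -> (a1 < a)%N.
  by move: sorted_e; rewrite /= (path_sortedE ltn_trans) => /andP[/allP le_e _] /le_e.
have e_n0 : 0%N \notin a1 :: e by rewrite inE negb_or eq_sym -lt0n a1_gt0; apply/negP => /e_gt.
have defQ : q^`() = Q * 'X^(a1.-1).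
  rewrite -[LHS](poly_take_drop a1.-1) (_ : take_poly _ _ = 0) ?add0r //.
  apply/polyP => i; rewrite coef_take_poly coef0; case: ifP => // lt_i; apply/eqP.
  rewrite coef_deriv mulrn_eq0; apply: contraLR lt_i => /norP[_ /qe].
  by rewrite inE -leqNgt -ltnS prednK // => /predU1P[->//|/e_gt/ltnW].
have nz_dq := deriv_neq0 nzq qe e_n0.
have root_Q i : (i < n)%N -> 0 < x i -> Q.[x i] = 0.
  move=> lt_in xi; have /eqP := root_q i lt_in xi.
  by rewrite defQ hornerM hornerXn mulf_eq0 expf_eq0 (gt_eqF xi) andbF orbF => /eqP.
have dQ i : (i.+1 < n)%N -> x i = x i.+1 -> 0 < x i -> Q^`().[x i] <= 0.
  move=> lt_in eq_x xi; have := ddq i lt_in eq_x xi.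
  rewrite (_ : q^`(2) = q^`()^`()) // defQ derivM hornerD !hornerM root_Q ?mul0r ?addr0 ?(ltnW lt_in) //.
  by rewrite hornerXn pmulr_lle0 // exprn_gt0.
have Q0 : (exists2 i, (i < n)%N & x i = 0) -> Q.[0] <= 0.
  move=> /q_a1 qa1; rewrite horner_coef0 coef_drop_poly add0n coef_deriv prednK //.
  exact: mulrn_wle0.
have nz_dQ : Q^`() != 0.
  apply: contraNneq nz_dq => dQ0; rewrite defQ (_ : Q = 0) ?mul0r //.
  have defQ0 : Q = (Q`_0)%:P.
    apply/polyP => -[|i]; rewrite coefC //=; apply/eqP.
    have /eqP := congr1 (fun P : {poly R} => P`_i) dQ0.
    by rewrite coef_deriv coef0 mulrn_eq0.
  have lt_0n : (0 < n)%N by exact: leq_ltn_trans lt_en.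
  by have := root_Q 0%N lt_0n x0_gt0; rewrite defQ0 hornerC => ->.
pose p := 0 < Q^`().[x 0%N + 1].
have dQ_far : 0 <= (-1) ^+ (~~ p) * Q^`().[x 0%N + 1].
  by rewrite /p; case: ltP => le0; rewrite ?(expr0, expr1); lra.
have le_g := greedy_size x0 xd xn x0_gt0 root_Q dQ Q0 dQ_far nz_dQ.
have le_nz : (nonzero_coefs Q^`() <= size e)%N.
  rewrite -(size_map (fun a => a - a1.+1)%N e); apply: nonzero_coefs_le => i.
  rewrite coef_deriv mulrn_eq0 => /norP[_]; rewrite coef_drop_poly coef_deriv mulrn_eq0.
  move=> /norP[_ /qe]; rewrite inE => /predU1P[eq_i|ie].
    by exfalso; clear -a1_gt0 eq_i; lia.
  by apply/mapP; exists (i.+1 + a1.-1).+1 => //; clear -a1_gt0; lia.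
have [|nu [gnu rnu sub_nu]] := @gale_extend n _ p (size e) (@gale_greedy R n x p).
  by rewrite rank_greedy (leq_trans le_g le_nz) ltnW.
exists nu, p; split=> //; apply: block_coneS sub_nu _; exact: greedy_cone.
Qed.
End Critical.

(** * Points of the moment set nearest to an outer point *)

Section LocalMinimum.
Variable R : rcfType.
Implicit Types (x y : nat -> R) (q H : {poly R}) (e : seq nat).

Lemma low_coef_ge0 H k (d : R) : 0 < d -> (forall s, 0 < s < d -> 0 <= H.[s]) ->
  (forall j, (j < k)%N -> H`_j = 0) -> 0 <= H`_k.
Proof.
move=> d0 H_ge0 low0; pose K := drop_poly k H.
have defH : H = K * 'X^k.
  rewrite -[LHS](poly_take_drop k) (_ : take_poly k H = 0) ?add0r //.
  by apply/polyP => i; rewrite coef_take_poly coef0; case: ifP => // /low0.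
rewrite (_ : H`_k = K.[0]); last by rewrite horner_coef0 coef_drop_poly.
rewrite leNgt; apply/negP => K0; rewrite -oppr_gt0 in K0.
have [d' d'0 contK] := poly_cont 0 K K0.
pose s := Num.min d d' / 2.
have min0 : 0 < Num.min d d' by rewrite lt_min d0.
have s0 : 0 < s by rewrite divr_gt0.
have : s < Num.min d d' by rewrite ltr_pdivrMr // ltr_pMr // ltr1n.
rewrite lt_min => /andP[sd sd'].
have := H_ge0 s; rewrite s0 sd defH hornerM hornerXn => /(_ isT).
rewrite pmulr_lge0 ?exprn_gt0 // => Ks.
have := contK s; rewrite subr0 gtr0_norm // => /(_ sd').
by rewrite ltr_norml; lra.
Qed.

Definition sq_dist n e (z : nat -> R) x : R :=
  \sum_(a <- e) (power_sum n x a - z a) ^+ 2.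

Variables (n : nat) (e : seq nat) (z x : nat -> R) (B : R).
Hypotheses (x_ge0 : forall i, 0 <= x i) (x_ltB : forall i, x i < B).
Hypothesis min_x : forall y, (forall i, (i < n)%N -> 0 <= y i <= B) ->
  sq_dist n e z x <= sq_dist n e z y.
Hypotheses (uniq_e : uniq e) (e_gt0 : 0%N \notin e).

(** Its derivative at [x i] is -1/2 times the partial derivative of [sq_dist] with respect to the
    i-th coordinate. *)
Definition dist_poly : {poly R} :=
  \sum_(a <- e) (z a - power_sum n x a) *: 'X^a.

Lemma coef_dist_poly k : dist_poly`_k = if k \in e then z k - power_sum n x k else 0.
Proof.
rewrite coef_sum; case: ifP => ke.
  rewrite (bigD1_seq k) //= coefZ coefXn eqxx mulr1 big1 ?addr0 // => j nkj.
  by rewrite coefZ coefXn eq_sym (negPf nkj) mulr0.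
rewrite big_seq big1 // => j je; rewrite coefZ coefXn; case: eqP => [jk|]; last by rewrite mulr0.
by rewrite jk je in ke.
Qed.

Section Curve.
Variable W : nat -> {poly R}.
Let A a := \sum_(i < n) (W i ^+ a - (x i ^+ a)%:P).
Let T := \sum_(i < n) (dist_poly \Po W i - dist_poly.[x i]%:P).

Lemma curve_sumE : T = \sum_(a <- e) (z a - power_sum n x a) *: A a.
Proof.
under [RHS]eq_bigr do rewrite scaler_sumr.
rewrite exchange_big /=; apply: eq_bigr => i _.
rewrite {1}/dist_poly raddf_sum horner_sum raddf_sum -sumrB; apply: eq_bigr => a _.
by rewrite /= linearZ /= comp_Xn_poly hornerZ hornerXn polyCM -!mul_polyC mulrBr.
Qed.

(* T is the linear part of the variation of the objective function along the
   curve W; the quadratic part has order at least 2m *)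
Lemma curve_coef_le0 m d : (0 < m)%N -> 0 < d ->
    (forall s i, 0 < s < d -> (i < n)%N -> 0 <= (W i).[s] <= B) ->
    (forall a j, a \in e -> (j < m)%N -> (A a)`_j = 0) ->
  T`_m <= 0.
Proof.
(* [H] is the increase of the squared distance along the curve, hence nonnegative for small positive
   parameters. *)
move=> m0 d0 box_W A_low; pose H := \sum_(a <- e) A a ^+ 2 - T *+ 2.
have A2_low a j : a \in e -> (j <= m)%N -> (A a ^+ 2)`_j = 0.
  move=> ae le_jm; rewrite expr2 coefM big1 // => k _.
  have [lt_km|le_mk] := ltnP k m; first by rewrite A_low ?mul0r.
  by rewrite [X in _ * X]A_low ?mulr0 //; have := ltn_ord k; lia.
have T_low j : (j < m)%N -> T`_j = 0.
  move=> lt_jm; rewrite curve_sumE coef_sum big_seq big1 // => a ae.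
  by rewrite coefZ A_low ?mulr0.
have coef_H j : (j <= m)%N -> H`_j = - T`_j *+ 2.
  move=> le_jm; rewrite coefB coef_sum big_seq big1 ?sub0r ?coefMn ?mulNrn //.
  by move=> a ae; rewrite A2_low.
suff : 0 <= H`_m by rewrite coef_H // pmulrn_lge0 // oppr_ge0.
apply: low_coef_ge0 d0 _ _ => [s s0d|j lt_jm]; last first.
  by rewrite coef_H ?(ltnW lt_jm) // T_low // oppr0 mul0rn.
have := min_x (fun i => box_W s i s0d); rewrite -subr_ge0; congr (0 <= _).
rewrite /sq_dist -sumrB /H curve_sumE -sumrMnl -sumrB horner_sum; apply: eq_bigr => a _.
rewrite hornerD hornerN hornerMn hornerZ horner_exp.
have -> : (A a).[s] = power_sum n (fun i => (W i).[s]) a - power_sum n x a.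
  rewrite horner_sum -sumrB; apply: eq_bigr => i _.
  by rewrite hornerD hornerN hornerC horner_exp.
by rewrite -mulr_natr; ring.
Qed.
End Curve.

Lemma sum_single (V : zmodType) (F : nat -> V) i : (i < n)%N ->
  (forall k, k != i -> F k = 0) -> \sum_(k < n) F k = F i.
Proof.
move=> lt_in F0; rewrite (bigD1 (Ordinal lt_in)) //= big1 ?addr0 // => k nki.
exact: F0.
Qed.

Lemma sum_pair (V : zmodType) (F : nat -> V) i : (i.+1 < n)%N ->
  (forall k, k != i -> k != i.+1 -> F k = 0) -> \sum_(k < n) F k = F i + F i.+1.
Proof.
move=> lt_in F0; rewrite (bigD1 (Ordinal (ltnW lt_in))) //=; congr (_ + _).
rewrite (bigD1 (Ordinal lt_in)) /=; last by rewrite -val_eqE /= gtn_eqF.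
by rewrite big1 ?addr0 // => k /andP[nki nkj]; apply: F0.
Qed.

(** Since 0 < [x i] < [B], the coordinate can be moved both ways; the linear coefficients are
    opposite values of the derivative. *)
Lemma first_order i : (i < n)%N -> 0 < x i -> dist_poly^`().[x i] = 0.
Proof.
move=> lt_in xi.
suff key (sg : bool) : (-1) ^+ sg * dist_poly^`().[x i] <= 0.
  by apply/le_anti; move: (key true) (key false); rewrite expr0 expr1; lra.
pose w : {poly R} := (x i)%:P + (-1) ^+ sg *: 'X.
pose W k : {poly R} := if k == i then w else (x k)%:P.
have w0 : w.[0] = x i by rewrite /w !hornerE ?mulr0 ?addr0.
have sumW (F : {poly R} -> R -> {poly R}) : (forall u, F u%:P u = 0) ->
    \sum_(k < n) F (W k) (x k) = F w (x i).
  move=> F0; rewrite (@sum_single _ (fun k => F (W k) (x k)) i) // /W ?eqxx //.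
  by move=> k /negPf->.
have d0 : 0 < Num.min (x i) (B - x i) by rewrite lt_min xi subr_gt0 x_ltB.
have := @curve_coef_le0 W 1 _ isT d0.
rewrite (sumW (fun w u => dist_poly \Po w - dist_poly.[u]%:P)); last first.
  by move=> u; rewrite comp_polyCr subrr.
rewrite -[X in X <= 0]mulr1n -coef_deriv -horner_coef0 derivB derivC subr0 deriv_comp hornerM.
rewrite horner_comp w0 derivD derivC add0r derivZ derivX hornerZ hornerC mulr1 mulrC; apply.
  move=> s k; rewrite lt_min => /and3P[s0 sx sB] _; rewrite /W; case: eqP => _.
    by rewrite /w !hornerE; case: (sg); rewrite ?(expr0, expr1); apply/andP; split; lra.
  by rewrite hornerC x_ge0 ltW.
move=> a [|//] ae _.
rewrite (sumW (fun w u => w ^+ a - (u ^+ a)%:P)); last by move=> u; rewrite polyC_exp subrr.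
by rewrite -horner_coef0 hornerD hornerN hornerC horner_exp w0 subrr.
Qed.

(** Moving two equal coordinates apart by opposite amounts changes no moment to first order; the
    quadratic coefficient is the second derivative. *)
Lemma second_order i : (i.+1 < n)%N -> x i = x i.+1 -> 0 < x i ->
  dist_poly^`(2).[x i] <= 0.
Proof.
move=> lt_in eq_x xi.
pose w (sg : bool) : {poly R} := (x i)%:P + (-1) ^+ sg *: 'X.
have box_w sg s : 0 < s < Num.min (x i) (B - x i) -> 0 <= (w sg).[s] <= B.
  rewrite lt_min => /and3P[s0 sx sB].
  by rewrite /w !hornerE; case: (sg); rewrite ?(expr0, expr1); apply/andP; split; lra.
pose W k : {poly R} := if k == i then w false else if k == i.+1 then w true else (x k)%:P.
have w0 sg : (w sg).[0] = x i by rewrite /w !hornerE ?mulr0 ?addr0.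
have dw sg : (w sg)^`() = ((-1) ^+ sg)%:P by rewrite derivD derivC add0r derivZ derivX alg_polyC.
clearbody w; have sumW (F : {poly R} -> R -> {poly R}) : (forall u, F u%:P u = 0) ->
    \sum_(k < n) F (W k) (x k) = F (w false) (x i) + F (w true) (x i).
  move=> F0; rewrite (@sum_pair _ (fun k => F (W k) (x k)) i) // /W ?eqxx.
    by rewrite -eq_x (gtn_eqF (ltnSn i)).
  by move=> k /negPf-> /negPf->.
have d0 : 0 < Num.min (x i) (B - x i) by rewrite lt_min xi subr_gt0 x_ltB.
have := @curve_coef_le0 W 2 _ isT d0.
rewrite (sumW (fun w u => dist_poly \Po w - dist_poly.[u]%:P)); last first.
  by move=> u; rewrite comp_polyCr subrr.
move=> le0; suff : (dist_poly \Po w false - dist_poly.[x i]%:P +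
    (dist_poly \Po w true - dist_poly.[x i]%:P))`_2 *+ 2 = dist_poly^`(2).[x i] *+ 2.
  move=> /(pmulrnI (isT : (0 < 2)%N)) <-; apply: le0.
    move=> s k s0d _; rewrite /W; case: eqP => _; first exact: box_w.
    by case: eqP => _; [exact: box_w | rewrite hornerC x_ge0 ltW].
  move=> a j ae lt_j; rewrite (sumW (fun w u => w ^+ a - (u ^+ a)%:P)); last first.
    by move=> u; rewrite polyC_exp subrr.
  case: j lt_j => [|[|//]] _.
    by rewrite -horner_coef0 !(hornerD, hornerN, hornerC, horner_exp) !w0 !subrr addr0.
  rewrite -[LHS]mulr1n -coef_deriv -horner_coef0 !derivD !derivN !derivC !subr0.
  rewrite !deriv_exp !dw !(hornerD, hornerMn, hornerM, horner_exp, hornerC) !w0.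
  by rewrite expr0 expr1 -mulrnDl; apply/eqP; rewrite mulrn_eq0; apply/orP; right; apply/eqP; ring.
rewrite -[_ *+ 2]mulr1n; have -> (p : {poly R}) : p`_2 *+ 2 *+ 1 = p^`()^`().[0].
  by rewrite horner_coef0 !coef_deriv.
rewrite !derivD !derivN !derivC !subr0 !deriv_comp !derivM !deriv_comp !dw !derivC.
rewrite !(hornerD, hornerM, horner_comp, hornerC) !w0 -[dist_poly^`()^`()]/(dist_poly^`(2)).
by rewrite -mulr_natr expr0 expr1; ring.
Qed.

(** Raising a zero coordinate to s adds s^a to the moment of exponent a, so the lowest order is the
    least exponent [a1]. *)
Lemma zero_order a1 i : a1 \in e -> (forall a, a \in e -> (a1 <= a)%N) ->
  (i < n)%N -> x i = 0 -> dist_poly`_a1 <= 0.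
Proof.
move=> a1e min_a1 lt_in xi.
have a1_gt0 : (0 < a1)%N by rewrite lt0n; apply: contraNneq e_gt0 => <-.
pose W k : {poly R} := if k == i then 'X else (x k)%:P.
have sumW (F : {poly R} -> R -> {poly R}) : (forall u, F u%:P u = 0) ->
    \sum_(k < n) F (W k) (x k) = F 'X 0.
  move=> F0; rewrite (@sum_single _ (fun k => F (W k) (x k)) i) // /W ?eqxx ?xi //.
  by move=> k /negPf->.
have B0 : 0 < B by rewrite -xi.
have := @curve_coef_le0 W a1 _ a1_gt0 B0.
rewrite (sumW (fun w u => dist_poly \Po w - dist_poly.[u]%:P)); last first.
  by move=> u; rewrite comp_polyCr subrr.
rewrite comp_polyXr coefB coefC (gtn_eqF a1_gt0) subr0; apply.
  move=> s k /andP[s0 sB] _; rewrite /W; case: eqP => _.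
    by rewrite hornerX !ltW.
  by rewrite hornerC x_ge0 ltW.
move=> a j ae lt_j; rewrite (sumW (fun w u => w ^+ a - (u ^+ a)%:P)); last first.
  by move=> u; rewrite polyC_exp subrr.
have lt_ja : (j < a)%N by rewrite (leq_trans lt_j) // min_a1.
rewrite coefB coefXn coefC (ltn_eqF lt_ja) sub0r expr0n (gtn_eqF (leq_ltn_trans (leq0n j) lt_ja)) /=.
by rewrite if_same oppr0.
Qed.
End LocalMinimum.

Lemma minimizer_gale (R : rcfType) n a1 e (z x : nat -> R) B :
    (forall i, 0 <= x i) -> (forall i j, (i <= j)%N -> x j <= x i) ->
    (forall i, (n <= i)%N -> x i = 0) -> x 0%N < B ->
    sorted ltn (a1 :: e) -> (0 < a1)%N -> (size e < n)%N ->
    (forall y, (forall i, (i < n)%N -> 0 <= y i <= B) ->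
       sq_dist n (a1 :: e) z x <= sq_dist n (a1 :: e) z y) ->
    ~ (forall a, a \in a1 :: e -> power_sum n x a = z a) ->
  exists mu p, [/\ gale n mu p, rank mu n = size e & block_cone n mu x].
Proof.
move=> x0 xd xn x_ltB sorted_e a1_gt0 lt_en min_x neq_z.
(* The zero sequence lies in every block cone, so any Gale set of the right size serves. *)
have [x0_le0|x0_gt0] := leP (x 0%N) 0.
  have xE i : x i = 0 by apply/le_anti; rewrite x0 (le_trans (xd 0%N i isT)).
  have rank0 k : rank pred0 k = 0%N by rewrite /rank big1.
  have [||mu [gmu rmu _]] := @gale_extend n pred0 false (size e).
  - by move=> i _ _; rewrite rank0.
  - by rewrite rank0 (ltnW lt_en).
  by exists mu, false; split=> //; split=> // i _ _; rewrite !xE.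
have uniq_e : uniq (a1 :: e) by apply: sorted_uniq sorted_e => //; [exact: ltn_trans | exact: ltnn].
have a1_min a : a \in a1 :: e -> (a1 <= a)%N.
  move: sorted_e; rewrite inE /= (path_sortedE ltn_trans) => /andP[/allP le_e _].
  by case/predU1P => [->//|/le_e/ltnW].
have e0 : 0%N \notin a1 :: e by apply/negP => /a1_min; rewrite leqNgt a1_gt0.
have xB i : x i < B by apply: le_lt_trans x_ltB; apply: xd.
apply: (@critical_gale R n x (dist_poly n (a1 :: e) z x) a1 e) => //.
- apply/negP => /eqP q0; apply: neq_z => a ae; apply/esym/eqP; rewrite -subr_eq0.
  by have := coef_dist_poly n z x uniq_e a; rewrite ae q0 coef0 => <-.
- by move=> i; rewrite coef_dist_poly //; case: ifP => //; rewrite eqxx.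
- by move=> i lt_in xi; apply: first_order.
- by move=> i lt_in eq_x xi; apply: second_order.
- by case=> i lt_in xi; apply: zero_order xi => //; exact: mem_head.
Qed.

From mathcomp Require Import all_classical all_reals all_analysis.
From mathcomp Require mpoly.
Import Order.TTheory GRing.Theory Num.Theory.
Import numFieldNormedType.Exports.
Local Open Scope classical_set_scope.
Local Open Scope ring_scope.

(** * The boundary of the moment set *)

Definition mem_nat n (mu : {set 'I_n}) : pred nat :=
  fun i => if insub i is Some o then o \in mu else false.

Lemma mem_nat_ord n (mu : {set 'I_n}) (i : 'I_n) : mem_nat mu i = (i \in mu).
Proof. by rewrite /mem_nat valK. Qed.

Lemma rank_mem_nat n (mu : {set 'I_n}) : rank (mem_nat mu) n = #|mu|.
Proof.
rewrite -sum1_card big_mkcond /=; apply: eq_bigr => i _.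
by rewrite mem_nat_ord; case: ifP.
Qed.

Lemma rank_tail (mu : pred nat) i n : (i <= n)%N -> (forall j, (i <= j < n)%N -> ~~ mu j) ->
  rank mu i = rank mu n.
Proof.
move=> le_in; rewrite -(subnKC le_in); elim: (n - i)%N => [|k IHk] mu_tail.
  by rewrite addn0.
rewrite addnS rankS -IHk => [|j /andP[le_ij lt_j]].
  by rewrite (negPf (mu_tail _ _)) ?addn0 // leq_addr addnS ltnSn.
by apply: mu_tail; rewrite le_ij addnS ltnS ltnW.
Qed.

Lemma gale_eq n (mu nu : pred nat) p : (forall i, (i < n)%N -> mu i = nu i) ->
  gale n mu p -> gale n nu p.
Proof.
move=> eq_mn gmu i lt_in nui; rewrite -(@eq_rank mu) => [|j lt_ji].
  by apply: gmu; rewrite ?eq_mn.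
by rewrite eq_mn // (ltn_trans lt_ji).
Qed.

Section Extension.
Variable R : realType.

Definition ext n (x : 'rV[R]_n) : nat -> R :=
  fun i => if insub i is Some o then x ord0 o else 0.

Lemma ext_ord n (x : 'rV[R]_n) (i : 'I_n) : ext x i = x ord0 i.
Proof. by rewrite /ext valK. Qed.

Lemma ext_out n (x : 'rV[R]_n) i : (n <= i)%N -> ext x i = 0.
Proof. by move=> le_ni; rewrite /ext insubF // ltnNge le_ni. Qed.

Lemma ext_ge0 n (x : 'rV[R]_n) : nonneg_orthant x -> forall i, 0 <= ext x i.
Proof. by move=> x0 i; rewrite /ext; case: insubP. Qed.

Lemma ext_row n (f : nat -> R) i : (forall i, (n <= i)%N -> f i = 0) ->
  ext (\row_(i < n) f i) i = f i.
Proof.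
move=> f0; have [lt_in|le_ni] := ltnP i n; last by rewrite ext_out ?f0.
by rewrite (ext_ord _ (Ordinal lt_in)) mxE.
Qed.

Lemma power_sum_ext n (x : 'rV[R]_n) a : power_sum n (ext x) a = \sum_(i < n) x ord0 i ^+ a.
Proof. by apply: eq_bigr => i _; rewrite ext_ord. Qed.

Lemma Rcone_block n (mu : {set 'I_n}) (x : 'rV[R]_n) :
  Rcone mu x <-> block_cone n (mem_nat mu) (ext x).
Proof.
split=> [[x0 [x_tail x_adj]]|[x0 xd xn x_eq]].
  have stepP i : ext x i.+1 <= ext x i.
    have [lt_i1|le_i1] := ltnP i.+1 n; last by rewrite ext_out // ext_ge0.
    rewrite (ext_ord x (Ordinal lt_i1)) (ext_ord x (Ordinal (ltnW lt_i1))).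
    by case: (x_adj (Ordinal (ltnW lt_i1)) (Ordinal lt_i1) erefl).
  split; first exact: ext_ge0.
  - move=> i j le_ij; rewrite -(subnKC le_ij); elim: (j - i)%N => [|k IHk].
      by rewrite addn0.
    by rewrite addnS (le_trans (stepP _)).
  - by move=> i le_ni; rewrite ext_out.
  - move=> i lt_in; rewrite (mem_nat_ord mu (Ordinal lt_in)) => imu.
    rewrite (ext_ord x (Ordinal lt_in)).
    have [lt_i1|le_i1] := ltnP i.+1 n.
      rewrite (ext_ord x (Ordinal lt_i1)).
      by case: (x_adj (Ordinal lt_in) (Ordinal lt_i1) erefl) => _; apply.
    (* Here [i] is the last index and not a member, so that all members precede it. *)
    rewrite ext_out // x_tail // => k kmu /=.
    have ne : k != Ordinal lt_in by apply: contraNneq imu => <-.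
    by rewrite ltn_neqAle -[i]/(val (Ordinal lt_in)) val_eqE ne /= -ltnS (leq_trans (ltn_ord k)).
split; first by move=> i; rewrite -ext_ord.
split=> [i k_lt|i j eq_j].
  rewrite -ext_ord (cone_eq0 (And4 x0 xd xn x_eq)) ?(ltnW (ltn_ord i)) //.
  apply: rank_tail => [|j /andP[le_ij lt_jn]]; first exact: ltnW.
  rewrite (mem_nat_ord mu (Ordinal lt_jn)); apply/negP => /k_lt /=.
  by rewrite ltnNge le_ij.
rewrite -!ext_ord eq_j xd //; split=> // imu.
by rewrite x_eq // mem_nat_ord.
Qed.

Lemma block_cone_eq n (mu nu : pred nat) (x y : nat -> R) :
    (forall i, (i < n)%N -> mu i = nu i) -> x =1 y ->
  block_cone n mu x -> block_cone n nu y.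
Proof.
move=> eq_mn /funext <- [x0 xd xn xe]; split=> // i lt_in.
by rewrite -eq_mn //; apply: xe.
Qed.

Lemma sort_vector n (x : 'rV[R]_n) : nonneg_orthant x -> exists f : nat -> R,
  [/\ forall i, 0 <= f i, forall i j, (i <= j)%N -> f j <= f i,
      forall i, (n <= i)%N -> f i = 0, power_sum n f =1 power_sum n (ext x) &
      forall B, (forall i, x ord0 i <= B) -> forall i, (i < n)%N -> f i <= B].
Proof.
move=> x0; pose s := sort >=%O [seq x ord0 i | i <- enum 'I_n].
have size_s : size s = n by rewrite size_sort size_map size_enum_ord.
have mem_s u : u \in s -> exists i, u = x ord0 i.
  by rewrite mem_sort => /mapP[i _ ->]; exists i.
have s0 i : 0 <= s`_i.
  have [lt_is|le_si] := ltnP i (size s); last by rewrite nth_default.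
  by have [j ->] := mem_s _ (mem_nth 0 lt_is); apply: x0.
exists (nth 0 s); split=> //.
- move=> i j le_ij; have [lt_js|le_sj] := ltnP j (size s); last by rewrite (nth_default _ le_sj).
  have ge_trans : transitive (>=%O : rel R) by move=> b c d /= cb bd; apply: le_trans bd cb.
  have ge_refl : reflexive (>=%O : rel R) by move=> b /=.
  have ge_tot : total (>=%O : rel R) by move=> b c /=; rewrite orbC; apply: le_total.
  apply: (sorted_leq_nth ge_trans ge_refl 0 (sort_sorted ge_tot _)) => //.
  by rewrite inE (leq_ltn_trans le_ij).
- by move=> i le_ni; rewrite nth_default // size_s.
- move=> a; rewrite power_sum_ext /power_sum.
  rewrite -(big_mkord xpredT (fun i => s`_i ^+ a)) -{1}size_s -(big_nth 0 xpredT (fun u => u ^+ a)).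
  by rewrite (perm_big _ (permEl (perm_sort _ _))) big_map big_enum.
move=> B xB i lt_in; rewrite -size_s in lt_in.
by have [j ->] := mem_s _ (mem_nth 0 lt_in).
Qed.

Lemma continuous_sum (T : topologicalType) (I : Type) (r : seq I) (f : I -> T -> R) (x : T) :
  (forall i, {for x, continuous (f i)}) ->
  {for x, continuous (fun y => \sum_(i <- r) f i y)}.
Proof.
move=> fc; elim: r => [|i r IHr].
  have e : cst 0 = (fun y => \sum_(i <- [::]) f i y).
    by apply: funext => y; rewrite big_nil.
  by case: _ / e; exact: cst_continuous.
have e : (f i + (fun y => \sum_(i <- r) f i y))%R = (fun y => \sum_(i <- i :: r) f i y).
  by apply: funext => y; rewrite big_cons.
by case: _ / e; exact: continuousD.
Qed.

Lemma continuous_power_sum n a : continuous (fun x : 'rV[R]_n => power_sum n (ext x) a).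
Proof.
have -> : (fun x : 'rV[R]_n => power_sum n (ext x) a) =
    (fun x : 'rV[R]_n => \sum_(i <- index_enum 'I_n) x ord0 i ^+ a).
  by apply: funext => x; rewrite power_sum_ext.
move=> x; apply: continuous_sum => i.
apply: (@continuous_comp _ _ _ (fun x : 'rV[R]_n => x ord0 i) (fun u : R => u ^+ a)).
  exact: coord_continuous.
exact: exprn_continuous.
Qed.

Lemma continuous_sq_dist n e z : continuous (fun x : 'rV[R]_n => sq_dist n e z (ext x)).
Proof.
move=> x; apply: (@continuous_sum _ _ e (fun a (x : 'rV[R]_n) => (power_sum n (ext x) a - z a) ^+ 2)) => a.
apply: (@continuous_comp _ _ _ (fun x : 'rV[R]_n => power_sum n (ext x) a - z a) (fun u : R => u ^+ 2)).
  apply: (@continuousB _ _ _ (fun x : 'rV[R]_n => power_sum n (ext x) a) (fun=> z a)).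
    exact: continuous_power_sum.
  exact: cst_continuous.
exact: exprn_continuous.
Qed.

Definition box n (B : R) : set 'rV[R]_n := [set x | forall i, 0 <= x ord0 i <= B].

Lemma box_compact n B : compact (@box n B).
Proof.
have := @rV_compact R n (fun=> `[0, B]%classic) (fun=> @segment_compact R 0 B).
by congr compact; apply/seteqP; split=> x /= xB i; have := xB i; rewrite in_itv.
Qed.

Lemma Rcone_closed n (mu : {set 'I_n}) : closed (@Rcone R n mu).
Proof.
have le_closed (f g : 'rV[R]_n -> R) : continuous f -> continuous g -> closed [set x | f x <= g x].
  move=> fc gc; rewrite (_ : [set x | _] = (fun x => g x - f x) @^-1` [set u | 0 <= u]).
    apply: preimage_closed; last exact: closed_ge.
    by move=> x _; apply: (@continuousB _ _ _ g f); [exact: gc | exact: fc].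
  by apply/seteqP; split=> x /=; rewrite subr_ge0.
have cc (i : 'I_n) : continuous (fun x : 'rV[R]_n => x ord0 i) by exact: coord_continuous.
have c0 : continuous ((fun=> 0) : 'rV[R]_n -> R) by exact: cst_continuous.
have all_closed (P : 'I_n -> Prop) (F : 'I_n -> set 'rV[R]_n) : (forall i, closed (F i)) ->
    closed [set x | forall i, P i -> F i x].
  move=> Fc; rewrite (_ : [set x | _] = \bigcap_(i in P) F i) //.
  by apply: closed_bigI => i _; exact: Fc.
have -> : @Rcone R n mu = [set x : 'rV[R]_n | forall i : 'I_n, True -> 0 <= x ord0 i]
    `&` ([set x : 'rV[R]_n | forall i : 'I_n, (forall k, k \in mu -> (k < i)%N) -> x ord0 i <= 0]
    `&` ([set x : 'rV[R]_n | forall i : 'I_n, True ->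
            forall j : 'I_n, j = i.+1 :> nat -> x ord0 j <= x ord0 i]
    `&` [set x : 'rV[R]_n | forall i : 'I_n, i \notin mu ->
            forall j : 'I_n, j = i.+1 :> nat -> x ord0 i <= x ord0 j])).
  apply/seteqP; split=> x /=.
    move=> [x0 [xt xa]]; split; first by move=> i _.
    split; first by move=> i /xt ->.
    by split=> [i _ j /xa[]|i imu j /xa[_ /(_ imu) ->]].
  move=> [x0 [xt [xd xe]]]; split; first by move=> i; apply: x0.
  split=> [i /xt xi|i j eq_j]; first by apply/le_anti; rewrite xi x0.
  by split=> [|imu]; [exact: xd|apply/le_anti/andP; split; [exact: xe|exact: xd]].
apply: closedI; first by apply: (all_closed) => i; exact: le_closed.
apply: closedI; first by apply: (all_closed) => i; exact: le_closed.
apply: closedI; apply: (all_closed) => i; apply: (all_closed) => j; exact: le_closed.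
Qed.

Lemma finite_pos_lower_bound (T : finType) (P : pred T) (Q : T -> R -> Prop) :
    (forall t d d', Q t d -> d' <= d -> Q t d') ->
    (forall t, P t -> exists2 d, 0 < d & Q t d) ->
  exists2 d, 0 < d & forall t, P t -> Q t d.
Proof.
move=> Qle ex_d.
have /choice[d dP] t : exists d, 0 < d /\ (P t -> Q t d).
  by have [/ex_d[d]|] := boolP (P t); [exists d | exists 1].
exists (\big[Num.min/1]_(t | P t) d t).
  by apply: lt_bigmin => [|t _]; [exact: ltr01 | case: (dP t)].
by move=> t Pt; apply: (Qle t (d t)); [case: (dP t) => _; apply | exact: bigmin_le_cond].
Qed.
Lemma sq_dist_eq n e z (x y : nat -> R) :
  (forall a, power_sum n x a = power_sum n y a) -> sq_dist n e z x = sq_dist n e z y.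
Proof. by move=> eq_xy; apply: eq_bigr => a _; rewrite eq_xy. Qed.

Lemma sq_dist_term n e z (x : nat -> R) a : a \in e ->
  (power_sum n x a - z a) ^+ 2 <= sq_dist n e z x.
Proof.
move=> ae; rewrite /sq_dist (big_rem a) //= lerDl sumr_ge0 // => b _; exact: sqr_ge0.
Qed.

Lemma sq_dist_ge0 n e z (x : nat -> R) : 0 <= sq_dist n e z x.
Proof. by apply: sumr_ge0 => a _; apply: sqr_ge0. Qed.

Lemma sq_dist_triangle n e z w (x : nat -> R) : sq_dist n e w x <=
  2 * (sq_dist n e z x + \sum_(a <- e) (w a - z a) ^+ 2).
Proof.
rewrite /sq_dist -big_split mulr_sumr; apply: ler_sum => a _ /=.
have := sqr_ge0 (power_sum n x a - z a + (w a - z a)).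
by rewrite -subr_ge0 => h; rewrite -subr_ge0; apply: le_trans h _; rewrite le_eqVlt; apply/orP; left; apply/eqP; ring.
Qed.

(** * Boundary points of the moment set lie over cones of Gale sets *)

Section GaleBoundary.
Variables (n a1 : nat) (e : seq nat) (x0 : 'rV[R]_n).
Let E := a1 :: e.
Hypotheses (sorted_e : sorted ltn E) (a1_gt0 : (0 < a1)%N) (lt_en : (size e < n)%N).
Hypothesis x0_ge0 : nonneg_orthant x0.
Let w a := power_sum n (ext x0) a.
(** The box contains [x0], and a point with a coordinate equal to [B] has its moment of exponent
    [a1] too far from [w a1] to be a minimizer. *)
Let B := 2 + w a1 + \sum_(i < n) x0 ord0 i.

Lemma w_ge0 a : 0 <= w a.
Proof. by apply: sumr_ge0 => i _; rewrite exprn_ge0 // ext_ge0. Qed.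

Lemma near_gale z (d : R) : d <= 1 / 4 -> sq_dist n E z (ext x0) < d ->
    ~ (exists2 y : 'rV[R]_n, nonneg_orthant y & forall a, a \in E -> power_sum n (ext y) a = z a) ->
  exists (mu : {set 'I_n}) p (x : 'rV[R]_n), [/\ gale n (mem_nat mu) p, #|mu| = size e,
     Rcone mu x, @box n B x & sq_dist n E w (ext x) <= 4 * d].
Proof.
move=> d4 lt_d nz.
have sum_x0 : 0 <= \sum_(i < n) x0 ord0 i by apply: sumr_ge0.
have w1 := w_ge0 a1.
have box_x0 : @box n B x0.
  move=> i; rewrite x0_ge0 /=.
  apply: (@le_trans _ _ (\sum_(i < n) x0 ord0 i)); last by rewrite /B; lra.
  by rewrite (bigD1 i) //= lerDl sumr_ge0.
have [x1 /set_mem box_x1 min_x1] := EVT_min_rV (ex_intro _ _ box_x0) (@box_compact n B)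
   (continuous_subspaceT (@continuous_sq_dist n E z)).
have x1_ge0 : nonneg_orthant x1 by move=> i; have /andP[] := box_x1 i.
have [f [f0 fd fn f_ps f_B]] := sort_vector x1_ge0.
have le_f : sq_dist n E z f <= sq_dist n E z (ext x0).
  by rewrite (sq_dist_eq _ _ f_ps) min_x1 // inE.
have n_gt0 : (0 < n)%N by exact: leq_ltn_trans lt_en.
have lt_f0 : f 0%N < B.
  have abs_lt (u : R) : u ^+ 2 < 1 / 4 -> - (1 / 2) < u < 1 / 2.
    by move=> lt_u; rewrite -ltr_norml -(@ltr_pXn2r _ 2) ?nnegrE ?normr_ge0 //; rewrite ?real_normK ?num_real //; lra.
  have a1E : a1 \in E by rewrite mem_head.
  have /andP[_ lt1] : - (1 / 2) < power_sum n f a1 - z a1 < 1 / 2.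
    by apply: abs_lt; have := sq_dist_term n z f a1E; lra.
  have /andP[lt2 _] : - (1 / 2) < w a1 - z a1 < 1 / 2.
    by apply: abs_lt; have := sq_dist_term n z (ext x0) a1E; rewrite -/(w a1); lra.
  have le_ps : f 0%N ^+ a1 <= power_sum n f a1.
    rewrite /power_sum (bigD1 (Ordinal n_gt0)) //= lerDl sumr_ge0 // => i _.
    by rewrite exprn_ge0.
  rewrite ltNge; apply/negP => le_B; have f1 : 1 <= f 0%N by move: le_B; rewrite /B; lra.
  by have := ler_eXnr a1_gt0 f1; move: le_B; rewrite /B; lra.
have min_f y : (forall i, (i < n)%N -> 0 <= y i <= B) -> sq_dist n E z f <= sq_dist n E z y.
  move=> yB; pose y' : 'rV[R]_n := \row_(i < n) y i.
  have -> : sq_dist n E z y = sq_dist n E z (ext y').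
    apply: sq_dist_eq => a; apply: eq_bigr => i _; by rewrite ext_ord mxE.
  rewrite (sq_dist_eq _ _ f_ps) min_x1 // inE => i; rewrite mxE; exact: yB.
have neq_f : ~ (forall a, a \in E -> power_sum n f a = z a).
  by move=> eq_f; apply: nz; exists x1 => // a aE; rewrite -f_ps eq_f.
have [mu [p [gmu rmu cmu]]] := minimizer_gale f0 fd fn lt_f0 sorted_e a1_gt0 lt_en min_f neq_f.
pose nu : {set 'I_n} := finset (fun i : 'I_n => mu i).
have eq_nu i : (i < n)%N -> mu i = mem_nat nu i.
  by move=> lt_in; rewrite (mem_nat_ord nu (Ordinal lt_in)) finset.in_set.
exists nu, p, (\row_(i < n) f i); split.
- exact: gale_eq gmu.
- by rewrite -rank_mem_nat -rmu; apply/esym/eq_rank.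
- by apply/Rcone_block; apply: block_cone_eq cmu => // i; rewrite ext_row.
- by move=> i; rewrite mxE f0 f_B // => j; have /andP[] := box_x1 j.
rewrite (@sq_dist_eq _ _ _ _ f) => [|a]; last by apply: eq_bigr => i _; rewrite ext_row.
have := sq_dist_triangle n E z w f.
rewrite (_ : \sum_(a <- E) _ = sq_dist n E z (ext x0)) //; lra.
Qed.

(** There are finitely many Gale sets, and on the compact part of each cone in the box the distance
    to [w] has a minimum. If all minima were positive, the minimizers of [near_gale] could not come
    arbitrarily close to [w]. *)
Lemma gale_boundary :
    (forall d : R, 0 < d -> exists2 z, sq_dist n E z (ext x0) < d &
      ~ (exists2 y : 'rV[R]_n, nonneg_orthant y & forall a, a \in E -> power_sum n (ext y) a = z a)) ->
  exists (mu : {set 'I_n}) p (x : 'rV[R]_n), [/\ gale n (mem_nat mu) p, #|mu| = size e,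
    Rcone mu x & forall a, a \in E -> power_sum n (ext x) a = w a].
Proof.
move=> near_x0; apply: contrapT => no_x.
pose P := [pred mu : {set 'I_n} | `[< exists2 p, gale n (mem_nat mu) p & #|mu| = size e >]].
have [||d d0 dP] := @finite_pos_lower_bound _ P
  (fun mu d => forall x : 'rV[R]_n, Rcone mu x -> @box n B x -> d <= sq_dist n E w (ext x)).
- by move=> mu d d' le_d le_d' x Cx Bx; apply: le_trans le_d' _; apply: le_d.
- move=> mu /asboolP[p gmu card_mu].
  have Kc : compact (@box n B `&` Rcone mu) by apply: compact_closedI; [exact: box_compact | exact: Rcone_closed].
  have K0 : (@box n B `&` Rcone mu) !=set0.
    exists 0; split.
      move=> i; rewrite mxE lexx /B; have := w_ge0 a1.
      have : 0 <= \sum_(i < n) x0 ord0 i by apply: sumr_ge0.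
      by lra.
    by split=> [i|]; [rewrite mxE | split=> [i _|i j _]; rewrite !mxE].
  have [x /set_mem[Bx Cx] min_x] := EVT_min_rV K0 Kc (continuous_subspaceT (@continuous_sq_dist n E w)).
  exists (sq_dist n E w (ext x)); last by move=> y Cy By; apply: min_x; rewrite inE.
  rewrite lt0r sq_dist_ge0 andbT; apply/eqP => x_0; apply: no_x.
  exists mu, p, x; split=> // a aE; apply/eqP; rewrite -subr_eq0 -sqrf_eq0.
  by apply/eqP/le_anti; rewrite sqr_ge0 andbT -x_0 sq_dist_term.
(* [near_gale] requires at most 1/4, and its factor 4 turns [d / 8] into [d / 2]. *)
have d'0 : 0 < Num.min (1 / 4) (d / 8) by rewrite lt_min; apply/andP; split; lra.
have [z lt_z nz] := near_x0 _ d'0.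
have [|mu [p [x [gmu card_mu Cx Bx le_x]]]] := near_gale _ lt_z nz; first by rewrite ge_min lexx.
have Pmu : P mu by apply/asboolP; exists p.
have := dP mu Pmu x Cx Bx; have : Num.min (1 / 4) (d / 8) <= d / 8 by rewrite ge_min lexx orbT.
by lra.
Qed.
End GaleBoundary.
End Extension.

(** * The normalized norm map *)

Section Topology.
Variable R : realType.

Lemma continuous_row (T : topologicalType) m (f : 'I_m -> T -> R) (x : T) :
  (forall j, {for x, continuous (f j)}) ->
  {for x, continuous (fun y => \row_(j < m) f j y)}.
Proof.
move=> fc U [P nbhsP subU]; apply: filterS (subU) _ => /=.
have : \forall y \near x, forall j, P ord0 j (f j y).
  by apply: filter_forall => j; apply: fc; have := nbhsP ord0 j; rewrite mxE.
by apply: filterS => y Py i j; rewrite mxE ord1.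
Qed.

(** Closed subsets of a compact set have compact, hence closed, images in a Hausdorff space. *)
Lemma compact_inverse_continuous (T U : topologicalType) (S : set T) (f : T -> U) (g : U -> T) :
  hausdorff_space U -> compact S -> {within S, continuous f} ->
  (forall x, S x -> g (f x) = x) -> {within f @` S, continuous g}.
Proof.
move=> hU cS fc gK; apply/subspace_continuousP => _ [x Sx <-] A.
move=> gA; have nbhsA : nbhs x A by rewrite -(gK x Sx).
have cK : compact (f @` (S `&` ~` A^°)).
  apply: continuous_compact.
    by apply: continuous_subspaceW fc => y [].
  by apply: compact_closedI => //; apply: open_closedC; exact: open_interior.
have clK := compact_closed hU cK.
have nK : (~` (f @` (S `&` ~` A^°))) (f x).
  move=> [y [Sy nAy] eq_f]; apply: nAy; have <- : x = y by rewrite -(gK x) // -(gK y) // eq_f.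
  exact: nbhsA.
have nbhs_nK := open_nbhs_nbhs (conj (closed_openC clK) nK).
apply: filterS nbhs_nK => fy nKy [y Sy eq_y]; move: nKy; rewrite -eq_y => nKy.
change (A (g (f y))); rewrite gK //; apply: contrapT => nAy.
by apply: nKy; exists y => //; split=> // /interior_subset.
Qed.
End Topology.

Section Psi.
Variable R : realType.
Implicit Types (n m : nat).

Lemma psi_domP n (x : 'rV[R]_n) : @psi_dom R n x <-> nonneg_orthant x /\ x != 0.
Proof. by split=> -[x0 /eqP nx]; split=> //; apply/eqP. Qed.

Lemma pnormE n p (x : 'rV[R]_n) : pnorm p x = power_sum n (ext x) p `^ p%:R^-1.
Proof. by rewrite power_sum_ext. Qed.

Lemma power_sum_ge0 n p (f : nat -> R) : (forall i, 0 <= f i) -> 0 <= power_sum n f p.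
Proof. by move=> f0; apply: sumr_ge0 => i _; rewrite exprn_ge0. Qed.

Lemma pnorm_exp n p (x : 'rV[R]_n) : nonneg_orthant x -> (0 < p)%N ->
  pnorm p x ^+ p = power_sum n (ext x) p.
Proof.
move=> x0 p0; have s0 := power_sum_ge0 n p (ext_ge0 x0).
rewrite pnormE -powR_mulrn ?powR_ge0 // -powRrM mulVf ?powRr1 //.
by rewrite pnatr_eq0 -lt0n.
Qed.

Lemma pnorm_ge0 n p (x : 'rV[R]_n) : 0 <= pnorm p x.
Proof. exact: powR_ge0. Qed.

Lemma power_sum_gt0 n p (x : 'rV[R]_n) : psi_dom x -> 0 < power_sum n (ext x) p.
Proof.
move=> /psi_domP[x0 nx]; have [i xi] : exists i, x ord0 i != 0.
  apply: contrapT => nex; case/eqP: nx; apply/rowP => i; rewrite mxE.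
  by apply/eqP; apply: contrapT => /negP xi; apply: nex; exists i.
rewrite power_sum_ext (bigD1 i) //= ltr_pwDl ?exprn_gt0 ?lt0r ?xi ?x0 //.
by apply: sumr_ge0 => j _; rewrite exprn_ge0.
Qed.

Lemma pnorm_gt0 n p (x : 'rV[R]_n) : psi_dom x -> 0 < pnorm p x.
Proof. by move=> dx; rewrite pnormE powR_gt0 // power_sum_gt0. Qed.

Lemma eq_pnorm n p (x : 'rV[R]_n) c : nonneg_orthant x -> (0 < p)%N -> 0 <= c ->
  power_sum n (ext x) p = c ^+ p -> pnorm p x = c.
Proof.
move=> x0 p0 c0 eq_c; apply/eqP.
by rewrite -(@eqrXn2 _ p) ?pnorm_ge0 // pnorm_exp // eq_c.
Qed.

Lemma ext_scale n t (x : 'rV[R]_n) i : ext (t *: x) i = t * ext x i.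
Proof. by rewrite /ext; case: insubP => [j _ _|_]; rewrite ?mxE ?mulr0. Qed.

Lemma power_sum_scale n p t (x : 'rV[R]_n) :
  power_sum n (ext (t *: x)) p = t ^+ p * power_sum n (ext x) p.
Proof.
by rewrite /power_sum mulr_sumr; apply: eq_bigr => i _; rewrite ext_scale exprMn.
Qed.

Lemma nonneg_scale n t (x : 'rV[R]_n) : 0 <= t -> nonneg_orthant x -> nonneg_orthant (t *: x).
Proof. by move=> t0 x0 i; rewrite mxE mulr_ge0. Qed.

Lemma psi_dom_scale n t (x : 'rV[R]_n) : 0 < t -> psi_dom x -> psi_dom (t *: x).
Proof.
move=> t0 /psi_domP[x0 nx]; apply/psi_domP; split; first exact: nonneg_scale (ltW t0) x0.
by rewrite scaler_eq0 negb_or gt_eqF.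
Qed.

Lemma pnorm_scale n p t (x : 'rV[R]_n) : (0 < p)%N -> 0 <= t -> nonneg_orthant x ->
  pnorm p (t *: x) = t * pnorm p x.
Proof.
move=> p0 t0 x0; apply: eq_pnorm; rewrite ?mulr_ge0 ?pnorm_ge0 //; first exact: nonneg_scale.
by rewrite power_sum_scale exprMn pnorm_exp.
Qed.

Lemma continuous_pnorm n p (x : 'rV[R]_n) : psi_dom x -> {for x, continuous (@pnorm R n p)}.
Proof.
move=> dx; rewrite (_ : @pnorm R n p = (fun u => u `^ p%:R^-1) \o (fun x => power_sum n (ext x) p)).
  apply: continuous_comp; first exact: continuous_power_sum.
  apply/differentiable_continuous/derivable1_diffP.
  by apply: derivable_powR; rewrite in_itv /= andbT power_sum_gt0.
by apply: funext => y; rewrite pnormE.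
Qed.

Variables (m n : nat) (a : 'I_m -> nat).
Hypotheses (m_gt0 : (0 < m)%N) (a_gt0 : forall j, (0 < a j)%N).
Implicit Types x y : 'rV[R]_n.

Definition pnorm_sum x : R := \sum_(k < m) pnorm (a k) x.

Lemma pnorm_sum_gt0 x : psi_dom x -> 0 < pnorm_sum x.
Proof.
move=> dx; rewrite /pnorm_sum (bigD1 (Ordinal m_gt0)) //= ltr_pwDl ?pnorm_gt0 //.
by apply: sumr_ge0 => i _; apply: pnorm_ge0.
Qed.

Lemma psi_row x j : psiA a x ord0 j = pnorm (a j) x / pnorm_sum x.
Proof. by rewrite mxE. Qed.

Lemma psi_scale t x : 0 < t -> psi_dom x -> psiA a (t *: x) = psiA a x.
Proof.
move=> t0 dx; have [x0 _] := (psi_domP x).1 dx; apply/rowP => j; rewrite !psi_row.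
have -> : pnorm_sum (t *: x) = t * pnorm_sum x.
  by rewrite /pnorm_sum mulr_sumr; apply: eq_bigr => k _; rewrite pnorm_scale // ltW.
by rewrite pnorm_scale ?(ltW t0) // -mulf_div divff ?mul1r // gt_eqF.
Qed.

Lemma psi_eq x y : (forall j, power_sum n (ext x) (a j) = power_sum n (ext y) (a j)) ->
  psiA a x = psiA a y.
Proof.
move=> eq_xy; have eq_p j : pnorm (a j) x = pnorm (a j) y by rewrite !pnormE eq_xy.
apply/rowP => j; rewrite !psi_row eq_p; congr (_ / _).
by apply: eq_bigr => k _.
Qed.

Lemma psi_sum1 x : psi_dom x -> sum_one_hyperplane (psiA a x).
Proof.
move=> dx; rewrite /sum_one_hyperplane /=; under eq_bigr do rewrite psi_row.
by rewrite -mulr_suml divff // gt_eqF // pnorm_sum_gt0.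
Qed.

(** Dividing by the sum of the norms makes the norms equal to the coordinates of the image; the
    factor [c] serves to reach a multiple of them. *)
Lemma psi_normalize x : psi_dom x -> exists t, 0 < t /\
  forall c j, 0 <= c -> power_sum n (ext ((c * t) *: x)) (a j) = (c * psiA a x ord0 j) ^+ a j.
Proof.
move=> dx; have [x0 _] := (psi_domP x).1 dx; exists (pnorm_sum x)^-1.
split=> [|c j c0]; first by rewrite invr_gt0 pnorm_sum_gt0.
have t0 : 0 <= c / pnorm_sum x by rewrite divr_ge0 // ltW // pnorm_sum_gt0.
rewrite -pnorm_exp //; last exact: nonneg_scale.
by rewrite pnorm_scale // psi_row mulrAC mulrA.
Qed.

Lemma psi_of_norms x (v : 'rV[R]_m) : nonneg_orthant x -> sum_one_hyperplane v ->
  (forall j, 0 <= v ord0 j) -> (forall j, power_sum n (ext x) (a j) = v ord0 j ^+ a j) ->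
  psiA a x = v.
Proof.
move=> x0 sv v0 eq_v; have eq_p j : pnorm (a j) x = v ord0 j by apply: eq_pnorm.
apply/rowP => j; rewrite psi_row eq_p /pnorm_sum (eq_bigr (fun k => v ord0 k)) //.
by rewrite sv divr1.
Qed.

Lemma psi_inj_scale x y : psi_dom x -> psi_dom y -> psiA a x = psiA a y ->
  exists2 t, 0 < t & forall j, power_sum n (ext x) (a j) = power_sum n (ext (t *: y)) (a j).
Proof.
move=> dx dy eq_xy; have [x0 _] := (psi_domP x).1 dx; have [y0 _] := (psi_domP y).1 dy.
have [sx sy] := (pnorm_sum_gt0 dx, pnorm_sum_gt0 dy).
exists (pnorm_sum x / pnorm_sum y) => [|j]; first exact: divr_gt0.
rewrite power_sum_scale -!pnorm_exp // -exprMn; congr (_ ^+ _).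
have := congr1 (fun u : 'rV[R]_m => u ord0 j) eq_xy; rewrite !psi_row => eq_j.
by rewrite mulrAC -mulrA -eq_j mulrC divfK // gt_eqF.
Qed.

Lemma continuous_psi x : psi_dom x -> {for x, continuous (@psiA R m n a)}.
Proof.
move=> dx; apply: (@continuous_row R _ m (fun j y => pnorm (a j) y / \sum_(k < m) pnorm (a k) y)) => j.
apply: (@continuousM _ _ (@pnorm R n (a j)) (fun y => (\sum_(k < m) pnorm (a k) y)^-1)).
  exact: continuous_pnorm.
apply: continuousV; first by rewrite gt_eqF // pnorm_sum_gt0.
by apply: continuous_sum => k; exact: continuous_pnorm.
Qed.
End Psi.

(** * Generators and cross-sections of the cones *)

Section ConeGenerators.
Variables (R : realType) (n : nat).
Implicit Types (nu mu : {set 'I_n}) (x y : 'rV[R]_n).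

Definition elt nu (k : 'I_#|nu|) : 'I_n := enum_val k.

Lemma elt_in nu (k : 'I_#|nu|) : elt k \in nu.
Proof. exact: enum_valP. Qed.

Lemma eq_elt nu (j k : 'I_#|nu|) : (elt j == elt k :> nat) = (j == k).
Proof. by rewrite (inj_eq val_inj) (inj_eq enum_val_inj). Qed.

Definition gen_vector nu (k : 'I_#|nu|) : 'rV[R]_n := \row_(i < n) (i <= elt k)%N%:R.

(** The gaps at the elements of nu are the coordinates with respect to the vectors [gen_vector]. *)
Definition gap x i := ext x i - ext x i.+1.

Lemma ext_sum (K : nat) (c : 'I_K -> R) (V : 'I_K -> 'rV[R]_n) i :
  ext (\sum_k c k *: V k) i = \sum_k c k * ext (V k) i.
Proof.
rewrite /ext; case: insubP => [j _ _|_]; last by rewrite big1 // => k _; rewrite mulr0.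
by rewrite summxE; apply: eq_bigr => k _; rewrite mxE.
Qed.

Lemma ext_gen nu k i : ext (@gen_vector nu k) i = (i <= elt k)%N%:R.
Proof.
have [lt_in|le_ni] := ltnP i n; first by rewrite (ext_ord _ (Ordinal lt_in)) mxE.
by rewrite ext_out // leqNgt (leq_trans (ltn_ord _) le_ni).
Qed.

Lemma gap_sum (K : nat) (c : 'I_K -> R) (V : 'I_K -> 'rV[R]_n) i :
  gap (\sum_k c k *: V k) i = \sum_k c k * gap (V k) i.
Proof. by rewrite /gap !ext_sum -sumrB; apply: eq_bigr => k _; rewrite mulrBr. Qed.

Lemma gap_gen nu k i : gap (@gen_vector nu k) i = (i == elt k :> nat)%:R.
Proof. by rewrite /gap !ext_gen; case: ltngtP => _; rewrite ?subrr ?subr0. Qed.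

Lemma gap_comb nu (c : 'I_#|nu| -> R) k :
  gap (\sum_k c k *: gen_vector k) (elt k) = c k.
Proof.
rewrite gap_sum (bigD1 k) //= gap_gen eqxx mulr1 big1 ?addr0 // => j nj.
by rewrite gap_gen eq_elt eq_sym (negPf nj) mulr0.
Qed.

Lemma gen_comb_inj nu (c c' : 'I_#|nu| -> R) :
  \sum_k c k *: gen_vector k = \sum_k c' k *: gen_vector k -> c =1 c'.
Proof. by move=> eq_c k; rewrite -(gap_comb c) eq_c gap_comb. Qed.

Lemma gap_scale t x i : gap (t *: x) i = t * gap x i.
Proof. by rewrite /gap !ext_scale mulrBr. Qed.

(** Summation by parts. The values on the blocks may come in any order, as happens when blocks are
    permuted for the Zariski closures. *)
Lemma block_coords nu x :
    (forall i, (i < n)%N -> ~~ mem_nat nu i -> ext x i = ext x i.+1) ->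
  x = \sum_(k < #|nu|) gap x (elt k) *: gen_vector k.
Proof.
move=> x_eq; apply/rowP => i.
rewrite -ext_ord -[RHS]ext_ord ext_sum.
under eq_bigr do rewrite ext_gen.
transitivity (\sum_(k in nu) gap x k * (i <= k)%N%:R); last by rewrite big_enum_val.
have -> : \sum_(k in nu) gap x k * (i <= k)%N%:R = \sum_(k < n) gap x k * (i <= k)%N%:R.
  rewrite [RHS](bigID (mem nu)) /= [X in _ = _ + X]big1 ?addr0 // => k knu.
  by rewrite /gap x_eq ?subrr ?mul0r // mem_nat_ord.
rewrite -(big_mkord xpredT (fun k => gap x k * (i <= k)%N%:R)).
rewrite (big_cat_nat (n := i)) //=; last exact: ltnW.
rewrite big_nat_cond big1 ?add0r => [|k /andP[/andP[_ lt_ki] _]]; last by rewrite leqNgt lt_ki mulr0.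
rewrite (eq_big_nat _ _ (F2 := fun k => gap x k)) => [|k /andP[-> _]]; last by rewrite mulr1.
rewrite -[RHS]opprK -sumrN.
under eq_bigr do rewrite /gap opprB.
by rewrite telescope_sumr ?(ltnW (ltn_ord i)) // opprB [ext x n]ext_out // subr0.
Qed.

Lemma cone_coords nu x : Rcone nu x -> x = \sum_(k < #|nu|) gap x (elt k) *: gen_vector k.
Proof. by move=> /Rcone_block[_ _ _ x_eq]; exact: block_coords. Qed.

Lemma gap_ge0 nu x i : Rcone nu x -> 0 <= gap x i.
Proof. by move=> /Rcone_block[_ xd _ _]; rewrite subr_ge0 xd. Qed.

Lemma comb_cone nu (c : 'I_#|nu| -> R) : (forall k, 0 <= c k) ->
  Rcone nu (\sum_k c k *: gen_vector k).
Proof.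
move=> c0; apply/Rcone_block; split=> [i|i j le_ij|i le_ni|i lt_in imu].
- by rewrite ext_sum sumr_ge0 // => k _; rewrite ext_gen mulr_ge0.
- rewrite !ext_sum; apply: ler_sum => k _; rewrite !ext_gen ler_wpM2l // ler_nat.
  by have [/(leq_trans le_ij)->|] := leqP j (elt k); rewrite ?leq0n.
- by rewrite ext_out.
rewrite !ext_sum; apply: eq_bigr => k _; rewrite !ext_gen leq_eqVlt.
case: eqP => // eq_i; case/negP: imu; rewrite /= eq_i mem_nat_ord.
exact: elt_in.
Qed.

Lemma conv_simplex (K : nat) (P : 'I_K -> bool) (V : 'I_K -> 'rV[R]_n) : conv_on P V `<=` simplex_of V.
Proof. by move=> x [c [c0 [cP [c1 ->]]]]; exists c. Qed.

(** The scaling factor of a point is the sum of its gap coordinates, which is 1 exactly on the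
    simplex. *)
Lemma gen_cross_section nu : (0 < #|nu|)%N -> cross_section (@Rcone R n nu) (@gen_vector nu).
Proof.
move=> nu0; split=> [c _ c_eq0 k|].
  by have := @gen_comb_inj nu c (fun=> 0) _ k; apply; rewrite c_eq0 big1 // => j _; rewrite scale0r.
split=> [_ [c [c0 [_ [c1 ->]]]]|x Cx nx].
  split; first exact: comb_cone.
  move=> /= c_eq0; have := oner_neq0 R; rewrite -c1 big1 ?eqxx // => k _.
  by have := @gen_comb_inj nu c (fun=> 0) _ k; apply; rewrite c_eq0 big1 // => j _; rewrite scale0r.
pose c (k : 'I_#|nu|) := gap x (elt k); have c0 k : 0 <= c k by exact: gap_ge0 (Cx).
pose t := \sum_k c k; have x_eq : x = \sum_k c k *: gen_vector k by exact: cone_coords.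
have t0 : 0 < t.
  rewrite lt0r sumr_ge0 ?andbT //; apply: contraNneq nx => /eqP.
  rewrite psumr_eq0 // => /allP ck; rewrite x_eq big1 // => k _.
  by have /eqP-> := ck k (mem_index_enum _); rewrite scale0r.
have sum_t c' : \sum_k (c' k / t) *: @gen_vector nu k = t^-1 *: \sum_k c' k *: gen_vector k.
  by rewrite scaler_sumr; apply: eq_bigr => k _; rewrite scalerA mulrC.
exists t, (t^-1 *: x); split=> //; split.
  exists (fun k => c k / t); split; first by move=> k; rewrite divr_ge0 // ltW.
  split=> //; split; first by rewrite -mulr_suml divff // gt_eqF.
  by rewrite {1}x_eq sum_t.
split; first by rewrite scalerA divff ?scale1r // gt_eqF.
move=> t' y' t'0 [c' [c'0 [_ [c'1 ->]]]] x_eq'.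
have eq_c k : c k = t' * c' k.
  by rewrite /c x_eq' gap_scale gap_comb.
have eq_t : t' = t by rewrite /t (eq_bigr _ (fun k _ => eq_c k)) -mulr_sumr c'1 mulr1.
by split=> //; rewrite x_eq' eq_t scalerA mulVf ?scale1r // gt_eqF.
Qed.

Lemma RconeS mu nu : mu \subset nu -> @Rcone R n mu `<=` Rcone nu.
Proof.
move=> /fintype.subsetP sub x [x0 [xt xa]]; split=> //; split=> [i lt_i|i j eq_j].
  by apply: xt => k /sub; apply: lt_i.
have [le_x eq_x] := xa i j eq_j; split=> // inu; apply: eq_x.
by apply: contra inu; apply: sub.
Qed.

Lemma Rcone_gap0 nu x (k : 'I_n) : Rcone nu x -> gap x k = 0 -> Rcone (nu :\ k)%SET x.
Proof.
move=> /Rcone_block[x0 xd xn xe] gap0; apply/Rcone_block; split=> // i lt_in.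
rewrite (mem_nat_ord _ (Ordinal lt_in)) in_setD1 negb_and negbK => /orP[/eqP eq_k|inu].
  by move: gap0; rewrite /gap -eq_k /= => /eqP; rewrite subr_eq0 => /eqP.
by apply: xe => //; rewrite (mem_nat_ord _ (Ordinal lt_in)).
Qed.

Lemma gap_Rcone_notin nu x (k : 'I_n) : Rcone nu x -> k \notin nu -> gap x k = 0.
Proof.
move=> /Rcone_block[_ _ _ xe] knu; rewrite /gap xe ?subrr ?mem_nat_ord //.
Qed.

Lemma Rcone_nonneg nu x : Rcone nu x -> nonneg_orthant x.
Proof. by case. Qed.

Lemma Rcone_dom nu x : (Rcone nu `\ (0 : 'rV[R]_n)) x -> psi_dom x.
Proof. by move=> [Cx nx]; split=> //; exact: Rcone_nonneg Cx. Qed.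

(* The two nonnegative matrices expressing the given vertices and the
   generators through each other are inverse to each other, hence monomial *)
Lemma cross_section_vertices nu (V : 'I_#|nu| -> 'rV[R]_n) :
  cross_section (Rcone nu) V -> exists tau : 'I_#|nu| -> 'I_#|nu|, bijective tau /\
    forall k, exists2 al : R, 0 < al & V (tau k) = al *: gen_vector k.
Proof.
move=> [_ [V_cone V_ray]].
have V_simplex i : simplex_of V (V i).
  exists (fun j => (j == i)%:R); split=> [j|]; first exact: ler0n.
  split=> //; split.
    by rewrite (bigD1 i) //= eqxx big1 ?addr0 // => j /negPf->.
  by rewrite (bigD1 i) //= eqxx scale1r big1 ?addr0 // => j /negPf->; rewrite scale0r.
have key (k : 'I_#|nu|) : exists i, exists2 al : R, 0 < al & V i = al *: gen_vector k.
  have gE : @gen_vector nu k = \sum_j (j == k)%:R *: gen_vector j.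
    by rewrite (bigD1 k) //= eqxx scale1r big1 ?addr0 // => j /negPf->; rewrite scale0r.
  have Cg : Rcone nu (@gen_vector nu k) by rewrite gE; apply: comb_cone => j; exact: ler0n.
  have ng : @gen_vector nu k != 0.
    apply/eqP => g0; have := gap_gen k (elt k); rewrite g0 eqxx /gap /ext.
    by case: insubP => [? _ _|_]; case: insubP => [? _ _|_]; rewrite ?mxE subrr => /eqP; rewrite eq_sym oner_eq0.
  have [t [y [t0 [[b [b0 [_ [_ y_eq]]]] [g_eq _]]]]] := V_ray _ Cg ng.
  pose A i (j : 'I_#|nu|) := gap (V i) (elt j).
  have CV i : Rcone nu (V i) by case: (V_cone _ (V_simplex i)).
  have A0 i j : 0 <= A i j by exact: gap_ge0 (CV i).
  (* The k-th generator is a nonnegative combination of vertices with nonnegative coordinates: a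
     vertex that occurs in it has no coordinate other than the k-th. *)
  have sumA j : t * \sum_i b i * A i j = (j == k)%:R.
    rewrite -gap_sum -y_eq -gap_scale -g_eq gap_gen.
    by rewrite eq_elt.
  have [i bi] : exists i, 0 < b i * A i k.
    apply: contrapT => no_i; have := sumA k; rewrite eqxx big1 ?mulr0; last first.
      move=> i _; apply/le_anti; rewrite mulr_ge0 // andbT leNgt; apply/negP => bi.
      by apply: no_i; exists i.
    by move/eqP; rewrite eq_sym oner_eq0.
  have bi0 : 0 < b i by rewrite lt0r b0 andbT; apply: contraTneq bi => ->; rewrite mul0r ltxx.
  have Aik : 0 < A i k by rewrite -(pmulr_rgt0 _ bi0).
  exists i, (A i k) => //; rewrite {1}(cone_coords (CV i)) (bigD1 k) //= big1 ?addr0 // => j nj.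
  have /eqP := sumA j; rewrite (negPf nj) mulf_eq0 (gt_eqF t0) /= psumr_eq0; last first.
    by move=> l _; rewrite mulr_ge0.
  move=> /allP/(_ i (mem_index_enum _)); rewrite /= mulf_eq0 (gt_eqF bi0) /=.
  by rewrite /A => /eqP->; rewrite scale0r.
have [tau tauP] := choice key; exists tau; split=> //.
apply: injF_bij => k k' eq_tau; have [al al0 Vk] := tauP k; have [al' al'0 Vk'] := tauP k'.
have := congr1 (fun x => gap x (elt k)) Vk; rewrite eq_tau Vk' !gap_scale !gap_gen eqxx mulr1 eq_elt.
by case: eqP => // _ /eqP; rewrite mulr0 eq_sym gt_eqF.
Qed.
End ConeGenerators.

(** * The image and its boundary *)

Section Image.
Variables (R : realType) (m n : nat) (a : 'I_m -> nat).
Hypotheses (m_gt0 : (0 < m)%N) (le_mn : (m <= n)%N).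
Hypotheses (a_gt0 : forall j, (0 < a j)%N) (a_incr : forall i j : 'I_m, (i < j)%N -> (a i < a j)%N).
Implicit Types (nu mu : {set 'I_n}) (x y : 'rV[R]_n).

Definition exponents := [seq a j | j <- enum 'I_m].

Lemma size_exponents : size exponents = m.
Proof. by rewrite size_map size_enum_ord. Qed.

Lemma mem_exponents j : a j \in exponents.
Proof. by rewrite map_f // mem_enum. Qed.

Lemma exponentsP p : p \in exponents -> exists j, p = a j.
Proof. by move=> /mapP[j _ ->]; exists j. Qed.

Lemma exponents_n0 : 0%N \notin exponents.
Proof. by apply/negP => /exponentsP[j j0]; have := a_gt0 j; rewrite -j0. Qed.

Lemma sorted_exponents : sorted ltn exponents.
Proof.
rewrite /exponents (sorted_map (f := a)); apply: (@sub_sorted _ (relpre val ltn)).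
  by move=> i j; apply: a_incr.
by rewrite -sorted_map val_enum_ord iota_ltn_sorted.
Qed.

Lemma uniq_exponents : uniq exponents.
Proof. by apply: sorted_uniq sorted_exponents; [exact: ltn_trans | exact: ltnn]. Qed.

Lemma exponents_cons : exists a1 e, exponents = a1 :: e.
Proof.
case defE: exponents => [|a1 e]; last by exists a1, e.
by have := m_gt0; rewrite -size_exponents defE.
Qed.

Lemma inj_exponents : injective a.
Proof.
move=> i j eq_a; apply: val_inj; case: (ltngtP i j) => // /a_incr; rewrite eq_a ltnn //.
Qed.

Lemma psi_eq_exponents x y :
    (forall p, p \in exponents -> power_sum n (ext x) p = power_sum n (ext y) p) ->
  psiA a x = psiA a y.
Proof. by move=> eq_xy; apply: psi_eq => j; apply: eq_xy; exact: mem_exponents. Qed.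

Lemma dom_of_power_sums x y : psi_dom x -> nonneg_orthant y ->
    (forall p, p \in exponents -> power_sum n (ext y) p = power_sum n (ext x) p) ->
  psi_dom y.
Proof.
move=> dx y0 eq_xy; apply/psi_domP; split=> //; apply/eqP => y_eq0.
have j0 := Ordinal m_gt0; have := power_sum_gt0 (a j0) dx.
rewrite -eq_xy ?mem_exponents // y_eq0 power_sum_ext big1 ?ltxx // => i _.
by rewrite mxE expr0n gtn_eqF.
Qed.

Lemma coord_le_power_sum x p c : nonneg_orthant x -> (0 < p)%N -> 0 <= c ->
  power_sum n (ext x) p <= c -> forall i, x ord0 i <= 1 + c.
Proof.
move=> x0 p0 c0 le_c i; rewrite leNgt; apply/negP => lt_x.
have x1 : 1 <= x ord0 i by lra.
have := ler_eXnr p0 x1; have : x ord0 i ^+ p <= power_sum n (ext x) p.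
  rewrite power_sum_ext (bigD1 i) //= lerDl sumr_ge0 // => k _; exact: exprn_ge0.
by lra.
Qed.

(* Minimizing one more power sum on the fiber leads to the boundary of the
   moment set of the enlarged exponent set. *)
Lemma dom_equiv_cone x : psi_dom x -> exists nu y,
  [/\ #|nu| = m, (Rcone nu `\ (0 : 'rV[R]_n)) y & psiA a y = psiA a x].
Proof.
move=> dx; have [x0 _] := (psi_domP x).1 dx.
suff [nu [y [card_nu Cy eq_y]]] : exists nu y, [/\ #|nu| = m, Rcone nu y &
    forall p, p \in exponents -> power_sum n (ext y) p = power_sum n (ext x) p].
  exists nu, y; split=> //; last exact: psi_eq_exponents.
  by split=> //; have [] := dom_of_power_sums dx (Rcone_nonneg Cy) eq_y.
move: le_mn; rewrite leq_eqVlt => /predU1P[eq_mn|lt_mn].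
  (* For [m = n] the cone of the full set consists of all decreasing nonnegative vectors, and
     sorting suffices. *)
  have [f [f0 fd fn f_ps _]] := sort_vector x0.
  exists [set: 'I_n]%SET, (\row_(i < n) f i); split.
  - by rewrite cardsT card_ord.
  - apply/Rcone_block; apply: (@block_cone_eq _ _ xpredT _ f) => [i lt_in|i|].
    + by rewrite (mem_nat_ord _ (Ordinal lt_in)) finset.in_setT.
    + by rewrite ext_row.
    + by split.
  by move=> p _; rewrite -f_ps; apply: eq_bigr => i _; rewrite ext_row.
have [a1 [e defE]] := exponents_cons.
have a1E : a1 \in exponents by rewrite defE mem_head.
have a1_gt0 : (0 < a1)%N by have [j ->] := exponentsP a1E.
pose c := power_sum n (ext x) a1; have c0 : 0 <= c by exact/power_sum_ge0/ext_ge0.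
(* The additional exponent exceeds all others; the fiber [K] is bounded because the first power sum
   bounds the coordinates. *)
pose b := (\max_(p <- a1 :: e) p).+1.
have b_gt p : p \in a1 :: e -> (p < b)%N by move=> pE; rewrite ltnS leq_bigmax_seq.
pose K := @box R n (1 + c) `&` [set y | forall p, p \in exponents -> power_sum n (ext y) p = power_sum n (ext x) p].
have K_compact : compact K.
  apply: compact_closedI; first exact: box_compact.
  rewrite (_ : [set y | _] = \bigcap_(p in [set p | p \in exponents])
     ((fun y => power_sum n (ext y) p) @^-1` [set power_sum n (ext x) p])) //.
  apply: closed_bigI => p _; apply: preimage_closed; last exact: closed_eq.
  by move=> y _; exact: continuous_power_sum.
have Kx : K x.
  by split=> // i; rewrite x0; apply: coord_le_power_sum a1_gt0 _ _ _ => //; rewrite /c.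
have [y /set_mem[By eq_y] min_y] := EVT_min_rV (ex_intro _ _ Kx) K_compact
  (continuous_subspaceT (@continuous_power_sum R n b)).
have y0 : nonneg_orthant y by move=> i; have /andP[] := By i.
have size_e : size e = m.-1 by move: size_exponents; rewrite defE => <-.
have [|||mu [p [y' [gmu card_mu Cy' eq_y']]]] := @gale_boundary R n a1 (rcons e b) y _ a1_gt0 _ y0.
- move: sorted_exponents; rewrite defE /= rcons_path => ->; exact: b_gt (mem_last _ _).
- by rewrite size_rcons size_e prednK.
(* Lowering only the last moment of the minimizer by [s] leaves the moment set, and s^2 < [d]
   because [s] is less than 1 and [d]. *)
- move=> d d0; pose s := Num.min 1 d / 2.
  have min0 : 0 < Num.min 1 d by rewrite lt_min ltr01.
  have s0 : 0 < s by rewrite divr_gt0.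
  have : s < Num.min 1 d by rewrite ltr_pdivrMr // ltr_pMr // ltr1n.
  rewrite lt_min => /andP[s1 sd].
  exists (fun p => power_sum n (ext y) p - (p == b)%:R * s).
    rewrite -cats1 -cat_cons /sq_dist big_cat /= big_seq1 eqxx big_seq big1 ?add0r.
      by rewrite mul1r opprB addrC subrK expr2; nra.
    by move=> q /b_gt lt_q; rewrite (ltn_eqF lt_q) mul0r subr0 subrr expr0n.
  move=> [z z0 z_eq].
  have eq_z q : q \in exponents -> power_sum n (ext z) q = power_sum n (ext x) q.
    rewrite defE => qE; rewrite z_eq; last by rewrite -cats1 -cat_cons mem_cat qE.
    by rewrite (ltn_eqF (b_gt _ qE)) mul0r subr0 eq_y // defE.
  have Kz : K z.
    split=> // i; rewrite z0; apply: coord_le_power_sum a1_gt0 _ _ _ => //.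
    by rewrite eq_z.
  have := min_y z; rewrite inE => /(_ Kz); rewrite z_eq; last by rewrite -cats1 -cat_cons mem_cat mem_head orbT.
  by rewrite eqxx mul1r; lra.
exists mu, y'; split=> //; first by rewrite card_mu size_rcons size_e prednK.
by move=> q qE; rewrite eq_y' ?eq_y //; move: qE; rewrite defE -cats1 -cat_cons mem_cat => ->.
Qed.

Lemma image_union : psiA a @` (@psi_dom R n)
  = \bigcup_(nu in [set nu : {set 'I_n} | #|nu| = m]) (@Bset R m n a nu).
Proof.
apply/seteqP; split=> [_ [x dx <-]|_ [nu _ [x Cx <-]]].
  by have [nu [y [card_nu Cy <-]]] := dom_equiv_cone dx; exists nu => //; exists y.
by exists x => //; exact: Rcone_dom Cx.
Qed.

Lemma simplex_image nu (V : 'I_#|nu| -> 'rV[R]_n) : cross_section (Rcone nu) V ->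
  psiA a @` simplex_of V = Bset a nu.
Proof.
move=> [_ [V_cone V_ray]]; apply/seteqP; split=> [_ [x Vx <-]|_ [x [Cx nx] <-]].
  by exists x => //; exact: V_cone.
have /eqP nx' : x <> 0 by [].
have [t [y [t0 [Vy [x_eq _]]]]] := V_ray x Cx nx'.
by exists y => //; rewrite x_eq psi_scale //; exact: Rcone_dom (V_cone _ Vy).
Qed.

Lemma simplex_compact (k : nat) (V : 'I_k -> 'rV[R]_n) : compact (simplex_of V).
Proof.
pose f (c : 'rV[R]_k) := \sum_i c ord0 i *: V i.
have f_cont : continuous f.
  move=> c; rewrite (_ : f = fun c => \row_(j < n) \sum_i c ord0 i * V i ord0 j).
    apply: continuous_row => j; apply: continuous_sum => i.
    by apply: continuousM; [exact: coord_continuous | exact: cst_continuous].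
  apply: funext => d; apply/rowP => j; rewrite !mxE summxE.
  by apply: eq_bigr => i _; rewrite mxE.
rewrite (_ : simplex_of V = f @` (@box R k 1 `&` (fun c : 'rV[R]_k => \sum_i c ord0 i) @^-1` [set 1])).
  apply: continuous_compact; first exact: continuous_subspaceT.
  apply: compact_closedI; first exact: box_compact.
  apply: preimage_closed; last exact: closed_eq.
  by move=> c _; apply: continuous_sum => i; exact: coord_continuous.
apply/seteqP; split=> [_ [c [c0 [_ [c1 ->]]]]|_ [c [Bc c1] <-]].
  exists (\row_i c i); last by apply: eq_bigr => i _; rewrite mxE.
  split; last by rewrite /=; under eq_bigr do rewrite mxE.
  move=> i; rewrite mxE c0 -c1 (bigD1 i) //= lerDl sumr_ge0 //.
by exists (fun i => c ord0 i); split=> // i; have /andP[] := Bc i.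
Qed.

(** Points with equal images have equal moments after scaling, so [block_cone_inj] puts them on one
    ray, which meets the simplex once. Compactness makes the inverse continuous. *)
Lemma simplex_homeomorphic nu (V : 'I_#|nu| -> 'rV[R]_n) : (#|nu| <= m)%N ->
  cross_section (Rcone nu) V -> homeomorphic_on (psiA a) (simplex_of V).
Proof.
move=> le_nu [_ [V_cone V_ray]].
have V_dom x : simplex_of V x -> psi_dom x by move=> /V_cone; exact: Rcone_dom.
have psi_cont : {within simplex_of V, continuous (@psiA R m n a)}.
  apply: continuous_in_subspaceT => x /set_mem Vx.
  by apply: continuous_psi => //; exact: V_dom.
split=> //.
have psi_inj x y : simplex_of V x -> simplex_of V y -> psiA a x = psiA a y -> x = y.
  move=> Vx Vy eq_xy.
  have [t t0 eq_ps] := psi_inj_scale m_gt0 a_gt0 (V_dom x Vx) (V_dom y Vy) eq_xy.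
  have [[Cx /eqP nx] [Cy /eqP ny]] := (V_cone _ Vx, V_cone _ Vy).
  have x_eq : x = t *: y.
    apply/rowP => i; rewrite -!ext_ord.
    have Cty : block_cone n (mem_nat nu) (ext (t *: y)).
      have /Rcone_block[c1 c2 c3 c4] := Cy.
      split=> [j|j k le_jk|j le_nj|j lt_jn jnu]; rewrite !ext_scale.
      - by rewrite mulr_ge0 // ltW.
      - by rewrite ler_wpM2l ?(ltW t0) // c2.
      - by rewrite c3 ?mulr0.
      - by rewrite c4.
    apply: (block_cone_inj ((Rcone_block nu x).1 Cx) Cty uniq_exponents exponents_n0) => //.
      by rewrite rank_mem_nat size_exponents.
    by move=> p /exponentsP[j ->]; rewrite eq_ps.
  have [s [z [s0 [Vz [_ z_uniq]]]]] := V_ray x Cx nx.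
  have [_ ->] := z_uniq 1 x ltr01 Vx (esym (scale1r x)).
  by have [_ ->] := z_uniq t y t0 Vy x_eq.
pose g u := get (fun x => simplex_of V x /\ psiA a x = u).
have gK x : simplex_of V x -> g (psiA a x) = x.
  move=> Vx; have [Vg psi_g] : simplex_of V (g (psiA a x)) /\ psiA a (g (psiA a x)) = psiA a x.
    exact: (@getPex _ (fun y => simplex_of V y /\ psiA a y = psiA a x) (ex_intro _ x (conj Vx erefl))).
  exact: psi_inj.
exists g; split=> //; apply: compact_inverse_continuous gK => //; last exact: simplex_compact.
Qed.

(** The barycentric coordinate of the vertex [V (tau k)] is a positive multiple of the gap at
    [elt k]; the opposite facet is where this gap vanishes. *)
Lemma facet_image nu (V : 'I_#|nu| -> 'rV[R]_n) (tau : 'I_#|nu| -> 'I_#|nu|) :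
    cross_section (Rcone nu) V ->
    bijective tau ->
    (forall k, exists2 al : R, 0 < al & V (tau k) = al *: gen_vector R k) ->
  forall k, psiA a @` facet_of V (tau k) = Bset a (nu :\ elt k)%SET.
Proof.
move=> [_ [V_cone V_ray]] tau_bij V_tau k.
have gap_V (lam : 'I_#|nu| -> R) : exists2 al : R, 0 < al &
    gap (\sum_i lam i *: V i) (elt k) = lam (tau k) * al.
  have [al al0 Vk] := V_tau k; exists al => //; rewrite gap_sum (bigD1 (tau k)) //=.
  rewrite Vk gap_scale gap_gen eqxx mulr1 big1 ?addr0 // => i nik.
  have [tau' tauK tau'K] := tau_bij; have [al' _] := V_tau (tau' i).
  rewrite tau'K => ->; rewrite gap_scale gap_gen eq_elt eq_sym (can2_eq tau'K tauK) (negPf nik).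
  by rewrite !mulr0.
apply/seteqP; split=> [_ [x Fx <-]|_ [x [Cx nx] <-]].
  have [Cx nx] := V_cone x (conv_simplex Fx); exists x => //; split=> //.
  apply: Rcone_gap0 => //; case: Fx => lam [_ [lam0 [_ ->]]].
  by have [al _ ->] := gap_V lam; rewrite lam0 ?mul0r // negbK.
have /eqP nx' : x <> 0 by [].
have Cx' := RconeS (subD1set nu (elt k)) Cx.
have [t [y [t0 [Vy [x_eq _]]]]] := V_ray x Cx' nx'.
exists y; last by rewrite x_eq psi_scale //; exact: Rcone_dom (V_cone _ Vy).
case: Vy => lam [lam0 [_ [lam1 y_eq]]]; exists lam; split=> //; split=> // i.
rewrite negbK => /eqP ->; have [al al0 gap_y] := gap_V lam.
have gap_x : gap x (elt k) = 0 by apply: gap_Rcone_notin Cx _; rewrite !inE eqxx.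
have /eqP : t * (lam (tau k) * al) = 0 by rewrite -gap_y -y_eq -gap_scale -x_eq.
by rewrite !mulf_eq0 (gt_eqF t0) (gt_eqF al0) orbF => /eqP.
Qed.

Lemma facet_sets nu (V : 'I_#|nu| -> 'rV[R]_n) : #|nu| = m -> cross_section (Rcone nu) V ->
  [set psiA a @` facet_of V j | j in [set: 'I_#|nu|]]
  = [set (@Bset R m n a mu) | mu in [set mu : {set 'I_n} | #|mu| = m.-1 /\ mu \subset nu]].
Proof.
move=> card_nu csV; have [tau [tau_bij V_tau]] := cross_section_vertices csV.
have facetE := facet_image csV tau_bij V_tau.
apply/seteqP; split=> [_ [j _ <-]|_ [mu [card_mu sub_mu] <-]].
  have [tau' _ tau'K] := tau_bij; rewrite -(tau'K j) facetE.
  exists (nu :\ elt (tau' j))%SET => //; split; last exact: subD1set.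
  by rewrite -card_nu (cardsD1 (elt (tau' j)) nu) elt_in.
have : #|nu :\: mu| = 1%N.
  by rewrite cardsD (finset.setIidPr sub_mu) card_nu card_mu -subn1 subKn.
move=> /eqP/cards1P[i eq_i].
have inu : i \in nu.
  have : i \in nu :\: mu by rewrite eq_i finset.in_set1.
  by rewrite finset.in_setD => /andP[].
pose k : 'I_#|nu| := enum_rank_in inu i.
have elt_k : elt k = i by rewrite /elt enum_rankK_in.
exists (tau k) => //; rewrite facetE elt_k -eq_i finset.setDDr finset.setDv finset.set0U.
by rewrite (finset.setIidPr sub_mu).
Qed.

(** By scaling, the image is already that of the compact standard simplex. *)
Lemma image_closed : closed (psiA a @` (@psi_dom R n)).
Proof.
pose D : set 'rV[R]_n := @box R n 1 `&` (fun x : 'rV[R]_n => \sum_i x ord0 i) @^-1` [set 1].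
have D_dom x : D x -> psi_dom x.
  move=> [Bx sx]; apply/psi_domP; split; first by move=> i; have /andP[] := Bx i.
  apply/eqP => x_eq0; move: sx; rewrite /= x_eq0 big1 => [/eqP|i _]; last by rewrite mxE.
  by rewrite eq_sym oner_eq0.
have D_compact : compact D.
  apply: compact_closedI; first exact: box_compact.
  apply: preimage_closed; last exact: closed_eq.
  by move=> c _; apply: continuous_sum => i; exact: coord_continuous.
have -> : psiA a @` (@psi_dom R n) = psiA a @` D.
  apply/seteqP; split=> [_ [x dx <-]|_ [x /D_dom dx <-]]; last by exists x.
  have [x0 nx] := (psi_domP x).1 dx.
  have s0 : 0 < power_sum n (ext x) 1 by exact: power_sum_gt0.
  have sE : \sum_i x ord0 i = power_sum n (ext x) 1 by rewrite power_sum_ext.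
  exists ((power_sum n (ext x) 1)^-1 *: x); last by rewrite psi_scale // invr_gt0.
  split.
    move=> i; rewrite mxE mulrC divr_ge0 ?x0 ?(ltW s0) //= ler_pdivrMr // mul1r -sE.
    by rewrite (bigD1 i) //= lerDl sumr_ge0.
  rewrite /=; under eq_bigr do rewrite mxE.
  by rewrite -mulr_sumr sE mulVf // gt_eqF.
apply: compact_closed; first exact: norm_hausdorff.
apply: continuous_compact D_compact; apply: continuous_in_subspaceT => x /set_mem Dx.
by apply: continuous_psi => //; exact: D_dom.
Qed.

(** * The boundary of the image *)

Definition gale_sets : set {set 'I_n} :=
  [set mu : {set 'I_n} | #|mu| = m.-1 /\ exists p, gale n (mem_nat mu) p].

(** Near such a point there are points v of the hyperplane outside the image with positive
    coordinates. No nonnegative vector has the norms v_j, so the moments of a preimage are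
    approached by unattained ones and [gale_boundary] applies. *)
Lemma boundary_gale u : (psiA a @` (@psi_dom R n)) u ->
    ~ rel_interior_H (psiA a @` (@psi_dom R n)) u ->
  (\bigcup_(mu in gale_sets) (@Bset R m n a mu)) u.
Proof.
move=> Su nint; have [x dx eq_u] := Su.
have [t [t0 psi_t]] := psi_normalize m_gt0 a_gt0 dx.
have dtx := psi_dom_scale t0 dx; have [x0 _] := (psi_domP _).1 dtx.
have u_gt0 j : 0 < u ord0 j.
  by rewrite -eq_u psi_row divr_gt0 ?pnorm_gt0 ?pnorm_sum_gt0.
have ps_x j : power_sum n (ext (t *: x)) (a j) = u ord0 j ^+ a j.
  by have := psi_t 1 j ler01; rewrite !mul1r eq_u.
have [a1 [e defE]] := exponents_cons.
have a1_gt0 : (0 < a1)%N by have [|j ->] := @exponentsP a1; rewrite ?defE ?mem_head.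
have size_e : size e = m.-1 by move: size_exponents; rewrite defE => <-.
have lt_en : (size e < n)%N by rewrite size_e prednK.
have sE : sorted ltn (a1 :: e) by rewrite -defE; exact: sorted_exponents.
(* Moments that a vector with norms [v] would have, indexed by exponents instead of positions. *)
pose z (v : 'rV[R]_m) p := \sum_(j < m) if a j == p then v ord0 j ^+ p else 0.
have zE v j : z v (a j) = v ord0 j ^+ a j.
  rewrite /z (bigD1 j) //= eqxx big1 ?addr0 // => i nij.
  by rewrite (inj_eq inj_exponents) (negPf nij).
have z_cont : continuous (fun v : 'rV[R]_m => sq_dist n (a1 :: e) (z v) (ext (t *: x))).
  move=> v; apply: (@continuous_sum _ _ _ _ (fun p (v : 'rV[R]_m) =>
    (power_sum n (ext (t *: x)) p - z v p) ^+ 2)) => p.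
  apply: (@continuous_comp _ _ _ (fun v : 'rV[R]_m => power_sum n (ext (t *: x)) p - z v p) (fun c : R => c ^+ 2)).
    apply: (@continuousB _ _ _ (fun=> power_sum n (ext (t *: x)) p) (fun v => z v p)).
      exact: cst_continuous.
    apply: continuous_sum => j; case: (a j == p); last exact: cst_continuous.
    apply: (@continuous_comp _ _ _ (fun v : 'rV[R]_m => v ord0 j) (fun c : R => c ^+ p)).
      exact: coord_continuous.
    exact: exprn_continuous.
  exact: exprn_continuous.
have [d d0|mu [p [y [gmu card_mu Cy eq_y]]]] := @gale_boundary R n a1 e (t *: x) sE a1_gt0 lt_en x0; last first.
  exists mu; first by split; [rewrite card_mu | exists p].
  have eq_y' q : q \in exponents -> power_sum n (ext y) q = power_sum n (ext (t *: x)) q.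
    by rewrite defE; exact: eq_y.
  exists y; last by rewrite (psi_eq_exponents eq_y') psi_scale.
  by split=> //; have [] := dom_of_power_sums dtx (Rcone_nonneg Cy) eq_y'.
have near_u : \forall v \near u, sq_dist n (a1 :: e) (z v) (ext (t *: x)) < d /\ forall j, 0 < v ord0 j.
  near=> v; split; near: v.
    have : sq_dist n (a1 :: e) (z u) (ext (t *: x)) < d.
      rewrite /sq_dist big_seq big1 // => q; rewrite -defE => /exponentsP[j ->].
      by rewrite zE ps_x subrr expr0n.
    move=> lt_u; have := z_cont u; move/(@cvgr_lt _ _ _ _ _ _)/(_ _ lt_u); exact.
  apply: filter_forall => j.
  by have := @coord_continuous R 1 m ord0 j u; move/(@cvgr_gt _ _ _ _ _ _)/(_ _ (u_gt0 j)); exact.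
have /nbhs_ballP[r /= r0 ball_u] := near_u.
have [v [v1 ball_v nSv]] : exists v, [/\ sum_one_hyperplane v, ball u r v & ~ (psiA a @` (@psi_dom R n)) v].
  apply: contrapT => no_v; apply: nint; split=> //; exists r; split=> // v v1 bv.
  by apply: contrapT => nSv; apply: no_v; exists v.
have [lt_d v0] := ball_u v ball_v.
exists (z v) => // -[y y0 y_eq]; apply: nSv.
have eq_v : psiA a y = v.
  apply: psi_of_norms => // j; first exact: ltW.
  by rewrite -zE y_eq // -defE mem_exponents.
exists y => //; apply/psi_domP; split=> //; apply/eqP => y_eq0.
pose j0 := Ordinal m_gt0; have := v0 j0; have := y_eq (a j0); rewrite zE -defE => /(_ (mem_exponents _)).
rewrite y_eq0 power_sum_ext big1 => [vj0|i _]; last by rewrite mxE expr0n gtn_eqF.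
by rewrite -(@pmulr_rgt0 _ (v ord0 j0 ^+ (a j0).-1)) ?exprn_gt0 // -exprSr prednK // -vj0 ltxx.
Unshelve. all: by end_near. Qed.

(** Changing the last norm in the direction forbidden by [gale_extremal] and renormalizing gives
    points of the hyperplane arbitrarily near [u]; a preimage of one would contradict
    extremality. *)
Lemma gale_not_interior mu u : gale_sets mu -> Bset a mu u ->
  ~ rel_interior_H (psiA a @` (@psi_dom R n)) u.
Proof.
move=> [card_mu [p gmu]] [x Cx0 eq_u] [_ [r [r0 ball_S]]].
have dx := Rcone_dom Cx0; have [Cx _] := Cx0.
have [t [t0 psi_t]] := psi_normalize m_gt0 a_gt0 dx.
have u_gt0 j : 0 < u ord0 j.
  by rewrite -eq_u psi_row divr_gt0 ?pnorm_gt0 ?pnorm_sum_gt0.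
have sum_u : \sum_j u ord0 j = 1 by rewrite -eq_u; exact: psi_sum1.
have lt_last : (m.-1 < m)%N by rewrite prednK.
pose l := Ordinal lt_last; pose ul := u ord0 l.
have ul0 : 0 < ul by exact: u_gt0.
pose s : R := - (-1) ^+ p; have s2 : s * s = 1.
  by rewrite /s mulrNN -expr2 sqrr_sign.
have s_bound : -1 <= s <= 1 by rewrite /s; case: (p); rewrite ?(expr0, expr1); apply/andP; split; lra.
(* The bound 1/2 keeps the normalizing factor [q] at least 1/2, [r / 4] then keeps [v] in the ball,
   and [ul / 2] keeps the last coordinate positive. *)
pose d := Num.min (1 / 2) (Num.min (r / 4) (ul / 2)).
have d0 : 0 < d by rewrite !lt_min; apply/and3P; split; lra.
have [d_half d_r d_ul] : [/\ d <= 1 / 2, d <= r / 4 & d <= ul / 2].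
  by rewrite /d !ge_min !lexx ?orbT.
have ds_bound : - d <= d * s <= d by case/andP: s_bound => *; apply/andP; split; nra.
pose q := 1 + d * s; have q_half : 1 / 2 <= q by rewrite /q; case/andP: ds_bound; lra.
have q0 : 0 < q by lra.
pose w j := u ord0 j + (j == l)%:R * (d * s).
have w_gt0 j : 0 < w j.
  rewrite /w; case: eqP => [->|_]; last by rewrite mul0r addr0.
  by rewrite mul1r -/ul; case/andP: ds_bound; lra.
have sum_w : \sum_j w j = q.
  rewrite /w big_split /= sum_u (bigD1 l) //= eqxx mul1r big1 ?addr0 // => j /negPf->.
  by rewrite mul0r.
pose v : 'rV[R]_m := \row_j (w j / q).
have v1 : sum_one_hyperplane v.
  rewrite /sum_one_hyperplane /=; under eq_bigr do rewrite mxE.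
  by rewrite -mulr_suml sum_w divff // gt_eqF.
have ball_v : ball u r v.
  split=> // i j; rewrite ord1 /ball /= mxE.
  have le_u1 : u ord0 j <= 1 by rewrite -sum_u (bigD1 j) //= lerDl sumr_ge0 // => k _; rewrite ltW.
  have -> : u ord0 j - w j / q = (u ord0 j - (j == l)%:R) * (d * s) / q.
    by rewrite /w /q; field; rewrite -/q gt_eqF.
  rewrite normrM normfV (gtr0_norm q0) ltr_pdivrMr // normrM.
  have le1 : `|u ord0 j - (j == l)%:R| <= 1.
    by rewrite ler_norml; have := u_gt0 j; case: (j == l) => /=; lra.
  have le2 : `|d * s| <= d by rewrite ler_norml.
  have : `|u ord0 j - (j == l)%:R| * `|d * s| <= 1 * d by apply: ler_pM.
  by nra.
have [y dy psi_y] := ball_S v v1 ball_v.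
have [t' [t'0 psi_t']] := psi_normalize m_gt0 a_gt0 dy.
have qt0 : 0 < q * t' by rewrite mulr_gt0.
have [y0 _] := (psi_domP _).1 (psi_dom_scale qt0 dy).
have [f [f0 fd fn f_ps _]] := sort_vector y0.
have ps_f j : power_sum n f (a j) = w j ^+ a j.
  by rewrite f_ps psi_t' ?(ltW q0) // psi_y mxE mulrC divfK // gt_eqF.
have ps_x j : power_sum n (ext (t *: x)) (a j) = u ord0 j ^+ a j.
  by have := psi_t 1 j ler01; rewrite !mul1r eq_u.
have Ctx : block_cone n (mem_nat mu) (ext (t *: x)).
  have /Rcone_block[c1 c2 c3 c4] := Cx.
  split=> [j|j k le_jk|j le_nj|j lt_jn jnu]; rewrite !ext_scale.
  - by rewrite mulr_ge0 // ltW.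
  - by rewrite ler_wpM2l ?(ltW t0) // c2.
  - by rewrite c3 ?mulr0.
  - by rewrite c4.
have exp_eq : exponents = rcons (take m.-1 exponents) (a l).
  have -> : a l = nth 0%N exponents m.-1.
    by rewrite (nth_map l) ?size_enum_ord // -[m.-1]/(val l) nth_ord_enum.
  by rewrite -take_nth ?size_exponents // prednK // take_oversize // size_exponents.
have uniq_E := uniq_exponents; rewrite exp_eq rcons_uniq in uniq_E.
have := @gale_extremal R n (mem_nat mu) p (ext (t *: x)) f (take m.-1 exponents) (a l) gmu Ctx f0 fd.
rewrite -exp_eq sorted_exponents exponents_n0 => /(_ isT isT).
rewrite size_takel ?size_exponents ?leq_pred // rank_mem_nat => /(_ card_mu).
have eq_ps b : b \in take m.-1 exponents -> power_sum n (ext (t *: x)) b = power_sum n f b.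
  move=> be; have [j bj] := exponentsP (mem_take be).
  have njl : j != l.
    by apply: contraTneq be => jl; rewrite bj jl; case/andP: uniq_E.
  by rewrite bj ps_x ps_f /w (negPf njl) mul0r addr0.
move=> /(_ eq_ps); rewrite ps_x ps_f /w eqxx mul1r -/ul.
have lt_pow (b c : R) : 0 < b -> b < c -> b ^+ a l < c ^+ a l.
  by move=> b0 bc; rewrite ltr_pXn2r ?nnegrE ?(ltW b0) // ltW // (lt_trans b0).
have ds_gt : 0 < ul + d * s by case/andP: ds_bound; lra.
rewrite /s in ds_gt *; case: (p) ds_gt; rewrite ?(expr0, expr1) ?opprK ?mulr1 => ds_gt.
  by rewrite mulN1r oppr_ge0 subr_le0 leNgt lt_pow // ltrDl.
by rewrite mul1r subr_ge0 leNgt lt_pow // mulrN1 gtrDl oppr_lt0.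
Qed.

Lemma image_boundary :
  rel_boundary_H (psiA a @` (@psi_dom R n)) = \bigcup_(mu in gale_sets) (@Bset R m n a mu).
Proof.
apply/seteqP; split=> [u [clu nint]|u [mu gmu Bu]].
  by apply: boundary_gale => //; apply: image_closed.
split; last exact: gale_not_interior gmu Bu.
by apply: subset_closure; case: Bu => x Cx <-; exists x => //; exact: Rcone_dom Cx.
Qed.
End Image.

(** * An identity theorem *)

Section IdentityTheorem.
Variables (R : realType) (b : R) (S : {poly R}).
Hypothesis S_gt0 : forall t, 0 < t < b -> 0 < S.[t].
Implicit Types (g F : R -> R) (c P : {poly R}) (l : seq ({poly R} * (R -> R))).

(** Positive functions whose logarithmic derivative is a polynomial over the fixed denominator [S];
    real powers of positive factors of [S] are the intended examples. *)
Definition log_rational g := exists P, forall t, 0 < t < b ->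
  0 < g t /\ is_derive t 1 g (P.[t] / S.[t] * g t).

Lemma log_rational1 : log_rational (fun=> 1).
Proof.
exists 0 => t _; split; first exact: ltr01.
by rewrite horner0 !mul0r; exact: is_derive_cst.
Qed.

Lemma log_rationalS : log_rational (horner S).
Proof.
exists S^`() => t tb; have St := S_gt0 tb; split=> //.
by rewrite divfK ?gt_eqF //; exact: is_derive_poly.
Qed.

Lemma log_rationalM g h : log_rational g -> log_rational h -> log_rational (fun t => g t * h t).
Proof.
move=> [P gP] [Q hQ]; exists (P + Q) => t tb.
have [[g0 dg] [h0 dh]] := (gP t tb, hQ t tb); split; first exact: mulr_gt0.
refine (is_derive_eq (is_deriveM dg dh) _).
by rewrite hornerD /GRing.scale /=; ring.
Qed.

Lemma log_rationalV g : log_rational g -> log_rational (fun t => (g t)^-1).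
Proof.
move=> [P gP]; exists (- P) => t tb.
have [g0 dg] := gP t tb; split; first by rewrite invr_gt0.
have ng : g t != 0 by rewrite gt_eqF.
refine (is_derive_eq (is_deriveV ng dg) _).
rewrite hornerN /GRing.scale /= -exprVn; field.
by rewrite ng gt_eqF // S_gt0.
Qed.

Definition comb l t := \sum_(cg <- l) cg.1.[t] * cg.2 t.

Lemma comb_cons c g l t : comb ((c, g) :: l) t = c.[t] * g t + comb l t.
Proof. by rewrite /comb big_cons. Qed.

Fixpoint log_rational_all l : Prop :=
  if l is (c, g) :: l' then log_rational g /\ log_rational_all l' else True.

(** If h and g have logarithmic derivatives Q/S and P/S, then c h/g has derivative (c' S + c (Q -
    P)) h/(g S). The number of terms is unchanged. *)
Lemma comb_div_derive l g : log_rational_all l -> log_rational g ->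
  exists l2, [/\ size l2 = size l, log_rational_all l2 &
    forall t, 0 < t < b -> is_derive t 1 (fun t => comb l t / g t) (comb l2 t)].
Proof.
move=> + gP; elim: l => [_|[c h] l IHl [hP lP]].
  exists [::]; split=> // t tb; rewrite /comb big_nil.
  rewrite (_ : (fun t => _) = cst 0); first exact: is_derive_cst.
  by apply: funext => u; rewrite big_nil mul0r.
have [l2 [size_l2 l2P dl]] := IHl lP.
have [[P gPP] [Q hQ]] := (gP, hP).
exists ((c^`() * S + c * (Q - P), fun t => h t * (g t * S.[t])^-1) :: l2); split.
- by rewrite /= size_l2.
- split=> //; apply: log_rationalM => //; apply: log_rationalV; apply: log_rationalM => //.
  exact: log_rationalS.
move=> t tb; rewrite comb_cons.
have [[g0 dg] [h0 dh]] := (gPP t tb, hQ t tb); have St := S_gt0 tb.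
have ng : g t != 0 by rewrite gt_eqF.
rewrite (_ : (fun t => _) = (fun t => c.[t] * h t / g t + comb l t / g t)); last first.
  by apply: funext => u; rewrite comb_cons mulrDl.
refine (is_derive_eq (is_deriveD (is_deriveM (is_deriveM (is_derive_poly c t) dh) (is_deriveV ng dg)) (dl t tb)) _).
congr (_ + _); rewrite /GRing.scale /= -exprVn !fctE !(hornerD, hornerM, hornerN).
by field; rewrite ng gt_eqF.
Qed.

Lemma const0_of_derive0 (G G' : R -> R) (d : R) : 0 < d -> d <= b ->
  (forall t, 0 < t < d -> G t = 0) -> (forall t, 0 < t < b -> is_derive t 1 G (G' t)) ->
  (forall t, 0 < t < b -> G' t = 0) -> forall t, 0 < t < b -> G t = 0.
Proof.
move=> d0 le_db G0 dG dG0 t /andP[t0 tb].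
have [lt_td|le_dt] := ltP t d; first by apply: G0; rewrite t0.
have lt_t : d / 2 < t by lra.
have [||x] := @MVT R G G' (d / 2) t lt_t.
- by move=> x; rewrite in_itv /= => /andP[? ?]; apply: dG; lra.
- apply: derivable_within_continuous => x; rewrite in_itv /= => /andP[? ?].
  by apply: (@ex_derive _ _ _ _ _ _ (G' x)); apply: dG; lra.
rewrite in_itv /= => /andP[? ?]; rewrite dG0 ?mul0r; last by lra.
by move=> /eqP; rewrite subr_eq0 => /eqP ->; apply: G0; lra.
Qed.

Lemma derive0_of_locally0 (G G' : R -> R) (d : R) :
  (forall t, 0 < t < d -> G t = 0) -> (forall t, 0 < t < d -> is_derive t 1 G (G' t)) ->
  forall t, 0 < t < d -> G' t = 0.
Proof.
move=> G0 dG t td; have dGt := dG t td; rewrite -(@derive_val _ _ _ _ _ _ _ dGt).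
rewrite (@near_eq_derive _ _ _ G (cst 0) t 1) ?derive_cst //.
have /andP[t0 lt_td] := td.
near=> u; apply: G0; apply/andP; split; near: u.
  exact: lt_nbhsr.
exact: lt_nbhsl.
Unshelve. all: by end_near. Qed.

(* Divide by the last function and differentiate until its coefficient
   disappears. *)
Lemma comb_vanish (d : R) l : 0 < d -> d <= b -> log_rational_all l ->
  (forall t, 0 < t < d -> comb l t = 0) -> forall t, 0 < t < b -> comb l t = 0.
Proof.
move=> d0 le_db; have sub_db t : 0 < t < d -> 0 < t < b by move=> /andP[? ?]; lra.
have [K] := ubnP (size l); elim: K l => // K IHK [|[c g] l].
  by move=> _ _ _ t _; rewrite /comb big_nil.
(* Lexicographic induction on the number of terms and on the size of the first coefficient, which
   differentiation lowers. *)
have [k] := ubnP (size c); elim: k c g l => // k IHk c g l le_c; rewrite ltnS => lt_lK [gP lP] l0.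
have [c0|nzc] := eqVneq c 0.
  have l0' t : 0 < t < d -> comb l t = 0.
    by move=> td; have := l0 t td; rewrite comb_cons c0 horner0 mul0r add0r.
  move=> t tb; rewrite comb_cons c0 horner0 mul0r add0r.
  exact: (IHK l lt_lK lP l0').
have [l2 [size_l2 l2P dl]] := comb_div_derive lP gP.
pose G t := c.[t] + comb l t / g t.
have g0 t : 0 < t < b -> g t != 0.
  by case: gP => P gP tb; have [gt0 _] := gP t tb; rewrite gt_eqF.
have GE t : 0 < t < b -> comb ((c, g) :: l) t = G t * g t.
  by move=> tb; rewrite comb_cons mulrDl divfK // g0.
have dG t : 0 < t < b -> is_derive t 1 G (comb ((c^`(), fun=> 1) :: l2) t).
  move=> tb; rewrite comb_cons mulr1.
  exact: (is_deriveD (is_derive_poly c t) (dl t tb)).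
have G0 t : 0 < t < d -> G t = 0.
  move=> td; have /eqP := l0 t td; rewrite GE ?sub_db // mulf_eq0.
  by rewrite (negPf (g0 _ (sub_db _ td))) orbF => /eqP.
have dG0 t : 0 < t < d -> comb ((c^`(), fun=> 1) :: l2) t = 0.
  apply: (derive0_of_locally0 G0) => u ud; apply: dG; exact: sub_db.
have {}dG0 t : 0 < t < b -> comb ((c^`(), fun=> 1) :: l2) t = 0.
  have lt_c : (size c^`() < k)%N by rewrite -ltnS (leq_trans _ le_c) // ltnS lt_size_deriv.
  have lt_l2 : (size ((c^`(), (fun=> 1%R) : R -> R) :: l2) < K.+1)%N by rewrite /= ltnS size_l2.
  exact: (IHk _ _ _ lt_c lt_l2 (conj log_rational1 l2P) dG0).
by move=> t tb; rewrite GE // (const0_of_derive0 d0 le_db G0 dG dG0 tb) mul0r.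
Qed.

Definition log_span F := exists2 l, log_rational_all l & forall t, 0 < t < b -> F t = comb l t.

Lemma log_span_vanish (d : R) F : 0 < d -> d <= b -> log_span F ->
  (forall t, 0 < t < d -> F t = 0) -> forall t, 0 < t < b -> F t = 0.
Proof.
move=> d0 le_db [l lP Fl] F0 t tb; rewrite Fl //; apply: (comb_vanish d0 le_db lP) tb.
by move=> u /andP[u0 ud]; rewrite -Fl ?F0 ?u0 //= (lt_le_trans ud).
Qed.

Lemma log_span_gen g : log_rational g -> log_span g.
Proof.
move=> gP; exists [:: (1, g)] => // t _.
by rewrite comb_cons /comb big_nil hornerC mul1r addr0.
Qed.

Lemma log_span_const (k : R) : log_span (fun=> k).
Proof.
exists [:: (k%:P, fun=> 1)]; first by split=> //; exact: log_rational1.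
by move=> t _; rewrite comb_cons /comb big_nil hornerC mulr1 addr0.
Qed.

Lemma log_rational_all_cat l1 l2 : log_rational_all l1 -> log_rational_all l2 ->
  log_rational_all (l1 ++ l2).
Proof. by elim: l1 => //= -[c g] l IHl [gP lP] l2P; split=> //; exact: IHl. Qed.

Lemma comb_cat l1 l2 t : comb (l1 ++ l2) t = comb l1 t + comb l2 t.
Proof. by rewrite /comb big_cat. Qed.

Lemma log_spanD F G : log_span F -> log_span G -> log_span (fun t => F t + G t).
Proof.
move=> [l1 l1P Fl] [l2 l2P Gl]; exists (l1 ++ l2); first exact: log_rational_all_cat.
by move=> t tb; rewrite comb_cat Fl // Gl.
Qed.

Lemma log_spanM F G : log_span F -> log_span G -> log_span (fun t => F t * G t).
Proof.
move=> [l1 l1P Fl] [l2 l2P Gl].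
pose mul c g l := [seq (c * dh.1, fun t => g t * dh.2 t) | dh : {poly R} * (R -> R) <- l].
have mulP c g l : log_rational g -> log_rational_all l -> log_rational_all (mul c g l).
  move=> gP; elim: l => //= -[d h] l IHl [hP lP]; split; last exact: IHl.
  exact: log_rationalM.
have mulE c g l t : comb (mul c g l) t = c.[t] * g t * comb l t.
  rewrite /comb big_map mulr_sumr; apply: eq_bigr => -[d h] _ /=.
  by rewrite hornerM mulrACA.
suff [l lP lE] : exists2 l, log_rational_all l & forall t, comb l t = comb l1 t * comb l2 t.
  by exists l => // t tb; rewrite lE Fl // Gl.
elim: l1 l1P {Fl} => [_|[c g] l IHl [gP lP]].
  by exists [::] => // t; rewrite /comb !big_nil mul0r.
have [l' l'P l'E] := IHl lP; exists (mul c g l2 ++ l').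
  by apply: log_rational_all_cat => //; exact: mulP.
by move=> t; rewrite comb_cat mulE l'E comb_cons mulrDl.
Qed.

Lemma log_spanX F k : log_span F -> log_span (fun t => F t ^+ k).
Proof.
move=> FP; elim: k => [|k IHk]; first exact: log_span_const.
rewrite (_ : (fun t => _) = fun t => F t * F t ^+ k); first exact: log_spanM.
by apply: funext => t; rewrite exprS.
Qed.

Lemma log_span_sum (I : Type) (r : seq I) (F : I -> R -> R) :
  (forall i, log_span (F i)) -> log_span (fun t => \sum_(i <- r) F i t).
Proof.
move=> FP; elim: r => [|i r IHr].
  rewrite (_ : (fun t => _) = fun=> 0); first exact: log_span_const.
  by apply: funext => t; rewrite big_nil.
rewrite (_ : (fun t => _) = fun t => F i t + \sum_(i <- r) F i t); first exact: log_spanD.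
by apply: funext => t; rewrite big_cons.
Qed.

Lemma log_span_prod (I : Type) (r : seq I) (F : I -> R -> R) :
  (forall i, log_span (F i)) -> log_span (fun t => \prod_(i <- r) F i t).
Proof.
move=> FP; elim: r => [|i r IHr].
  rewrite (_ : (fun t => _) = fun=> 1); first exact: log_span_const.
  by apply: funext => t; rewrite big_nil.
rewrite (_ : (fun t => _) = fun t => F i t * \prod_(i <- r) F i t); first exact: log_spanM.
by apply: funext => t; rewrite big_cons.
Qed.

(** If S = Q s, the logarithmic derivative k s'/s of s^k equals k s' Q/S. *)
Lemma log_rational_root (s : {poly R}) k : (forall t, 0 < t < b -> 0 < s.[t]) -> s %| S ->
  log_rational (fun t => s.[t] `^ k).
Proof.
move=> s_gt0 /dvdpP[Q defS]; exists (k *: (s^`() * Q)) => t tb.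
have st := s_gt0 t tb; split; first exact: powR_gt0.
refine (is_derive_eq (is_derive1_comp (is_derive1_powR k st) (is_derive_poly s t)) _).
have St := S_gt0 tb; rewrite defS hornerM in St *.
have nQ : Q.[t] != 0 by apply: contraTneq St => ->; rewrite mul0r ltxx.
have pow_k : s.[t] `^ k = s.[t] `^ (k - 1) * s.[t].
  by rewrite -{3}(powRr1 (ltW st)) -powRD ?subrK // (gt_eqF st) implybT.
rewrite hornerZ hornerM pow_k; field.
by rewrite nQ gt_eqF.
Qed.
End IdentityTheorem.

(** * Types *)

Section Types.
Variable n : nat.
Implicit Types (mu nu : {set 'I_n}) (s : seq nat).

Lemma mem_elems1 mu e : (e \in elems1 mu) = (0 < e)%N && mem_nat mu e.-1.
Proof.
rewrite /elems1 mem_sort; apply/mapP/andP => [[i + ->]|[e0]].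
  by rewrite mem_enum mem_nat_ord.
rewrite /mem_nat; case: insubP => // i _ val_i imu.
by exists i; rewrite ?mem_enum // val_i prednK.
Qed.

Lemma size_elems1 mu : size (elems1 mu) = #|mu|.
Proof. by rewrite size_sort size_map cardE. Qed.

Lemma path_elems1 mu : path ltn 0%N (elems1 mu).
Proof.
rewrite path_sortedE; last exact: ltn_trans.
apply/andP; split; first by apply/allP => e; rewrite mem_elems1 => /andP[].
rewrite ltn_sorted_uniq_leq sort_uniq sort_sorted ?andbT; last exact: leq_total.
by rewrite map_inj_uniq ?enum_uniq // => i j /= [] /val_inj.
Qed.

Lemma elems1_le mu e : e \in elems1 mu -> (e <= n)%N.
Proof.
rewrite mem_elems1 /mem_nat => /andP[e0]; case: insubP => // i lt_i _ _.
by rewrite -(prednK e0).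
Qed.

Lemma last_elems1 mu : (last 0%N (elems1 mu) <= n)%N.
Proof.
by case defs: (elems1 mu) => [|e s] //=; apply: (@elems1_le mu); rewrite defs mem_last.
Qed.

(** Entries of [elems1] are shifted by one, so the members below [i] are the entries up to [i]. *)
Lemma rank_count mu i : rank (mem_nat mu) i = count (leq^~ i) (elems1 mu).
Proof.
have path_s := path_elems1 mu.
have uniq_s : uniq (elems1 mu).
  by apply: sorted_uniq (path_sorted path_s); [exact: ltn_trans | exact: ltnn].
elim: i => [|i IHi].
  rewrite /rank big_ord0; apply/esym/eqP; rewrite -leqn0 leqNgt -has_count.
  by apply/hasPn => e; rewrite mem_elems1 -ltnNge => /andP[].
rewrite rankS IHi; have -> : mem_nat mu i = (i.+1 \in elems1 mu) by rewrite mem_elems1.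
rewrite -count_uniq_mem //.
by elim: (elems1 mu) => //= e s <-; rewrite -[(e <= i)%N]ltnS; case: (ltngtP e i.+1) => _; lia.
Qed.

Lemma path_le_last x0 s e : path ltn x0 s -> e \in x0 :: s -> (e <= last x0 s)%N.
Proof.
elim: s x0 e => [|y s IHs] x0 e /=; first by rewrite inE => _ /eqP->.
move=> /andP[lt_xy path_s]; rewrite inE => /predU1P[->|]; last exact: IHs.
by apply: leq_trans (ltnW lt_xy) _; apply: IHs => //; rewrite mem_head.
Qed.

(** The count is constant on each block, so block lengths become multiplicities; the last term comes
    from the indices after the last block. *)
Lemma sum_blocks (V : zmodType) (F : nat -> V) x0 s : path ltn x0 s -> (last x0 s <= n)%N ->
  \sum_(x0 <= i < n) F (count (leq^~ i) s) =
  \sum_(k < size s) F k *+ nth 0%N (pairmap (fun a b => b - a)%N x0 s) k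
    + F (size s) *+ (n - last x0 s).
Proof.
elim: s F x0 => [|e s IHs] F x0 /=.
  by move=> _ _; rewrite big_ord0 add0r sumr_const_nat.
move=> /andP[lt_e path_s] le_last.
have le_en : (e <= n)%N.
  by apply: leq_trans le_last; apply: path_le_last; rewrite ?mem_head.
rewrite (big_cat_nat (n := e)) //=; last exact: ltnW.
rewrite big_ord_recl /= -addrA; congr (_ + _).
  rewrite -sumr_const_nat; apply: eq_big_nat => i /andP[_ lt_ie].
  rewrite leqNgt lt_ie add0n; congr F; apply/eqP; rewrite -leqn0 leqNgt -has_count.
  move: path_s; rewrite path_sortedE; last exact: ltn_trans.
  move=> /andP[/allP lt_s _]; apply/hasPn => u /lt_s lt_eu; rewrite -ltnNge.
  exact: ltn_trans lt_eu.
rewrite -(IHs (fun k => F k.+1)) //; apply: eq_big_nat => i /andP[le_ei _].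
by rewrite le_ei.
Qed.

Lemma size_block_lengths mu : size (block_lengths mu) = #|mu|.
Proof. by rewrite size_pairmap size_elems1. Qed.

Lemma block_lengths_gt0 x0 s : path ltn x0 s ->
  all (fun k => 0 < k)%N (pairmap (fun a b => b - a)%N x0 s).
Proof. by elim: s x0 => //= e s IHs x0 /andP[lt_e /IHs->]; rewrite subn_gt0 lt_e. Qed.

Lemma sumn_block_lengths x0 s : path ltn x0 s ->
  (sumn (pairmap (fun a b => b - a)%N x0 s) + x0 = last x0 s)%N.
Proof.
elim: s x0 => //= e s IHs x0 /andP[lt_e /IHs <-].
by rewrite addnAC subnK 1?ltnW // addnC.
Qed.

Lemma geq_total : total geq.
Proof. by move=> i j; rewrite /geq /= orbC leq_total. Qed.

Lemma nu_type_T_part mu : T_part n #|mu| (nu_type mu).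
Proof.
have perm_t : perm_eq (nu_type mu) (block_lengths mu) by rewrite perm_sort.
split; first by apply: sort_sorted; exact: geq_total.
split; first by rewrite size_sort size_block_lengths.
have bl_gt0 : all (fun k => 0 < k)%N (block_lengths mu) := block_lengths_gt0 (path_elems1 mu).
split; first by rewrite (perm_all _ perm_t).
rewrite (perm_sumn perm_t); apply/andP; split.
  rewrite -size_block_lengths; elim: (block_lengths mu) bl_gt0 => //= k s IHs /andP[k0 /IHs le_s].
  by rewrite -add1n leq_add.
have := sumn_block_lengths (path_elems1 mu); rewrite addn0 => ->.
exact: last_elems1.
Qed.

(** The partial sums of the partition are the elements of a set with these block lengths. *)
Lemma nu_type_surj l lam : T_part n l lam -> exists2 mu : {set 'I_n}, #|mu| = l & nu_type mu = lam.
Proof.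
move=> [sorted_lam [size_lam [lam_gt0 /andP[_ le_sum]]]].
pose s := scanl addn 0%N lam.
have pair_s : pairmap (fun a b => b - a)%N 0%N s = lam.
  by apply: scanlK => i j; rewrite addKn.
have path_scan x0 : path ltn x0 (scanl addn x0 lam).
  elim: lam x0 lam_gt0 {sorted_lam size_lam le_sum s pair_s} => //= k lam IHlam x0 /andP[k0 lam0].
  by rewrite IHlam // -[X in (X < _)%N]addn0 ltn_add2l k0.
have path_s : path ltn 0%N s := path_scan 0%N.
have le_s e : e \in s -> (0 < e <= n)%N.
  move=> es; move: (path_s); rewrite path_sortedE; last exact: ltn_trans.
  move=> /andP[/allP/(_ _ es) /= -> _] /=.
  apply: leq_trans le_sum; rewrite -pair_s; have := sumn_block_lengths path_s; rewrite addn0 => ->.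
  by apply: path_le_last; rewrite // inE es orbT.
pose mu := finset (fun i : 'I_n => i.+1 \in s).
have elems_mu : elems1 mu = s.
  apply: (irr_sorted_eq ltn_trans ltnn).
  - exact: path_sorted (path_elems1 mu).
  - exact: path_sorted path_s.
  move=> e; rewrite mem_elems1; case: e => [|e] /=.
    by apply/esym/negP => /le_s.
  have [lt_en|le_ne] := ltnP e n; first by rewrite (mem_nat_ord mu (Ordinal lt_en)) finset.in_set.
  rewrite /mem_nat insubF ?ltnNge ?le_ne //.
  by apply/esym/negP => /le_s /andP[_]; rewrite ltnNge le_ne.
have size_s : size s = l by rewrite /s size_scanl.
exists mu; first by rewrite -size_elems1 elems_mu.
rewrite /nu_type /block_lengths elems_mu pair_s; apply: sorted_sort => //.
by move=> i j k; rewrite /geq /= => le_ij le_ki; apply: leq_trans le_ki le_ij.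
Qed.

Lemma types_T_part l :
  [set nu_type mu | mu in [set mu : {set 'I_n} | #|mu| = l]] = T_part n l.
Proof.
apply/seteqP; split=> [_ [mu /= <- <-]|lam /nu_type_surj[mu card_mu type_mu]].
  exact: nu_type_T_part.
by exists mu.
Qed.
End Types.

(** * Zariski closures *)

Import (canonicals) mpoly.

Section Zariski.
Variables (R : realType) (m n : nat) (a : 'I_m -> nat).
Hypotheses (m_gt0 : (0 < m)%N) (a_gt0 : forall j, (0 < a j)%N).
Implicit Types (mu : {set 'I_n}) (x y z : 'rV[R]_n) (p : mpoly.mpoly m R).

(** Along the segment the power sums are polynomials in t. After clearing denominators, p composed
    with the map lies in the span covered by the identity theorem, which carries the vanishing from
    near [z] to [y] at t = 1. *)
Lemma psi_polynomial_segment p y z (d : R) : psi_dom y -> psi_dom z -> 0 < d ->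
    (forall t, 0 < t < d -> poly_eval p (psiA a (z + t *: (y - z))) = 0) ->
  poly_eval p (psiA a y) = 0.
Proof.
move=> dy dz d0 vanish; pose w t := z + t *: (y - z).
have [[y0 _] [z0 nz]] := ((psi_domP y).1 dy, (psi_domP z).1 dz).
pose s j : {poly R} := \sum_(i < n) ((z ord0 i)%:P + (y ord0 i - z ord0 i) *: 'X) ^+ a j.
have sE j t : (s j).[t] = power_sum n (ext (w t)) (a j).
  rewrite power_sum_ext horner_sum; apply: eq_bigr => i _.
  by rewrite horner_exp hornerD hornerC hornerZ hornerX !mxE mulrC.
have dw t : 0 < t <= 1 -> psi_dom (w t).
  move=> /andP[t0 t1]; have [->|nt1] := eqVneq t 1.
    by rewrite /w scale1r addrC subrK.
  have {nt1}t1 : t < 1 by rewrite lt_neqAle nt1.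
  have wE i : w t ord0 i = (1 - t) * z ord0 i + t * y ord0 i by rewrite !mxE; ring.
  have w0 i : (1 - t) * z ord0 i <= w t ord0 i by rewrite wE lerDl mulr_ge0 // ltW.
  have t1' : 0 < 1 - t by rewrite subr_gt0.
  apply/psi_domP; split.
    by move=> i; apply: le_trans (w0 i); rewrite mulr_ge0 // ltW.
  apply: contraNneq nz => w_eq0; apply/eqP/rowP => i; rewrite mxE; apply/le_anti.
  by rewrite z0 andbT -(pmulr_rle0 _ t1') (le_trans (w0 i)) // w_eq0 mxE.
have s1 j : 0 < (s j).[1] by rewrite sE; apply/power_sum_gt0/dw; rewrite ltr01 lexx.
have [||r r0 s_near] := @finite_pos_lower_bound R 'I_m xpredT
    (fun j r => forall t, `|t - 1| < r -> 0 < (s j).[t]).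
- by move=> j r r' s_r le_r t lt_t; apply: s_r; apply: lt_le_trans le_r.
- move=> j _; have [r r0 s_r] := poly_cont 1 (s j) (s1 j); exists r => // t /s_r.
  by rewrite ltr_norml => /andP[+ _]; rewrite ltrBrDl subrr.
(* The interval reaches slightly beyond 1, so that the endpoint [y] is an interior parameter; the
   power sums are still positive there. *)
pose b := 1 + r.
have s_gt0 j t : 0 < t < b -> 0 < (s j).[t].
  move=> /andP[t0 tb]; have [le_t1|lt_1t] := leP t 1; first by rewrite sE; apply/power_sum_gt0/dw; rewrite t0.
  by apply: s_near => //; rewrite gtr0_norm ?subr_gt0 // ltrBlDl.
pose S := \prod_j s j.
have S_gt0 t : 0 < t < b -> 0 < S.[t].
  by move=> tb; rewrite horner_prod prodr_gt0 // => j _; exact: s_gt0.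
pose N j t := (s j).[t] `^ (a j)%:R^-1.
have NP j : log_span b S (N j).
  apply/log_span_gen/log_rational_root => // [t|]; first exact: s_gt0.
  by rewrite /S (bigD1 j) //= dvdp_mulr.
have NE j t : N j t = pnorm (a j) (w t) by rewrite pnormE /N sE.
pose Sg t := \sum_j N j t.
have SgP : log_span b S Sg by exact: log_span_sum.
have Sg_gt0 t : 0 < t < b -> 0 < Sg t.
  move=> tb; rewrite /Sg (bigD1 (Ordinal m_gt0)) //= ltr_pwDl //.
    by rewrite /N powR_gt0 // s_gt0.
  by apply: sumr_ge0 => j _; exact: powR_ge0.
(* Multiplying by the power [D] of the sum of the norms clears the denominators of all monomials. *)
pose D := (\max_(mm <- mpoly.msupp p) mpoly.mdeg mm)%N.
pose F t := \sum_(mm <- mpoly.msupp p) mpoly.mcoeff mm p *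
  (\prod_j N j t ^+ mpoly.fun_of_multinom mm j * Sg t ^+ (D - mpoly.mdeg mm)%N).
have FP : log_span b S F.
  apply: log_span_sum => mm; apply: log_spanM; first exact: log_span_const.
  apply: log_spanM; last exact: log_spanX.
  by apply: log_span_prod => j; exact: log_spanX.
have FE t : 0 < t < b -> F t = Sg t ^+ D * poly_eval p (psiA a (w t)).
  move=> tb; rewrite /poly_eval mpoly.mevalE mulr_sumr /F.
  apply: eq_big_seq => mm mm_p.
  have le_mm : (mpoly.mdeg mm <= D)%N by rewrite /D leq_bigmax_seq.
  rewrite [RHS]mulrCA; congr (_ * _).
  have -> : \prod_i psiA a (w t) ord0 i ^+ mpoly.fun_of_multinom mm i =
      (\prod_j N j t ^+ mpoly.fun_of_multinom mm j) * (Sg t)^-1 ^+ mpoly.mdeg mm.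
    rewrite mpoly.mdegE -prodrXr -big_split; apply: eq_bigr => j _ /=.
    rewrite psi_row -NE -exprMn; congr ((_ / _) ^+ _).
    by apply: eq_bigr => k _; rewrite NE.
  rewrite [RHS]mulrCA; congr (_ * _); rewrite -{2}(subnK le_mm) exprD -mulrA exprVn.
  by rewrite divff ?mulr1 // expf_neq0 // gt_eqF // Sg_gt0.
have b1 : 0 < (1 : R) < b by rewrite ltr01 /b ltrDl.
have d'0 : 0 < Num.min d b by rewrite lt_min d0 /b addr_gt0.
have d'b : Num.min d b <= b by rewrite ge_min lexx orbT.
have F0 t : 0 < t < Num.min d b -> F t = 0.
  by rewrite lt_min => /and3P[t0 td tb]; rewrite FE ?t0 // vanish ?t0 // mulr0.
have := log_span_vanish S_gt0 d'0 d'b FP F0 b1; rewrite FE // => /eqP.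
rewrite mulf_eq0 expf_eq0 (gt_eqF (Sg_gt0 _ b1)) andbF /= => /eqP.
by rewrite /w scale1r addrC subrK.
Qed.

Lemma power_sum_blocks mu (X : nat -> R) (q : nat) : (0 < q)%N -> X #|mu| = 0 ->
  power_sum n (fun i => X (rank (mem_nat mu) i)) q =
  \sum_(0 <= k < #|mu|) X k ^+ q *+ nth 0%N (block_lengths mu) k.
Proof.
move=> q0 X0; rewrite /power_sum -(big_mkord xpredT (fun i => X (rank (mem_nat mu) i) ^+ q)).
under eq_bigr do rewrite rank_count.
rewrite (@sum_blocks n R (fun k => X k ^+ q) 0%N _ (path_elems1 mu) (last_elems1 mu)).
by rewrite size_elems1 X0 expr0n gtn_eqF // mul0rn addr0 big_mkord.
Qed.

(* Permuting the blocks of x according to the common type of mu and mu' *)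
Lemma same_type_block_vector mu mu' x : #|mu| = #|mu'| -> nu_type mu = nu_type mu' ->
    Rcone mu' x -> exists y, [/\ nonneg_orthant y,
      forall i, (i < n)%N -> ~~ mem_nat mu i -> ext y i = ext y i.+1 &
      forall q, (0 < q)%N -> power_sum n (ext y) q = power_sum n (ext x) q].
Proof.
move=> eq_card eq_type /Rcone_block Cx; have [x0 _ x_n _] := Cx.
set K := #|mu'| in eq_card; pose rk' := rank (mem_nat mu').
pose X k := if [pick i : 'I_n.+1 | rk' i == k] is Some i then ext x i else 0.
have X0 k : 0 <= X k by rewrite /X; case: pickP.
have XE i : (i <= n)%N -> X (rk' i) = ext x i.
  move=> le_in; rewrite /X; case: pickP => [j /eqP eq_r|/(_ (Ordinal (le_in : (i < n.+1)%N)))]; last by rewrite eqxx.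
  have le_jn : (j <= n)%N by rewrite -ltnS.
  have [le_ij|/ltnW le_ji] := leqP i j; last by apply: cone_eq Cx _ eq_r; rewrite le_ji.
  by apply/esym; apply: cone_eq Cx _ (esym eq_r); rewrite le_ij.
have XK : X K = 0 by rewrite /K -rank_mem_nat XE // x_n.
have perm_bl : perm_eq (block_lengths mu) (block_lengths mu').
  rewrite -(permPl (permEl (perm_sort geq (block_lengths mu)))) -/(nu_type mu) eq_type.
  by rewrite perm_sort.
have [Is perm_Is bl_eq] := (perm_iotaP 0%N perm_bl).
rewrite size_block_lengths -/K in perm_Is.
have size_Is : size Is = K by rewrite (perm_size perm_Is) size_iota.
(* Block [k] of mu receives the value from a block of mu' of the same length; the default [K] gives
   0 after the last block. *)
pose Y k := X (nth K Is k).
have YK : Y #|mu| = 0 by rewrite /Y nth_default ?XK // size_Is eq_card.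
pose y : 'rV[R]_n := \row_(i < n) Y (rank (mem_nat mu) i).
have extE i : (i <= n)%N -> ext y i = Y (rank (mem_nat mu) i).
  rewrite leq_eqVlt => /predU1P[->|lt_in]; first by rewrite ext_out // rank_mem_nat YK.
  by rewrite (ext_ord _ (Ordinal lt_in)) mxE.
exists y; split=> [i|i lt_in imu|q q0]; first by rewrite mxE X0.
  by rewrite !extE ?(ltnW lt_in) // rankS (negPf imu) addn0.
transitivity (power_sum n (fun i => Y (rank (mem_nat mu) i)) q).
  by apply: eq_bigr => i _; rewrite extE // ltnW.
transitivity (power_sum n (fun i => X (rk' i)) q); last first.
  by apply: eq_bigr => i _; rewrite XE // ltnW.
rewrite !power_sum_blocks // eq_card -/K bl_eq.
transitivity (\sum_(k <- Is) X k ^+ q *+ nth 0%N (block_lengths mu') k).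
  rewrite [RHS](big_nth K) size_Is; apply: eq_big_nat => k /andP[_ lt_k].
  by rewrite /Y (nth_map K) ?size_Is.
by rewrite (perm_big _ perm_Is) /index_iota subn0.
Qed.

(** The vector with permuted blocks lies in the span of the cone of mu. A segment towards it from
    the sum of the generators starts inside that cone, where the equation holds. *)
Lemma zariski_same_type mu mu' p : (0 < #|mu|)%N -> #|mu| = #|mu'| -> nu_type mu = nu_type mu' ->
    (forall u, Bset a mu u -> poly_eval p u = 0) ->
  forall u, Bset a mu' u -> poly_eval p u = 0.
Proof.
move=> mu_gt0 eq_card eq_type vanish _ [x Cx <-].
have dx := Rcone_dom Cx; have [Cx' _] := Cx.
have [y [y0 y_eq y_ps]] := same_type_block_vector eq_card eq_type Cx'.
have -> : psiA a x = psiA a y by apply: psi_eq => j; rewrite y_ps.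
have dy : psi_dom y.
  apply/psi_domP; split=> //; apply/eqP => y_eq0.
  have := power_sum_gt0 1 dx; rewrite -y_ps // y_eq0 power_sum_ext big1 ?ltxx // => i _.
  by rewrite mxE expr0n.
pose g (k : 'I_#|mu|) := gap y (elt k).
have y_comb : y = \sum_k g k *: gen_vector R k by exact: block_coords.
pose z : 'rV[R]_n := \sum_(k < #|mu|) 1 *: gen_vector R k.
have dz : psi_dom z.
  apply: (@Rcone_dom R n mu); split; first by apply: comb_cone => k; exact: ler01.
  move=> /= z_eq0; have := @gen_comb_inj R n mu (fun=> 1) (fun=> 0) _ (Ordinal mu_gt0).
  rewrite -/z z_eq0 big1 => [/(_ erefl)/eqP|k _]; last by rewrite scale0r.
  by rewrite oner_eq0.
(* [G] bounds every [1 - g k], so all coordinates on the segment stay positive for t < 1/[G]. *)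
pose G := 1 + \sum_k `|g k|.
have G0 : 0 < G by rewrite ltr_pwDl // sumr_ge0.
have d0 : 0 < Num.min 1 G^-1 by rewrite lt_min ltr01 invr_gt0.
apply: (psi_polynomial_segment dy dz d0) => t; rewrite lt_min => /and3P[t0 t1 tG].
apply: vanish; exists (z + t *: (y - z)) => //.
have wE : z + t *: (y - z) = \sum_k (1 + t * (g k - 1)) *: gen_vector R k.
  rewrite {1}y_comb /z -sumrB scaler_sumr -big_split; apply: eq_bigr => k _ /=.
  by rewrite -scalerBl scalerA -scalerDl.
have coef_gt0 k : 0 < 1 + t * (g k - 1).
  have tG1 : t * G < 1 by rewrite -ltr_pdivlMr // div1r.
  have le_g : 1 - g k <= G.
    rewrite /G lerD2l (le_trans _ (_ : `|g k| <= _)) //.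
      by rewrite -normrN ler_norm.
    by rewrite (bigD1 k) //= lerDl sumr_ge0.
  have : t * (1 - g k) <= t * G by rewrite ler_pM2l.
  by lra.
split; first by rewrite wE; apply: comb_cone => k; rewrite ltW.
rewrite /= wE => w_eq0.
have := @gen_comb_inj R n mu (fun k => 1 + t * (g k - 1)) (fun=> 0) _ (Ordinal mu_gt0).
rewrite w_eq0 big1 => [/(_ erefl) c0|k _]; last by rewrite scale0r.
by have := coef_gt0 (Ordinal mu_gt0); rewrite c0 ltxx.
Qed.

Lemma zariski_type mu mu' : #|mu| = #|mu'| -> nu_type mu = nu_type mu' ->
  zariski_closure_H (@Bset R m n a mu) = zariski_closure_H (@Bset R m n a mu').
Proof.
move=> eq_card eq_type; have [mu0|mu_gt0] := posnP #|mu|.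
  have /eqP mu_eq := mu0; move: mu_eq; rewrite cards_eq0 => /eqP->.
  have /eqP := mu0; rewrite eq_card cards_eq0 => /eqP->.
  by [].
have mu'_gt0 : (0 < #|mu'|)%N by rewrite -eq_card.
apply/seteqP; split=> u [u1 Zu]; split=> // p vanish; apply: Zu.
  exact: zariski_same_type vanish.
exact: zariski_same_type vanish.
Qed.
End Zariski.

Theorem theorem5p4 (R : realType) (m n : nat) (a : 'I_m -> nat)
  (hm0 : (0 < m)%N) (hmn : (m <= n)%N)
  (ha_pos : forall j, (0 < a j)%N)
  (ha_inc : forall i j : 'I_m, (i < j)%N -> (a i < a j)%N) :
  (* (i) im(psi_A) is the union of the B_nu, |nu| = m *)
  psiA a @` (@psi_dom R n)
    = \bigcup_(nu in [set nu : {set 'I_n} | #|nu| = m]) (@Bset R m n a nu)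
  (* (i) each B_nu, 1 <= |nu| = l <= m, is a curvy (l-1)-simplex *)
  /\ (forall nu : {set 'I_n}, (1 <= #|nu| <= m)%N ->
        (exists V : 'I_#|nu| -> 'rV[R]_n, cross_section ((@Rcone R n nu)) V) /\
        (forall V : 'I_#|nu| -> 'rV[R]_n, cross_section ((@Rcone R n nu)) V ->
           homeomorphic_on (psiA a) (simplex_of V) /\
           psiA a @` simplex_of V = (@Bset R m n a nu)))
  (* (i) curvy facets of B_nu, |nu| = m, are the B_mu, mu in binom(nu, m-1) *)
  /\ (forall nu : {set 'I_n}, #|nu| = m ->
        forall V : 'I_#|nu| -> 'rV[R]_n, cross_section ((@Rcone R n nu)) V ->
          [set psiA a @` facet_of V j | j in [set: 'I_#|nu|]]
          = [set (@Bset R m n a mu) | mu in [set mu : {set 'I_n} | #|mu| = m.-1 /\ mu \subset nu]])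
  (* (i) the boundary of im(psi_A) (in the hyperplane) is a union of some B_mu *)
  /\ (exists F : set {set 'I_n},
        F `<=` [set mu : {set 'I_n} | #|mu| = m.-1] /\
        rel_boundary_H (psiA a @` (@psi_dom R n)) = \bigcup_(mu in F) (@Bset R m n a mu))
  (* (ii) same type => same Zariski closure *)
  /\ (forall mu mu' : {set 'I_n}, #|mu| = m.-1 -> #|mu'| = m.-1 ->
        nu_type mu = nu_type mu' ->
        zariski_closure_H ((@Bset R m n a mu)) = zariski_closure_H ((@Bset R m n a mu')))
  (* (ii) the types of mu in binom([n], m-1) are exactly T_{n,m-1} *)
  /\ [set nu_type mu | mu in [set mu : {set 'I_n} | #|mu| = m.-1]] = T_part n m.-1.
Proof.
split; first exact: image_union.
split=> [nu /andP[nu_gt0 le_num]|].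
  split; first by exists (@gen_vector R n nu); exact: gen_cross_section.
  move=> V csV; split; first exact: simplex_homeomorphic.
  exact: simplex_image.
split; first by move=> nu card_nu V csV; exact: facet_sets.
split; first by exists (@gale_sets m n); split=> [mu []|]; last exact: image_boundary.
split=> [mu mu' card_mu card_mu'|]; last exact: types_T_part.
by apply: zariski_type => //; rewrite card_mu.
Qed.
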